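(* Let $B$ be a fractional Brownian motion with Hurst index $H\in(0,\frac34)$. Set $$ \sigma^2_H=\frac12\sum_{t\in\mathbb Z}\big(|t+1|^{2H}+|t-1|^{2H}-2|t|^{2H}\big)^2<\infty, $$ and $$ Z_n=\frac{1}{\sigma_H \sqrt{n}}\sum_{k=0}^{n-1}\big(n^{2H}(B_{(k+1)/n}-B_{k/n})^2-1\big), \quad n\geq 1. $$ Then, as $n\rightarrow\infty$, $Z_n$ converges in law to $Z\sim\mathscr{N}(0,1)$. Moreover, there exists a constant $c_H$ (depending uniquely on $H$) such that, for any $n\geq 1$, $$ d_{\rm Kol}(Z_n,Z)\leq \frac{c_H}{n^{\frac12\wedge (\frac32-2H)}}. $$
   Context: A fractional Brownian motion $B=\{B_t:t\in[0,1]\}$ of Hurst index $H\in(0,1)$ is a centered Gaussian process started from zero with covariance $E(B_sB_t)=\frac12(t^{2H}+s^{2H}-|t-s|^{2H})$. The Kolmogorov distance is $d_{\rm Kol}(U,V)=\sup_{z\in\mathbb R}|P(U\leq z)-P(V\leq z)|$. $a\wedge b=\min(a,b)$. *)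

(* Defs.v *)
From HB Require Import structures.
From mathcomp Require Import all_boot all_order all_algebra.
From mathcomp Require Import all_classical all_reals all_analysis.
From mathcomp Require Import measurable_realfun.

Set Implicit Arguments.
Unset Strict Implicit.
Unset Printing Implicit Defensive.

Import Order.TTheory GRing.Theory Num.Theory.
Import numFieldNormedType.Exports.

Local Open Scope classical_set_scope.
Local Open Scope ring_scope.

(* Laws are compared on measurable sets only: [distribution] is a total
   function on all sets, with no meaning outside the sigma-algebra. *)
Definition has_law d (T : measurableType d) (R : realType)
    (P : probability T R) (X : {RV P >-> R}) (mu : set R -> \bar R) : Prop :=
  forall A : set R, measurable A -> distribution P X A = mu A.

(* The degenerate case is stated apart, since [normal_prob m 0] is not the
   Dirac mass at [m] but the uniform law on [0, 1]. *)
Definition gaussian_rv d (T : measurableType d) (R : realType)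
    (P : probability T R) (X : {RV P >-> R}) : Prop :=
  exists m : R,
    (exists2 s : R, 0 < s & has_law X (normal_prob m s)) \/ has_law X (dirac m).

(* A family indexed by [D] is Gaussian when every finite linear combination of
   its members is a Gaussian variable. *)
Definition gaussian_process d (T : measurableType d) (R : realType)
    (P : probability T R) (I : Type) (D : set I) (X : I -> {RV P >-> R}) : Prop :=
  forall (n : nat) (a : 'I_n -> R) (t : 'I_n -> I), (forall i, D (t i)) ->
    gaussian_rv (P := P)
      (\sum_(i < n) (a i \o* X (t i) : {mfun T >-> R})).

(* Only the restriction of [B] to the time interval [0, 1] is constrained; the
   values of [B] at other times are junk. *)
Record fractional_brownian_motion d (T : measurableType d) (R : realType)
    (P : probability T R) (H : R) (B : R -> {RV P >-> R}) : Prop := {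
  fbm_index : 0 < H < 1 ;
  fbm_gaussian : gaussian_process `[0, 1]%classic B ;
  fbm_centered : forall t : R, t \in `[0, 1] -> ('E_P[B t] = 0)%E ;
  fbm_start : {ae P, forall w, B 0 w = 0} ;
  fbm_covariance : forall s t : R, s \in `[0, 1] -> t \in `[0, 1] ->
    ('E_P[(B s \* B t)%R])%E =
      (2^-1 * (t `^ (2 * H) + s `^ (2 * H) - `|t - s| `^ (2 * H)))%:E }.

Definition sigma2 (R : realType) (H : R) : \bar R :=
  ((2^-1)%:E * \esum_(t in [set: int])
     ((`|t%:~R + 1| `^ (2 * H) + `|t%:~R - 1| `^ (2 * H)
       - 2 * `|t%:~R| `^ (2 * H)) ^+ 2)%:E)%E.

Definition sigma (R : realType) (H : R) : R := Num.sqrt (fine (sigma2 H)).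

Definition normalized_qvar d (T : measurableType d) (R : realType)
    (P : probability T R) (H : R) (B : R -> {RV P >-> R}) (n : nat) : T -> R :=
  fun w => (sigma H * Num.sqrt n%:R)^-1 *
    \sum_(k < n) (n%:R `^ (2 * H)
      * (B (k.+1%:R / n%:R) w - B (k%:R / n%:R) w) ^+ 2 - 1).

Lemma measurable_normalized_qvar d (T : measurableType d) (R : realType)
    (P : probability T R) (H : R) (B : R -> {RV P >-> R}) (n : nat) :
  measurable_fun [set: T] (normalized_qvar H B n).
Proof.
apply: measurable_funM => //; apply: measurable_sum => k.
apply: measurable_funB => //; apply: measurable_funM => //.
by apply: measurable_funX; apply: measurable_funB.
Qed.

HB.instance Definition _ d (T : measurableType d) (R : realType)
    (P : probability T R) (H : R) (B : R -> {RV P >-> R}) (n : nat) :=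
  isMeasurableFun.Build _ _ _ _ (normalized_qvar H B n)
    (measurable_normalized_qvar H B n).

(* [Z] may live on another probability space than the [X n]. *)
Definition cvg_in_law d (T : measurableType d) d' (T' : measurableType d')
    (R : realType) (P : probability T R) (Q : probability T' R)
    (X : nat -> {RV P >-> R}) (Z : {RV Q >-> R}) : Prop :=
  forall f : R -> R, continuous f -> bounded_fun f ->
    ('E_P[f \o X n] @[n --> \oo] --> 'E_Q[f \o Z])%E.

Definition dKol d (T : measurableType d) d' (T' : measurableType d')
    (R : realType) (P : probability T R) (Q : probability T' R)
    (U : {RV P >-> R}) (V : {RV Q >-> R}) : \bar R :=
  ereal_sup (range (fun z : R => `|cdf U z - cdf V z|%E)).

(* Main.v *)
Require Import Defs.
From HB Require Import structures.
From mathcomp Require Import all_boot all_order all_algebra.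
From mathcomp Require Import all_classical all_reals all_analysis.
From mathcomp Require Import measurable_realfun.
From mathcomp Require Import ring lra zify.

Set Implicit Arguments.
Unset Strict Implicit.
Unset Printing Implicit Defensive.

Import Order.TTheory GRing.Theory Num.Theory.
Import numFieldNormedType.Exports.

Local Open Scope classical_set_scope.
Local Open Scope ring_scope.

(** Let [X] be the vector of the [n] increments of the motion on the grid
    [k / n], rescaled to unit variance, [C] its covariance matrix and
    [a = 1 / (sigma sqrt n)]. The normalized quadratic variation is
    [F = a (|X|^2 - n)], and it is compared with a normal variable [N] by Stein's
    method.

    For a continuous [h] with values in [0, 1], the equation
    [f' - x f = h - E h(N)] has a C1 solution with [|f'| <= 2]
    ([stein_solution]). Integration by parts for [X] reads
    [E (F f(F)) = E (2 a^2 (X^T C X) f'(F))] ([sqnorm_ibp]); therefore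
    [|E h(F) - E h(N)| <= 2 E |1 - 2 a^2 X^T C X|] ([stein_bound]). This bound
    ignores the modulus of continuity of [h]. Applied to steep ramps it controls
    the Kolmogorov distance ([dKol_le]), and applied to rescaled bounded
    continuous functions it gives convergence in law ([cvg_in_law_of_bound]).

    The right-hand side is at most the distance from [1] to the mean of
    [2 a^2 X^T C X], plus its standard deviation. The quadratic form [X^T C X]
    has mean [tr C^2] and variance [2 tr C^4], and
    [tr C^4 <= K^2 tr C^2] when [K] bounds the absolute row sums of [C]
    ([schur_test]). So the standard deviation is of the order of [K / sqrt n].

    The entries of [C] are [rho |i - j|], where [rho] is half the second
    difference of [r^(2H)]. It has a constant sign from [r = 2] on, hence
    [sum |rho|] telescopes and [K] is of the order of [n^max(0, 2H - 1)]
    ([sum_abs_rho_le]); this produces the exponent [min(1/2, 3/2 - 2H)] of the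
    theorem. The error on the mean is an average of tails of [sum rho(r)^2], and
    has the same order because [sum r^rate rho(r)^2] is finite
    ([weighted_rho2_summable]).

    The hypothesis on the process only gives the laws of linear combinations
    [V] of the increments, that is [E cos(V) = exp(- Var V / 2)]. Differentiating
    this identity in the coefficients of [V] gives the moments of order four and
    integration by parts against trigonometric functions. Since
    [exp(- y^2 / 2)] is the average of [cos(g y)] over a standard normal [g],
    averaging extends the latter to [exp(- s |X|^2)] ([gaussian_laplace_ibp]),
    and Bernstein polynomials in the variable [exp(- |X|^2)] extend it to the
    functions of [|X|^2] with a bounded continuous derivative. *)

Notation itg mu f := (mu.-integrable [set: _] (EFin \o f)).

(** * Integrals of real-valued functions *)

Section real_integrals.
Context d (T : measurableType d) (R : realType) (mu : {measure set T -> \bar R}).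
Implicit Types (f g : T -> R).

Lemma itg_measurable f : itg mu f -> measurable_fun [set: T] f.
Proof. by case/integrableP => /measurable_EFinP. Qed.

Lemma itg_dom f g : measurable_fun [set: T] f -> (forall x, `|f x| <= g x) ->
  itg mu g -> itg mu f.
Proof.
move=> mf fg; apply: le_integrable => //; first exact/measurable_EFinP.
move=> x _ /=; rewrite lee_fin; apply: le_trans (fg x) _; exact: ler_norm.
Qed.

Lemma itg_norm f : itg mu f -> itg mu (fun x => `|f x|).
Proof.
move=> fi; have mf := itg_measurable fi; apply: le_integrable fi => //.
  by apply/measurable_EFinP; exact: measurableT_comp.
by move=> x _ /=; rewrite lee_fin normr_id.
Qed.

Lemma itgD f g : itg mu f -> itg mu g -> itg mu (fun x => f x + g x).
Proof. by move=> fi gi; exact: (integrableD _ fi gi). Qed.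

Lemma itgB f g : itg mu f -> itg mu g -> itg mu (fun x => f x - g x).
Proof. by move=> fi gi; exact: (integrableB _ fi gi). Qed.

Lemma itgZ k f : itg mu f -> itg mu (fun x => k * f x).
Proof. by move=> fi; exact: (integrableZl measurableT k fi). Qed.

Lemma itgN f : itg mu f -> itg mu (fun x => - f x).
Proof. by move=> fi; exact: (integrableN fi). Qed.

Lemma itg0 : itg mu (fun=> 0 : R).
Proof. exact: integrable0. Qed.

Lemma itg_sum (I : Type) (r : seq I) (p : pred I) (F : I -> T -> R) :
  (forall i, itg mu (F i)) -> itg mu (fun x => \sum_(i <- r | p i) F i x).
Proof.
move=> Fi; elim: r => [|i r IH].
  by under eq_fun do rewrite big_nil; exact: itg0.
under eq_fun do rewrite big_cons.
by case: (p i) => //; exact: itgD.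
Qed.

Lemma Rintegral_sum (I : Type) (r : seq I) (p : pred I) (F : I -> T -> R) :
  (forall i, itg mu (F i)) ->
  \int[mu]_x (\sum_(i <- r | p i) F i x) = \sum_(i <- r | p i) \int[mu]_x F i x.
Proof.
move=> Fi; elim: r => [|i r IH].
  under eq_Rintegral do rewrite big_nil.
  by rewrite big_nil /Rintegral integral0.
rewrite big_cons -IH.
under eq_Rintegral do rewrite big_cons.
by case: (p i) => //; rewrite RintegralD//; exact: itg_sum.
Qed.

Lemma dominated_convergence_R (F : (T -> R)^nat) f g :
  (forall n, measurable_fun [set: T] (F n)) -> measurable_fun [set: T] f ->
  (forall x, F n x @[n --> \oo] --> f x) -> itg mu g ->
  (forall n x, `|F n x| <= g x) ->
  \int[mu]_x F n x @[n --> \oo] --> \int[mu]_x f x.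
Proof.
move=> mF mf Ff gi Fg.
have [fi _ c] : [/\ itg mu f, True & (\int[mu]_x (F n x)%:E)%E @[n --> \oo] -->
    (\int[mu]_x (f x)%:E)%E].
  have := @dominated_convergence _ _ _ mu _ measurableT
    (fun n => EFin \o F n) (EFin \o f) (EFin \o g).
  case=> //.
  - by move=> n; exact/measurable_EFinP.
  - exact/measurable_EFinP.
  - by apply: aeW => x _; apply/fine_cvgP; split; [exact: nearW|exact: Ff].
  - by apply: aeW => x n _; rewrite /= lee_fin.
apply: fine_cvg; rewrite fineK//.
by apply: integrable_fin_num.
Qed.

End real_integrals.

Section bounded_itg.
Context d (T : measurableType d) (R : realType) (P : probability T R).
Lemma itg_bounded (f : T -> R) (M : R) : measurable_fun [set: T] f ->
  (forall x, `|f x| <= M) -> itg P f.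
Proof.
move=> mf fM; apply: (itg_dom mf fM).
exact: (finite_measure_integrable_cst P M).
Qed.

Lemma itg_cst (k : R) : itg P (fun=> k).
Proof. exact: (finite_measure_integrable_cst P k). Qed.

Lemma Rintegral_prob_cst (k : R) : \int[P]_x k = k.
Proof. by rewrite Rintegral_cst// [X in fine X](probability_setT P) /= mulr1. Qed.
End bounded_itg.

Section normal_density.
Context (R : realType).
Notation mu := (@lebesgue_measure R).
Variables (m s : R).

(** The density is a Radon-Nikodym derivative of the law, and two such
    derivatives agree almost everywhere. *)
Lemma ge0_integral_normal_prob (f : R -> \bar R) :
  measurable_fun [set: R] f -> (forall x, 0 <= f x)%E ->
  (\int[normal_prob m s]_x f x = \int[mu]_x (f x * (normal_pdf m s x)%:E))%E.
Proof.
move=> mf f0; have dom := normal_prob_dominates m s.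
rewrite -(Radon_Nikodym_SigmaFinite.change_of_variables dom f0 measurableT mf).
apply: ae_eq_integral => //.
- apply: emeasurable_funM => //; apply: (measurable_int mu).
  exact: Radon_Nikodym_SigmaFinite.f_integrable.
- apply: emeasurable_funM => //; apply/measurable_EFinP.
  exact: measurable_normal_pdf.
- apply: ae_eqe_mul2l.
  apply: integral_ae_eq => //=.
  + exact: Radon_Nikodym_SigmaFinite.f_integrable.
  + by apply/measurable_EFinP; exact: measurable_normal_pdf.
  + move=> E _ mE.
    by rewrite -Radon_Nikodym_SigmaFinite.f_integral.
Qed.

Lemma itg_normal_prob (f : R -> R) :
  measurable_fun [set: R] f -> itg mu (fun x => f x * normal_pdf m s x) ->
  itg (normal_prob m s) f.
Proof.
move=> mf /integrableP[_ fi]; apply/integrableP; split; first exact/measurable_EFinP.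
rewrite ge0_integral_normal_prob//; last first.
  by apply/measurable_EFinP; apply: measurableT_comp.
apply: le_lt_trans fi; rewrite le_eqVlt; apply/orP; left; apply/eqP.
apply: eq_integral => x _ /=.
by rewrite normrM [X in _ = (_ * X)%:E]ger0_norm// normal_pdf_ge0.
Qed.

Lemma Rintegral_normal_prob (f : R -> R) :
  measurable_fun [set: R] f -> itg mu (fun x => f x * normal_pdf m s x) ->
  \int[normal_prob m s]_x f x = \int[mu]_x (f x * normal_pdf m s x).
Proof.
move=> mf fi; congr fine.
rewrite [LHS]integralE [RHS]integralE; congr (_ - _)%E.
- rewrite ge0_integral_normal_prob//; last by apply: measurable_funepos; exact/measurable_EFinP.
  apply: eq_integral => x _; rewrite !funeposE /=.
  by rewrite -!EFin_max -EFinM maxr_pMl ?normal_pdf_ge0// mul0r.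
- rewrite ge0_integral_normal_prob//; last by apply: measurable_funeneg; exact/measurable_EFinP.
  apply: eq_integral => x _; rewrite !funenegE /=.
  by rewrite -!EFin_max -EFinM maxr_pMl ?normal_pdf_ge0// mul0r mulNr.
Qed.

End normal_density.

(** * Integration by parts against the normal density *)

Section fundamental_theorem_line.
Context (R : realType).
Notation mu := (@lebesgue_measure R).

(** The fundamental theorem of calculus on [[-n, n]], followed by dominated
    convergence. *)
Lemma Rintegral_derive_vanishing (F f : R -> R) :
  (forall x, is_derive x (1 : R) F (f x)) -> continuous f -> itg mu f ->
  F n%:R @[n --> \oo] --> 0 -> F (- n%:R) @[n --> \oo] --> 0 ->
  \int[mu]_x f x = 0.
Proof.
move=> dF cf fi Fy FNy.
have mf := itg_measurable fi.
pose g (n : nat) := f \_ `[- n.+1%:R, n.+1%:R].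
have gE n : \int[mu]_x g n x = F n.+1%:R - F (- n.+1%:R).
  rewrite -Rintegral_mkcond /Rintegral.
  rewrite (@continuous_FTC2 _ f F) //.
  - by rewrite ltrNl (@lt_trans _ _ 0) // ?oppr_lt0.
  - exact: continuous_subspaceT.
  - have cF : continuous F by move=> x; apply/differentiable_continuous/derivable1_diffP; case: (dF x).
    split; [by move=> x _; case: (dF x) | exact/cvg_at_right_filter/cF | exact/cvg_at_left_filter/cF].
  - by move=> x _; rewrite derive1E; case: (dF x).
have c1 : \int[mu]_x g n x @[n --> \oo] --> \int[mu]_x f x.
  have := @dominated_convergence_R _ _ _ mu g f (fun x => `|f x|); apply => //.
  - by move=> n; apply/(measurable_restrict _ _ _) => //; exact: measurable_funTS.
  - move=> x; apply: cvg_near_cst; near=> n.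
    rewrite /g patchE mem_set //= in_itv /= -ler_norml.
    apply: (@le_trans _ _ n%:R); last by rewrite ler_nat.
    by near: n; exact: nbhs_infty_ger.
  - exact: itg_norm.
  - move=> n x; rewrite /g patchE; case: ifP => // _; by rewrite normr0.
have c2 : \int[mu]_x g n x @[n --> \oo] --> (0 : R).
  under eq_fun do rewrite gE.
  rewrite -cvg_shiftS in Fy; rewrite -cvg_shiftS in FNy.
  have h := cvgB Fy FNy. rewrite subr0 in h.
 exact: h.
exact: (cvg_unique _ c1 c2).
Unshelve. all: by end_near. Qed.

End fundamental_theorem_line.

Section gaussian_integrals.
Context (R : realType).
Notation mu := (@lebesgue_measure R).
Variables (m s : R).
Hypothesis s0 : 0 < s.
Notation pdf := (normal_pdf m s).

(** Doubling the standard deviation absorbs a factor of degree four: all the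
    integrands below are dominated by a multiple of a normal density. *)
Lemma normal_fun_pow4 x :
  (1 + (x - m) ^+ 4) * normal_fun m s x <= (1 + 15 * s ^+ 4) * normal_fun m (2 * s) x.
Proof.
(* The two normal functions are [exp(- 4 u)] and [exp(- u)]. *)
pose u := (x - m) ^+ 2 / (8 * s ^+ 2).
have u0 : 0 <= u by rewrite /u divr_ge0 ?sqr_ge0// mulr_ge0// sqr_ge0.
have s'0 : s != 0 by rewrite gt_eqF.
have -> : normal_fun m s x = expR (- (3 * u)) * expR (- u).
  by rewrite -expRD /normal_fun; congr expR; rewrite /u; field.
have -> : normal_fun m (2 * s) x = expR (- u).
  by rewrite /normal_fun; congr expR; rewrite /u; field.
rewrite mulrA ler_wpM2r ?expR_ge0// expRN ler_pdivrMr ?expR_gt0//.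
have -> : (x - m) ^+ 4 = 64 * s ^+ 4 * u ^+ 2 by rewrite /u; field.
have h3 : 0 <= 3 * u by rewrite mulr_ge0.
have /= := expR_ge1Dxn 1 h3; rewrite (_ : 2`!%:R = 2 :> R) // => h.
have s4 : 0 <= s ^+ 4 by rewrite exprn_ge0// ltW.
have u2 : 0 <= u ^+ 2 by rewrite sqr_ge0.
set E := expR _ in h *.
have h1 : 1 + 9 / 2 * u ^+ 2 <= E by apply: le_trans h; rewrite le_eqVlt; apply/orP; left; apply/eqP; field.
have : 64 * u ^+ 2 <= 15 * E by lra.
move=> /(ler_wpM2l s4); nra.
Qed.

Lemma normal_pdf_pow4 x :
  (1 + (x - m) ^+ 4) * pdf x <=
    (1 + 15 * s ^+ 4) * normal_peak s / normal_peak (2 * s) * normal_pdf m (2 * s) x.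
Proof.
have s'0 : s != 0 by rewrite gt_eqF.
have s2 : 2 * s != 0 by rewrite mulf_neq0.
rewrite !normal_pdfE//.
have p0 : 0 < normal_peak (2 * s) by exact: normal_peak_gt0.
have -> : (1 + 15 * s ^+ 4) * normal_peak s / normal_peak (2 * s) *
  (normal_peak (2 * s) * normal_fun m (2 * s) x) = normal_peak s * ((1 + 15 * s ^+ 4) *
    normal_fun m (2 * s) x) by field; rewrite gt_eqF.
rewrite mulrCA ler_wpM2l ?normal_peak_ge0//; exact: normal_fun_pow4.
Qed.

Lemma itg_mul_normal_pdf (g : R -> R) (K : R) : measurable_fun [set: R] g ->
  (forall x, `|g x| <= K * (1 + (x - m) ^+ 4)) -> itg mu (fun x => g x * pdf x).
Proof.
move=> mg gK; set C := (1 + 15 * s ^+ 4) * normal_peak s / normal_peak (2 * s).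
apply: (@itg_dom _ _ _ mu _ (fun x => `|K| * (C * normal_pdf m (2 * s) x))).
- by apply: measurable_funM => //; exact: measurable_normal_pdf.
- move=> x; rewrite normrM (ger0_norm (normal_pdf_ge0 _ _ _)).
  apply: (@le_trans _ _ (`|K| * (1 + (x - m) ^+ 4) * pdf x)).
    rewrite ler_wpM2r ?normal_pdf_ge0//; apply: le_trans (gK x) _.
    by rewrite ler_wpM2r ?ler_norm// addr_ge0// exprn_even_ge0.
  by rewrite -mulrA ler_wpM2l// normal_pdf_pow4.
- by do 2 apply: itgZ; exact: integrable_normal_pdf.
Qed.

Lemma is_derive_normal_pdf x : is_derive x (1 : R) pdf (- ((x - m) / s ^+ 2) * pdf x).
Proof.
have s'0 : s != 0 by rewrite gt_eqF.
rewrite normal_pdfE//.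
rewrite /normal_fun.
apply: is_derive_eq.
by rewrite /GRing.scale /=; field.
Qed.

(** A crude rate, enough to discard the boundary terms of the integrations by
    parts. *)
Lemma normal_pdf_decay (g : R -> R) (K : R) :
  (forall x, `|g x| <= K * (1 + `|x - m|)) ->
  exists C, forall x, 1 <= `|x - m| -> `|g x * pdf x| <= C / `|x - m|.
Proof.
move=> gK; have s'0 : s != 0 by rewrite gt_eqF.
set C := (1 + 15 * s ^+ 4) * normal_peak s.
exists (2 * `|K| * C) => x x1; set y := `|x - m| in x1 *.
have y0 : 0 < y by rewrite (lt_le_trans _ x1).
have pb : (1 + y ^+ 4) * pdf x <= C.
  have : (1 + (x - m) ^+ 4) * normal_fun m s x <= 1 + 15 * s ^+ 4.
    apply: le_trans (normal_fun_pow4 x) _.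
    rewrite ler_piMr //; first by rewrite addr_ge0// mulr_ge0// exprn_ge0// ltW.
    rewrite /normal_fun -[leRHS]expR0 ler_expR mulNr oppr_le0 divr_ge0 ?sqr_ge0//.
    by rewrite mulrn_wge0 ?sqr_ge0.
  have -> : y ^+ 4 = (x - m) ^+ 4 by rewrite /y -normrX ger0_norm// exprn_even_ge0.
  move=> /(ler_wpM2r (normal_peak_ge0 s)); rewrite -/C normal_pdfE//.
  by rewrite -mulrA [normal_fun _ _ _ * _]mulrC.
have p0 := normal_pdf_ge0 m s x.
rewrite normrM (ger0_norm p0) ler_pdivlMr//.
apply: (@le_trans _ _ (`|K| * (2 * (y ^+ 4 * pdf x)))).
  have gy : `|g x| <= `|K| * (2 * y).
    apply: le_trans (gK x) _; apply: (@le_trans _ _ (`|K| * (1 + y))).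
      by rewrite ler_wpM2r ?ler_norm// addr_ge0// ltW.
    by rewrite ler_wpM2l//; lra.
  have : y * y <= y ^+ 4.
    rewrite -expr2; apply: ler_weXn2l => //.
  move=> hy.
  have := ler_wpM2r (mulr_ge0 (ltW y0) p0) gy => h.
  have h2 : y * y * pdf x <= y ^+ 4 * pdf x by rewrite ler_wpM2r.
  have h3 := ler_wpM2l (normr_ge0 K) h2.
  have -> : `|g x| * pdf x * y = `|g x| * (y * pdf x) by ring.
  apply: le_trans h _; lra.
have : y ^+ 4 * pdf x <= C by apply: le_trans pb; lra.
move=> /(ler_wpM2l (normr_ge0 K)); lra.
Qed.

(** Meant for [v n = n] and [v n = - n], the two ends of the line. *)
Lemma cvg_inv_norm_shift (C : R) (v : nat -> R) : (forall n, `|v n| = n%:R) ->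
  (forall u : nat -> R, (forall n, 1 <= `|v n - m| -> `|u n| <= C / `|v n - m|) ->
  u n @[n --> \oo] --> 0).
Proof.
move=> vn u hu; apply/cvgrPdist_le => e e0.
near=> n; rewrite sub0r normrN.
have hn : `|m| + 1 + `|C| / e <= n%:R by near: n; exact: nbhs_infty_ger.
have h1 : 1 + `|C| / e <= `|v n - m|.
  by have := lerB_dist (v n) m; rewrite vn; lra.
have Ce : 0 <= `|C| / e by rewrite divr_ge0// ltW.
apply: le_trans (hu n _) _; first lra.
rewrite ler_pdivrMr; last lra.
apply: (@le_trans _ _ `|C|); first exact: ler_norm.
have : `|C| / e * e <= `|v n - m| * e by rewrite ler_wpM2r ?ltW//; lra.
by rewrite divfK ?gt_eqF//; lra.
Unshelve. all: by end_near. Qed.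

(** The derivative of [g * pdf] is [(dg - (x - m) / s^2 * g) * pdf], and its
    integral over the line vanishes. *)
Lemma gaussian_integration_by_parts (g dg : R -> R) (K : R) :
  (forall x, is_derive x (1 : R) g (dg x)) -> continuous dg ->
  (forall x, `|g x| <= K * (1 + `|x - m|)) ->
  (forall x, `|dg x| <= K) ->
  \int[mu]_x ((x - m) * g x * pdf x) = s ^+ 2 * \int[mu]_x (dg x * pdf x).
Proof.
move=> Dg cdg gK dgK; have s'0 : s != 0 by rewrite gt_eqF.
have cg : continuous g.
  by move=> x; apply/differentiable_continuous/derivable1_diffP; case: (Dg x).
have mg : measurable_fun [set: R] g by exact: continuous_measurable_fun.
have mdg : measurable_fun [set: R] dg by exact: continuous_measurable_fun.
have K0 : 0 <= K by apply: le_trans (dgK 0).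
have i1 : itg mu (fun x => (x - m) * g x * pdf x).
  apply: (@itg_mul_normal_pdf _ (2 * K)).
    by apply: measurable_funM => //; exact: measurable_funB.
  move=> x; rewrite normrM.
  have y0 : 0 <= `|x - m| by [].
  have -> : (x - m) ^+ 4 = `|x - m| ^+ 4 by rewrite -normrX ger0_norm// exprn_even_ge0.
  apply: (@le_trans _ _ (`|x - m| * (K * (1 + `|x - m|)))); first by rewrite ler_wpM2l.
  rewrite mulrCA [2 * K]mulrC -mulrA ler_wpM2l//.
  move: y0; set y := `|x - m| => y0; have h1 : y <= 1 + y ^+ 4.
    have [|] := leP y 1; first by have := exprn_ge0 4 y0; lra.
    by move=> /ltW y1; have := ler_eXn2l; have := exprn_ege1 3 y1; rewrite exprS; nra.
  have h2 : y ^+ 2 <= 1 + y ^+ 4 by have := sqr_ge0 (y ^+ 2 - 1); rewrite sqrrB1 -exprM; have := sqr_ge0 y; lra.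
  by rewrite mulrDr mulr1 -expr2; lra.
have i2 : itg mu (fun x => dg x * pdf x).
  apply: (@itg_mul_normal_pdf _ K) => // x; apply: le_trans (dgK x) _.
  by rewrite ler_peMr// lerDl exprn_even_ge0.
have [C HC] := normal_pdf_decay gK.
pose f x := dg x * pdf x - (s ^+ 2)^-1 * ((x - m) * g x * pdf x).
have If : \int[mu]_x f x = 0.
  apply: (@Rintegral_derive_vanishing _ (fun x => g x * pdf x)).
  - move=> x; have D1 := Dg x; have D2 := is_derive_normal_pdf x.
    apply: is_derive_eq; rewrite /f /GRing.scale /=; by field.
  - have cpdf : continuous pdf by exact: continuous_normal_pdf.
    move=> x; apply: cvgB; first by apply: cvgM; [exact: cdg|exact: cpdf].
    apply: cvgM; first exact: cvg_cst.
    apply: cvgM; last exact: cpdf.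
    by apply: cvgM; [apply: cvgB; [exact: cvg_id|exact: cvg_cst]|exact: cg].
  - by apply: itgB => //; exact: itgZ.
  - by apply: (@cvg_inv_norm_shift C (fun n => n%:R)) => [n|n]; [rewrite normr_nat|exact: HC].
  - by apply: (@cvg_inv_norm_shift C (fun n => - n%:R)) => [n|n]; [rewrite normrN normr_nat|exact: HC].
move: If; rewrite /f RintegralB//; last exact: itgZ.
rewrite RintegralZl// => /subr0_eq ->.
by rewrite mulrA divff ?mul1r// expf_neq0.
Qed.

End gaussian_integrals.

(** * One-dimensional Gaussian laws *)

Section differentiation_of_integrals.
Context d (T : measurableType d) (R : realType) (mu : {measure set T -> \bar R}).

(** The domination is uniform over all parameters, so that the derivative exists
    at every one of them and the result can be iterated. *)
Lemma is_derive_Rintegral (f df : R -> T -> R) (G : T -> R) :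
  (forall t, itg mu (f t)) -> (forall t y, is_derive t (1 : R) (f ^~ y) (df t y)) ->
  itg mu G -> (forall t y, `|df t y| <= G y) ->
  forall a, is_derive a (1 : R) (fun t => \int[mu]_y f t y) (\int[mu]_y df a y).
Proof.
move=> fi fdf Gi dfG a.
have Ia : `](a - 1), (a + 1)[%classic a by rewrite /= in_itv /= ltrDl ltr01 ltrBlDr ltrDl ltr01.
have dE t y : partial1of2 f t y = df t y.
  by rewrite partial1of2E; case: (fdf t y).
have G0 y : 0 <= G y by apply: le_trans (dfG 0 y).
have D1 : forall x y, `](a - 1), (a + 1)[%classic x -> [set: T] y ->
    derivable (f ^~ y) x 1 by move=> x y _ _; case: (fdf x y).
have D2 : forall x y, `](a - 1), (a + 1)[%classic x -> [set: T] y ->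
    `|partial1of2 f x y| <= G y by move=> x y _ _; rewrite dE.
have fi' : forall x, `](a - 1), (a + 1)[%classic x -> mu.-integrable [set: T] (EFin \o f x).
  by move=> x _; exact: fi.
apply: DeriveDef.
  exact: (derivable_under_integral measurableT Ia fi' D1 G0 Gi D2).
rewrite -derive1E (differentiation_under_integral measurableT Ia fi' D1 G0 Gi D2).
by apply: eq_Rintegral => y _; rewrite dE.
Qed.

End differentiation_of_integrals.

Section gaussian_characteristic_function.
Context (R : realType).
Notation mu := (@lebesgue_measure R).
Variables (m s : R).
Hypothesis s0 : 0 < s.
Notation pdf := (normal_pdf m s).

Let y_le (y : R) : `|y| <= 1 + y ^+ 4.
Proof.
have -> : y ^+ 4 = `|y| ^+ 4 by rewrite -normrX ger0_norm// exprn_even_ge0.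
have y0 : 0 <= `|y| by []; move: y0; set z := `|y| => z0.
have [z1|/ltW z1] := leP z 1; first by have := exprn_ge0 4 z0; lra.
by have := exprn_ege1 3 z1; rewrite exprS; nra.
Qed.

(** As a function of [t] the integral solves [h' = - s^2 t h]: differentiate
    under the integral sign, then integrate by parts. *)
Lemma gaussian_cos (t : R) :
  \int[mu]_x (cos (t * (x - m)) * pdf x) = expR (- (s ^+ 2 * t ^+ 2 / 2)).
Proof.
pose f t x := cos (t * (x - m)) * pdf x.
pose df t x := - ((x - m) * sin (t * (x - m)) * pdf x).
pose h t := \int[mu]_x f t x.
have mlin (u : R) : measurable_fun [set: R] (fun x : R => u * (x - m)).
  by apply: measurable_funM => //; exact: measurable_funB.
have mc u : measurable_fun [set: R] (fun x : R => cos (u * (x - m))).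
  by apply: measurableT_comp => //; apply: continuous_measurable_fun; exact: continuous_cos.
have fi u : itg mu (f u).
  apply: (@itg_mul_normal_pdf _ _ _ _ _ 1) => // x; apply: le_trans (cos_max _) _.
  by rewrite mul1r lerDl exprn_even_ge0.
have Gi : itg mu (fun x => `|x - m| * pdf x).
  apply: (@itg_mul_normal_pdf _ _ _ _ _ 1) => //.
    by apply: measurableT_comp => //; exact: measurable_funB.
  by move=> x; rewrite normr_id mul1r y_le.
have D u : is_derive u (1 : R) h (\int[mu]_x df u x).
  apply: (@is_derive_Rintegral _ _ _ mu f df (fun x => `|x - m| * pdf x)) => //.
  - by move=> v y; apply: is_derive_eq; rewrite /df /GRing.scale /=; ring.
  - move=> v y; rewrite /df normrN !normrM (ger0_norm (normal_pdf_ge0 _ _ _)).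
    by rewrite ler_wpM2r ?normal_pdf_ge0// ler_piMr// sin_max.
have E u : \int[mu]_x df u x = - (s ^+ 2 * u * h u).
  rewrite /df /h /f.
  have -> : \int[mu]_x - ((x - m) * sin (u * (x - m)) * pdf x) =
    - \int[mu]_x ((x - m) * sin (u * (x - m)) * pdf x).
    under eq_Rintegral do rewrite -mulN1r.
    rewrite RintegralZl ?mulN1r//.
    apply: (@itg_mul_normal_pdf _ _ _ _ _ 1) => //.
      apply: measurable_funM => //; first exact: measurable_funB.
      by apply: measurableT_comp => //; apply: continuous_measurable_fun; exact: continuous_sin.
    move=> x; rewrite normrM mul1r; apply: le_trans (y_le _).
    by rewrite ler_piMr// sin_max.
  have Ds x : is_derive x (1 : R) (fun x => sin (u * (x - m))) (u * cos (u * (x - m))).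
    by apply: is_derive_eq; rewrite /GRing.scale /=; ring.
  rewrite (@gaussian_integration_by_parts _ _ _ s0 (fun x => sin (u * (x - m)))
    (fun x => u * cos (u * (x - m))) (1 + `|u|) Ds) //.
  - under eq_Rintegral do rewrite -mulrA.
    by rewrite RintegralZl ?mulrA//; exact: (fi u).
  - move=> x; apply: cvgM; first exact: cvg_cst.
    apply: (cvg_comp _ cos); last exact: continuous_cos.
    by apply: cvgM; [exact: cvg_cst|apply: cvgB; [exact: cvg_id|exact: cvg_cst]].
  - move=> x; apply: le_trans (sin_max _) _.
    by rewrite -[leLHS]mulr1 ler_pM// lerDl.
  - move=> x; rewrite normrM; apply: (@le_trans _ _ `|u|); last by rewrite lerDr.
    by rewrite ler_piMr// cos_max.
pose k u := h u * expR (s ^+ 2 * u ^+ 2 / 2).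
have Dk u : is_derive u (1 : R) k 0.
  have Du := D u; rewrite E in Du.
  by apply: is_derive_eq; rewrite /GRing.scale /=; field.
have := is_derive_0_is_cst t 0 Dk.
rewrite /k expr0n /= mulr0 mul0r expR0 mulr1 => kt.
have h0 : h 0 = 1.
  rewrite /h /f; under eq_Rintegral do rewrite mul0r cos0 mul1r.
  by rewrite /Rintegral integral_normal_pdf.
rewrite h0 in kt; rewrite -[LHS]/(h t) expRN; apply: (mulIf (lt0r_neq0 (expR_gt0 (s ^+ 2 * t ^+ 2 / 2)))).
by rewrite mulVf ?gt_eqF ?expR_gt0.
Qed.

Lemma gaussian_mean : \int[mu]_x ((x - m) * pdf x) = 0.
Proof.
have D (x : R) : is_derive x (1 : R) (fun=> 1 : R) 0 by exact: is_derive_cst.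
have c : continuous (fun _ : R => 0 : R) by exact: cst_continuous.
have b1 (x : R) : `|1 : R| <= 1 * (1 + `|x - m|) by rewrite normr1 mul1r lerDl.
have b2 (x : R) : `|0 : R| <= 1 by rewrite normr0.
have := @gaussian_integration_by_parts _ m s s0 _ _ 1 D c b1 b2.
under eq_Rintegral do rewrite mulr1.
move=> ->; under eq_Rintegral do rewrite mul0r.
by rewrite /Rintegral integral0 mulr0.
Qed.

Lemma gaussian_variance : \int[mu]_x ((x - m) ^+ 2 * pdf x) = s ^+ 2.
Proof.
have D (x : R) : is_derive x (1 : R) (fun x => x - m) 1.
  by apply: is_derive_eq; rewrite subr0.
have c : continuous (fun _ : R => 1 : R) by exact: cst_continuous.
have b1 (x : R) : `|x - m| <= 1 * (1 + `|x - m|) by rewrite mul1r lerDr.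
have b2 (x : R) : `|1 : R| <= 1 by rewrite normr1.
have := @gaussian_integration_by_parts _ m s s0 _ _ 1 D c b1 b2.
under eq_Rintegral do rewrite -expr2.
move=> ->; under eq_Rintegral do rewrite mul1r.
by rewrite /Rintegral integral_normal_pdf mulr1.
Qed.

End gaussian_characteristic_function.

Section laws.
Context d (T : measurableType d) (R : realType) (P : probability T R).
Variables (X : {RV P >-> R}) (mu : probability (measurableTypeR R) R).
Hypothesis Xmu : forall A, measurable A -> distribution P X A = mu A.

(** [X] with the sigma-algebra of its codomain presented as the one that carries
    Lebesgue measure, hence the normal laws. *)
Let X' : T -> measurableTypeR R := X.

Let mX' : measurable_fun [set: T] X'.
Proof. exact: (measurable_funPT X). Qed.

HB.instance Definition _ := isMeasurableFun.Build _ _ _ _ X' mX'.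

Let ge0_integral_has_law (f : R -> \bar R) :
  measurable_fun [set: measurableTypeR R] f ->
  (forall x, 0 <= f x)%E -> (\int[P]_w f (X w) = \int[mu]_x f x)%E.
Proof.
move=> mf f0; rewrite -[LHS](ge0_integral_pushforward mX' P measurableT mf)//.
by apply: eq_measure_integral => A mA _; exact: Xmu.
Qed.

Lemma itg_has_law (f : R -> R) : itg mu f -> itg P (f \o X).
Proof.
move=> fi; have mf := itg_measurable fi; case/integrableP: fi => _ fi.
apply/integrableP; split; first by apply/measurable_EFinP; exact: (measurableT_comp mf mX').
have := @ge0_integral_has_law (fun x => `|(f x)%:E|%E).
rewrite /comp => -> //; apply: measurableT_comp => //; exact/measurable_EFinP.
Qed.

Lemma Rintegral_has_law (f : R -> R) : itg mu f ->
  \int[P]_w f (X w) = \int[mu]_x f x.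
Proof.
move=> fi; have mf := itg_measurable fi.
have mf' : measurable_fun [set: measurableTypeR R] (EFin \o f) by exact/measurable_EFinP.
congr fine.
rewrite -[LHS](integral_pushforward mX' mf' _ measurableT); last exact: itg_has_law.
by apply: eq_measure_integral => A mA _; exact: Xmu.
Qed.

End laws.

Section normal_probability_integrals.
Context (R : realType).

Lemma itg_normal_prob_pow4 (m s : R) (g : R -> R) (K : R) : 0 < s ->
  measurable_fun [set: R] g -> (forall x, `|g x| <= K * (1 + (x - m) ^+ 4)) ->
  itg (normal_prob m s) g.
Proof.
move=> s0 mg gK; apply: itg_normal_prob => //; exact: (itg_mul_normal_pdf s0 mg gK).
Qed.

Lemma Rintegral_normal_prob_pow4 (m s : R) (g : R -> R) (K : R) : 0 < s ->
  measurable_fun [set: R] g -> (forall x, `|g x| <= K * (1 + (x - m) ^+ 4)) ->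
  \int[normal_prob m s]_x g x = \int[lebesgue_measure]_x (g x * normal_pdf m s x).
Proof.
move=> s0 mg gK; apply: Rintegral_normal_prob => //; exact: (itg_mul_normal_pdf s0 mg gK).
Qed.

Lemma measurable_cos : measurable_fun [set: R] (@cos R).
Proof. by apply: continuous_measurable_fun; exact: continuous_cos. Qed.

Lemma measurable_sin : measurable_fun [set: R] (@sin R).
Proof. by apply: continuous_measurable_fun; exact: continuous_sin. Qed.

End normal_probability_integrals.

Section centered_gaussian_variable.
Context d (T : measurableType d) (R : realType) (P : probability T R).
Variable X : {RV P >-> R}.

Let Rintegral_dirac (m : R) (f : R -> R) : measurable_fun [set: R] f ->
  \int[@dirac _ (measurableTypeR R) m R]_x f x = f m.
Proof.
move=> mf; rewrite /Rintegral integral_dirac//; last exact/measurable_EFinP.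
by rewrite diracT mul1e.
Qed.

Let itg_dirac (m : R) (f : R -> R) : measurable_fun [set: measurableTypeR R] f ->
  itg (@dirac _ (measurableTypeR R) m R) f.
Proof.
move=> mf; apply/integrableP; split; first exact/measurable_EFinP.
rewrite integral_dirac//; first by rewrite diracT mul1e ltry.
by apply: measurableT_comp => //; exact/measurable_EFinP.
Qed.

(** The two consequences of Gaussianity on which everything rests. Degenerate
    laws satisfy them too, the identity being then [cos 0 = exp 0]. *)
Lemma centered_gaussian : gaussian_rv X -> 'E_P[X]%E = 0%E ->
  itg P (fun w => X w ^+ 4) /\
  \int[P]_w cos (X w) = expR (- (\int[P]_w (X w ^+ 2) / 2)).
Proof.
move=> [m [[s s0 Xms]|Xm]] EX.
- pose mu : probability (measurableTypeR R) R := normal_prob m s.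
  have Xmu : forall A, measurable A -> distribution P X A = mu A by exact: Xms.
  have p4 k (x : R) : (k <= 4)%N -> `|(x - m) ^+ k| <= 1 * (1 + (x - m) ^+ 4).
    move=> k4; rewrite mul1r normrX.
    have -> : (x - m) ^+ 4 = `|x - m| ^+ 4 by rewrite -normrX ger0_norm// exprn_even_ge0.
    have [h|/ltW h] := leP `|x - m| 1.
      by rewrite ler_wpDr ?exprn_ge0// exprn_ile1.
    by rewrite ler_wpDl// ler_weXn2l.
  have mid : measurable_fun [set: R] (fun x : R => x - m) by exact: measurable_funB.
  have i1 : itg mu (fun x => x - m).
    by apply: (@itg_normal_prob_pow4 _ m s _ 1) => // x; have := @p4 1%N x isT.
  have m0 : m = 0.
    have : \int[P]_w X w = 0 by move: EX; rewrite unlock /Rintegral => ->.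
    have -> : \int[P]_w X w = \int[P]_w ((X w - m) + m).
      by apply: eq_Rintegral => w _; rewrite subrK.
    have iXm : itg P (fun w => X w - m) by exact: (itg_has_law Xmu i1).
    rewrite RintegralD//; last exact: itg_cst.
    rewrite Rintegral_prob_cst (Rintegral_has_law Xmu i1).
    rewrite (@Rintegral_normal_prob_pow4 _ m s _ 1)//; last by move=> x; have := @p4 1%N x isT.
    by rewrite gaussian_mean// add0r.
  rewrite m0 in mu Xmu p4 mid i1 *.
  have mX k : measurable_fun [set: R] (fun x : R => x ^+ k) by exact: measurable_funX.
  have bX k (x : R) : (k <= 4)%N -> `|x ^+ k| <= 1 * (1 + (x - 0) ^+ 4).
    by move=> k4; have := p4 k x k4; rewrite subr0.
  have i4 : itg mu (fun x => x ^+ 4).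
    by apply: (@itg_normal_prob_pow4 _ 0 s _ 1) => // x; exact: bX.
  have i2 : itg mu (fun x => x ^+ 2).
    by apply: (@itg_normal_prob_pow4 _ 0 s _ 1) => // x; exact: bX.
  have bc (x : R) : `|cos x| <= 1 * (1 + (x - 0) ^+ 4).
    by apply: le_trans (cos_max _) _; rewrite mul1r lerDl exprn_even_ge0.
  have ic : itg mu (@cos R).
    by apply: (@itg_normal_prob_pow4 _ 0 s _ 1) => //; exact: measurable_cos.
  split; first exact: (itg_has_law Xmu i4).
  rewrite (Rintegral_has_law Xmu ic) (Rintegral_has_law Xmu i2).
  rewrite (@Rintegral_normal_prob_pow4 _ 0 s _ 1)//; last exact: measurable_cos.
  rewrite (@Rintegral_normal_prob_pow4 _ 0 s _ 1)//; last by move=> x; exact: bX.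
  have := gaussian_variance 0 s0; under eq_Rintegral do rewrite subr0.
  move=> ->; have := gaussian_cos 0 s0 1.
  under eq_Rintegral do rewrite subr0 mul1r.
  by move=> ->; rewrite expr1n mulr1.
- pose mu : probability (measurableTypeR R) R := @dirac _ (measurableTypeR R) m R.
  have Xmu : forall A, measurable A -> distribution P X A = mu A by exact: Xm.
  have mX k : measurable_fun [set: R] (fun x : R => x ^+ k) by exact: measurable_funX.
  have m0 : m = 0.
    have : \int[P]_w X w = 0 by move: EX; rewrite unlock /Rintegral => ->.
    rewrite (@Rintegral_has_law _ _ _ _ X mu Xmu id); last exact: itg_dirac.
    by rewrite Rintegral_dirac.
  have mc : measurable_fun [set: measurableTypeR R] (@cos R) by exact: measurable_cos.
  split; first exact: (itg_has_law Xmu (itg_dirac m (mX 4%N))).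
  rewrite (Rintegral_has_law Xmu (itg_dirac m mc)).
  rewrite (Rintegral_has_law Xmu (itg_dirac m (mX 2%N))).
  rewrite (Rintegral_dirac m mc) (Rintegral_dirac m (mX 2%N)).
  by rewrite m0 cos0 expr0n /= mul0r oppr0 expR0.
Qed.

End centered_gaussian_variable.

(** * Averaging over an independent parameter *)

Section mixing.
Context d (T : measurableType d) (R : realType) (P : probability T R).
Context d' (T' : measurableType d') (N : probability T' R).

(** Fubini's theorem; the bound [M] makes the integrand [U w * k g w] integrable
    for the product measure. *)
Lemma Rintegral_mixture (U : T -> R) (k : T' -> T -> R) (M : T' -> R) :
  itg P U -> measurable_fun [set: T' * T] (fun z => k z.1 z.2) -> itg N M ->
  (forall g w, `|k g w| <= M g) ->
  itg N (fun g => \int[P]_w (U w * k g w)) /\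
  \int[N]_g (\int[P]_w (U w * k g w)) = \int[P]_w (U w * \int[N]_g k g w).
Proof.
move=> Ui mk Mi kM.
have mU := itg_measurable Ui.
have mkg g : measurable_fun [set: T] (k g).
  exact: (measurableT_comp mk (pair1_measurable g)).
have mkw w : measurable_fun [set: T'] (k ^~ w).
  exact: (measurableT_comp mk (pair2_measurable w)).
have M0 g : 0 <= M g by exact: le_trans (kM g point).
pose f (z : T' * T) : \bar R := (U z.2 * k z.1 z.2)%:E.
have mf : measurable_fun setT f.
  apply/measurable_EFinP; apply: measurable_funM => //.
  exact: (measurableT_comp mU measurable_snd).
have iw g : itg P (fun w => U w * k g w).
  apply: (@itg_dom _ _ _ P _ (fun w => M g * `|U w|)).
  - exact: measurable_funM.
  - by move=> w; rewrite normrM mulrC ler_wpM2r.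
  - by apply: itgZ; exact: itg_norm.
have ig w : itg N (k ^~ w) by exact: (itg_dom (mkw w) (kM ^~ w) Mi).
have fi : (N \x P)%E.-integrable setT f.
  apply/integrable12ltyP => //.
  have h : itg N (fun g => M g * \int[P]_w `|U w|).
    by under eq_fun do rewrite mulrC; exact: itgZ.
  case/integrableP: h => _; apply: le_lt_trans.
  apply: ge0_le_integral => //=.
  - by move=> x _; apply: integral_ge0 => y _; rewrite lee_fin.
  - have mF := measurable_fun_fubini_tonelli_F (m2 := P) (abse \o f).
    by apply: mF => [|x]; [exact: measurableT_comp|exact: abse_ge0].
  - apply/measurable_EFinP; apply: measurableT_comp => //.
    by apply: measurable_funM => //; exact: itg_measurable Mi.
  - move=> g _; rewrite (ger0_norm (mulr_ge0 _ _)) ?Rintegral_ge0//.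
    rewrite EFinM /Rintegral fineK; last exact: (integrable_fin_num _ (itg_norm Ui)).
    rewrite -integralZl//; last exact: itg_norm.
    apply: ge0_le_integral => //=.
    + by apply/measurable_EFinP; apply: measurableT_comp => //; exact: measurable_funM.
    + by apply/measurable_EFinP; apply: measurable_funM => //; exact: measurableT_comp.
    + by move=> w _; rewrite lee_fin normrM mulrC ler_wpM2r.
have EP g : ((\int[P]_w (U w * k g w))%R%:E = \int[P]_w f (g, w))%E.
  by rewrite fineK//; exact: (integrable_fin_num _ (iw g)).
have EN w : ((U w * \int[N]_g k g w)%R%:E = \int[N]_g f (g, w))%E.
  rewrite -RintegralZl// fineK//.
  by apply: (integrable_fin_num _ (itgZ (U w) (ig w))).
split.
  have := integrable_fubini_F fi; apply: eq_integrable => // g _.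
  by rewrite /= EP.
rewrite /Rintegral; congr fine.
under eq_integral do rewrite EP.
under [RHS]eq_integral do rewrite EN.
exact: Fubini.
Qed.

End mixing.

(** * Trigonometric and polynomial moments of Gaussian vectors *)

Section linear_forms.
Context (T : Type) (R : realType) (n : nat).
Variables (X : 'I_n -> T -> R) (C : 'I_n -> 'I_n -> R).
Implicit Types a b c : 'I_n -> R.

Definition linear_form a w : R := \sum_i a i * X i w.
Definition covariance_form a b : R := \sum_i \sum_j a i * b j * C i j.

Lemma linDZ c d u w : linear_form (fun i => c i + u * d i) w = linear_form c w + u * linear_form d w.
Proof.
by rewrite /linear_form mulr_sumr -big_split; apply: eq_bigr => i _ /=; ring.
Qed.

Lemma lin0 w : linear_form (fun=> 0) w = 0.
Proof. by rewrite /linear_form big1// => i _; rewrite mul0r. Qed.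

Lemma bilDZr c d u b : covariance_form b (fun i => c i + u * d i) = covariance_form b c + u * covariance_form b d.
Proof.
rewrite /covariance_form mulr_sumr -big_split; apply: eq_bigr => i _ /=.
by rewrite mulr_sumr -big_split; apply: eq_bigr => j _ /=; ring.
Qed.

Lemma bil0r b : covariance_form b (fun=> 0) = 0.
Proof. by rewrite /covariance_form big1// => i _; rewrite big1// => j _; ring. Qed.

Hypothesis Csym : forall i j, C i j = C j i.

Lemma bilC a b : covariance_form a b = covariance_form b a.
Proof.
rewrite /covariance_form exchange_big; apply: eq_bigr => i _; apply: eq_bigr => j _.
by rewrite Csym; ring.
Qed.

End linear_forms.

(** A centered Gaussian vector described by the characteristic function of its
    linear forms. Integrability of the fourth powers is what allows this function
    to be differentiated four times. *)
Record gaussian_vector d (T : measurableType d) (R : realType)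
    (P : probability T R) (n : nat) (X : 'I_n -> T -> R)
    (C : 'I_n -> 'I_n -> R) : Prop := {
  gv_measurable : forall i, measurable_fun [set: T] (X i) ;
  gv_moment4 : forall a, itg P (fun w => linear_form X a w ^+ 4) ;
  gv_sym : forall i j, C i j = C j i ;
  gv_cos : forall a,
    \int[P]_w cos (linear_form X a w) = expR (- (covariance_form C a a / 2)) }.

Section fourth_moments.
Context d (T : measurableType d) (R : realType) (P : probability T R).

Lemma itg_mul_bounded (f g : T -> R) : itg P f -> measurable_fun [set: T] g ->
  (forall w, `|g w| <= 1) -> itg P (fun w => f w * g w).
Proof.
move=> fi mg g1; apply: (@itg_dom _ _ _ P _ (fun w => `|f w|)).
- by apply: measurable_funM => //; exact: itg_measurable fi.
- by move=> w; rewrite normrM ler_piMr.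
- exact: itg_norm.
Qed.

(** Hoelder's inequality turns four such functions into an integrable product. *)
Definition has_moment4 (f : T -> R) :=
  measurable_fun [set: T] f /\ itg P (fun w => f w ^+ 4).

Lemma itg_mul4 (f g h k : T -> R) : has_moment4 f -> has_moment4 g ->
  has_moment4 h -> has_moment4 k -> itg P (fun w => f w * g w * h w * k w).
Proof.
move=> [mf f4] [mg g4] [mh h4] [mk k4].
apply: (@itg_dom _ _ _ P _ (fun w => (f w ^+ 4 + g w ^+ 4) + (h w ^+ 4 + k w ^+ 4))).
- by do 3 (apply: measurable_funM => //).
- move=> w; move: (f w) (g w) (h w) (k w) => x y z t.
  have e (u v : R) : `|u * v| <= u ^+ 2 + v ^+ 2.
    rewrite ler_norml; apply/andP; split; nra.
  have -> : x * y * z * t = (x * y) * (z * t) by ring.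
  apply: le_trans (e _ _) _.
  have e2 (u v : R) : (u * v) ^+ 2 <= u ^+ 4 + v ^+ 4.
    have -> : u ^+ 4 = (u ^+ 2) ^+ 2 by rewrite -exprM.
    have -> : v ^+ 4 = (v ^+ 2) ^+ 2 by rewrite -exprM.
    by rewrite exprMn; nra.
  exact: lerD.
- by do 2 (apply: itgD; [|]; try exact: itgD).
Qed.

Lemma has_moment4_1 : has_moment4 (fun=> 1).
Proof. by split=> //; under eq_fun do rewrite expr1n; exact: itg_cst. Qed.

Lemma itg_mul3 (f g h : T -> R) : has_moment4 f -> has_moment4 g ->
  has_moment4 h -> itg P (fun w => f w * g w * h w).
Proof.
move=> mf mg mh; have := itg_mul4 mf mg mh has_moment4_1.
by under eq_fun do rewrite mulr1.
Qed.

Lemma itg_mul2 (f g : T -> R) : has_moment4 f -> has_moment4 g ->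
  itg P (fun w => f w * g w).
Proof.
move=> mf mg; have := itg_mul3 mf mg has_moment4_1.
by under eq_fun do rewrite mulr1.
Qed.

Lemma itg_moment4 (f : T -> R) : has_moment4 f -> itg P f.
Proof.
move=> mf; have := itg_mul2 mf has_moment4_1.
by under eq_fun do rewrite mulr1.
Qed.

End fourth_moments.

Section gaussian_vectors.
Context d (T : measurableType d) (R : realType) (P : probability T R).
Context (n : nat) (X : 'I_n -> T -> R) (C : 'I_n -> 'I_n -> R).
Hypothesis gX : gaussian_vector P X C.
Notation V := (linear_form X).
Notation B := (covariance_form C).
Implicit Types a b c e f : 'I_n -> R.

Lemma measurable_lin a : measurable_fun [set: T] (V a).
Proof.
by apply: measurable_sum => i; apply: measurable_funM => //; exact: gv_measurable gX i.
Qed.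

Lemma lin_moment4 a : has_moment4 P (V a).
Proof. by split; [exact: measurable_lin|exact: gv_moment4 gX a]. Qed.
#[local] Hint Resolve lin_moment4 measurable_lin : core.

Let mcos c : measurable_fun [set: T] (fun w => cos (V c w)).
Proof. exact: (measurableT_comp (@measurable_cos R) (measurable_lin c)). Qed.

Let msin c : measurable_fun [set: T] (fun w => sin (V c w)).
Proof. exact: (measurableT_comp (@measurable_sin R) (measurable_lin c)). Qed.

(** The direction of differentiation [e] is a vector of coefficients. *)
Let D c e (u : R) := (fun i => c i + u * e i).

Lemma derive_integral_cos (U : T -> R) c e : itg P U -> itg P (fun w => U w * V e w) ->
  is_derive (0 : R) (1 : R) (fun u => \int[P]_w (U w * cos (V (D c e u) w)))
    (- \int[P]_w (U w * V e w * sin (V c w))).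
Proof.
move=> Ui UVi.
have := @is_derive_Rintegral _ _ _ P (fun u w => U w * cos (V c w + u * V e w))
  (fun u w => - 1 * (U w * V e w * sin (V c w + u * V e w))) (fun w => `|U w * V e w|).
have mD u : measurable_fun [set: T] (fun w => V c w + u * V e w).
  by apply: measurable_funD => //; exact: measurable_funM.
have h1 t : itg P (fun w => U w * cos (V c w + t * V e w)).
  apply: itg_mul_bounded => //; last by move=> w; exact: cos_max.
  exact: (measurableT_comp (@measurable_cos R)).
have h2 t y : is_derive t (1 : R) (fun u : R => U y * cos (V c y + u * V e y))
    (- 1 * (U y * V e y * sin (V c y + t * V e y))).
  by apply: is_derive_eq; rewrite /GRing.scale /=; ring.
move=> /(_ h1 h2 (itg_norm UVi)) h3.
have /h3/(_ 0) : forall t w, `|- 1 * (U w * V e w * sin (V c w + t * V e w))| <= `|U w * V e w|.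
  by move=> t w; rewrite mulN1r normrN normrM ler_piMr// sin_max.
rewrite RintegralZl//; last first.
  under eq_fun do rewrite mul0r addr0.
  by apply: itg_mul_bounded => // w; exact: sin_max.
rewrite mulN1r.
under [X in - X]eq_Rintegral do rewrite mul0r addr0.
congr (is_derive _ _ _ _); apply/funext => u.
by apply: eq_Rintegral => w _; rewrite linDZ.
Qed.

Lemma derive_integral_sin (U : T -> R) c e : itg P U -> itg P (fun w => U w * V e w) ->
  is_derive (0 : R) (1 : R) (fun u => \int[P]_w (U w * sin (V (D c e u) w)))
    (\int[P]_w (U w * V e w * cos (V c w))).
Proof.
move=> Ui UVi.
have := @is_derive_Rintegral _ _ _ P (fun u w => U w * sin (V c w + u * V e w))
  (fun u w => U w * V e w * cos (V c w + u * V e w)) (fun w => `|U w * V e w|).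
have mD u : measurable_fun [set: T] (fun w => V c w + u * V e w).
  by apply: measurable_funD => //; exact: measurable_funM.
have h1 t : itg P (fun w => U w * sin (V c w + t * V e w)).
  apply: itg_mul_bounded => //; last by move=> w; exact: sin_max.
  exact: (measurableT_comp (@measurable_sin R)).
have h2 t y : is_derive t (1 : R) (fun u : R => U y * sin (V c y + u * V e y))
    (U y * V e y * cos (V c y + t * V e y)).
  by apply: is_derive_eq; rewrite /GRing.scale /=; ring.
move=> /(_ h1 h2 (itg_norm UVi)) h3.
have /h3/(_ 0) : forall t w, `|U w * V e w * cos (V c w + t * V e w)| <= `|U w * V e w|.
  by move=> t w; rewrite normrM ler_piMr// cos_max.
under [X in is_derive _ _ _ X -> _]eq_Rintegral do rewrite mul0r addr0.
congr (is_derive _ _ _ _); apply/funext => u.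
by apply: eq_Rintegral => w _; rewrite linDZ.
Qed.

Let E c : R := expR (- (B c c / 2)).

Let BDD c e u : B (D c e u) (D c e u) = B c c + u * B c e + u * (B c e + u * B e e).
Proof.
have Bs := bilC (gv_sym gX).
by rewrite /D bilDZr (Bs _ c) (Bs _ e) !bilDZr (Bs e c).
Qed.

Let derive_unique (F G : R -> R) (x y : R) : F = G ->
  is_derive (0 : R) (1 : R) F x -> is_derive (0 : R) (1 : R) G y -> x = y.
Proof. by move=> -> [_ <-] [_ <-]. Qed.

(** This formula and the following ones, up to the moment of order four, are
    obtained each from the previous one by differentiation at [u = 0] along
    [c + u e]. *)
Lemma gaussian_sin_moment1 c e :
  \int[P]_w (V e w * sin (V c w)) = B c e * E c.
Proof.
have h := @derive_integral_cos (fun=> 1) c e (itg_cst P 1).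
have h' : itg P (fun w => 1 * V e w).
  by under eq_fun do rewrite mul1r; exact: itg_moment4.
have {h h'} h := h h'.
have D2 : is_derive (0 : R) (1 : R)
    (fun u : R => expR (- ((B c c + u * B c e + u * (B c e + u * B e e)) / 2)))
    (- (B c e * E c)).
  apply: is_derive_eq; rewrite /E /GRing.scale /= !mul0r !addr0; by field.
transitivity (\int[P]_w (1 * V e w * sin (V c w))).
  by apply: eq_Rintegral => w _; rewrite mul1r.
apply: oppr_inj; apply: derive_unique h D2.
apply/funext => u; rewrite -BDD -(gv_cos gX).
by under eq_Rintegral do rewrite mul1r.
Qed.

Lemma gaussian_cos_moment2 a c e :
  \int[P]_w (V a w * V e w * cos (V c w)) = (B a e - B a c * B c e) * E c.
Proof.
have h := derive_integral_sin c (itg_moment4 (lin_moment4 a))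
  (itg_mul2 (lin_moment4 a) (lin_moment4 e)).
have D2 : is_derive (0 : R) (1 : R)
    (fun u : R => (B a c + u * B a e) *
      expR (- ((B c c + u * B c e + u * (B c e + u * B e e)) / 2)))
    ((B a e - B a c * B c e) * E c).
  apply: is_derive_eq; rewrite /E /GRing.scale /= !mul0r !addr0; by field.
apply: derive_unique h D2.
apply/funext => u; rewrite gaussian_sin_moment1 /E BDD.
by rewrite (bilC (gv_sym gX)) bilDZr.
Qed.

Lemma gaussian_sin_moment3 a b c e :
  \int[P]_w (V a w * V b w * V e w * sin (V c w)) =
  (B a e * B b c + B a c * B b e + (B a b - B a c * B b c) * B c e) * E c.
Proof.
have h := derive_integral_cos c (itg_mul2 (lin_moment4 a) (lin_moment4 b))
  (itg_mul3 (lin_moment4 a) (lin_moment4 b) (lin_moment4 e)).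
have D2 : is_derive (0 : R) (1 : R)
    (fun u : R => (B a b - (B a c + u * B a e) * (B b c + u * B b e)) *
      expR (- ((B c c + u * B c e + u * (B c e + u * B e e)) / 2)))
    (- ((B a e * B b c + B a c * B b e + (B a b - B a c * B b c) * B c e) * E c)).
  apply: is_derive_eq; rewrite /E /GRing.scale /= !mul0r !addr0; by field.
apply: oppr_inj; apply: derive_unique h D2.
apply/funext => u; rewrite gaussian_cos_moment2 /E BDD.
by rewrite [B (D c e u) b](bilC (gv_sym gX)) !bilDZr.
Qed.

Lemma gaussian_moment2 a b : \int[P]_w (V a w * V b w) = B a b.
Proof.
have := gaussian_cos_moment2 a (fun=> 0) b.
rewrite bil0r mul0r subr0 /E bil0r mul0r oppr0 expR0 mulr1 => <-.
by apply: eq_Rintegral => w _; rewrite lin0 cos0 mulr1.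
Qed.

(** Isserlis' formula. *)
Lemma gaussian_moment4 a b e f :
  \int[P]_w (V a w * V b w * V e w * V f w) = B a e * B b f + B a f * B b e + B a b * B e f.
Proof.
have h := derive_integral_sin (fun=> 0) (itg_mul3 (lin_moment4 a) (lin_moment4 b) (lin_moment4 e))
  (itg_mul4 (lin_moment4 a) (lin_moment4 b) (lin_moment4 e) (lin_moment4 f)).
have Bs := bilC (gv_sym gX).
have D2 : is_derive (0 : R) (1 : R)
    (fun u : R => (B a e * (u * B b f) + (u * B a f) * B b e +
      (B a b - (u * B a f) * (u * B b f)) * (u * B e f)) * expR (- (u * (u * B f f) / 2)))
    (B a e * B b f + B a f * B b e + B a b * B e f).
  apply: is_derive_eq; rewrite /GRing.scale /= !mul0r oppr0 expR0; by field.
transitivity (\int[P]_w (V a w * V b w * V e w * V f w * cos (V (fun=> 0) w))).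
  by apply: eq_Rintegral => w _; rewrite lin0 cos0 mulr1.
apply: derive_unique h D2.
apply/funext => u; rewrite gaussian_sin_moment3 /E BDD.
rewrite (Bs (D _ _ _) e) /D !bilDZr (Bs (fun=> 0) f) !bil0r.
by rewrite !(add0r, mulr0, mul0r).
Qed.

End gaussian_vectors.

(** * Gaussian integration by parts for the Laplace transform of the norm *)

Section standard_normal_integrals.
Context (R : realType).

Definition standard_normal : probability (measurableTypeR R) R := normal_prob (0 : R) 1.

Lemma itg_standard_normal (g : R -> R) (K : R) : measurable_fun [set: R] g ->
  (forall x, `|g x| <= K * (1 + x ^+ 4)) -> itg standard_normal g.
Proof.
move=> mg gK; apply: (@itg_normal_prob_pow4 _ 0 1 _ K) => // x; by rewrite subr0.
Qed.

Lemma Rintegral_standard_normal (g : R -> R) (K : R) : measurable_fun [set: R] g ->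
  (forall x, `|g x| <= K * (1 + x ^+ 4)) ->
  \int[standard_normal]_x g x = \int[lebesgue_measure]_x (g x * normal_pdf 0 1 x).
Proof.
move=> mg gK; apply: (@Rintegral_normal_prob_pow4 _ 0 1 _ K) => // x; by rewrite subr0.
Qed.

Lemma normr_le_pow4 (x : R) : `|x| <= 1 * (1 + x ^+ 4).
Proof.
rewrite mul1r.
have -> : x ^+ 4 = `|x| ^+ 4 by rewrite -normrX ger0_norm// exprn_even_ge0.
have [h|/ltW h] := leP `|x| 1; first by rewrite ler_wpDr ?exprn_ge0.
by rewrite ler_wpDl// -[leLHS]expr1 ler_weXn2l.
Qed.

Lemma itg_standard_normal_norm : itg standard_normal (fun x : R => `|x|).
Proof.
apply: (@itg_standard_normal _ 1); first exact: measurableT_comp.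
by move=> x; rewrite normr_id; exact: normr_le_pow4.
Qed.

Let mmulr (v : R) : measurable_fun [set: R] (fun x : R => x * v).
Proof. exact: measurable_funM. Qed.

Let bound1 (x y : R) : `|x| <= 1 -> `|x| <= 1 * (1 + y ^+ 4).
Proof. by move=> h; rewrite mul1r (le_trans h)// lerDl exprn_even_ge0. Qed.

(** Read from right to left, this writes a Gaussian function of [v] as an average
    of cosines. *)
Lemma standard_normal_cos (v : R) : \int[standard_normal]_x cos (x * v) = expR (- (v ^+ 2 / 2)).
Proof.
rewrite (@Rintegral_standard_normal _ 1); last by move=> x; apply/bound1/cos_max.
  have := gaussian_cos 0 (ltr01 : 0 < 1 :> R) v.
  rewrite expr1n mul1r => <-.
  by under [RHS]eq_Rintegral do rewrite subr0 mulrC [v * _]mulrC mulrC.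
exact: (measurableT_comp (@measurable_cos R) (mmulr v)).
Qed.

Lemma standard_normal_sin (v : R) :
  \int[standard_normal]_x (x * sin (x * v)) = v * expR (- (v ^+ 2 / 2)).
Proof.
have ms : measurable_fun [set: R] (fun x : R => sin (x * v)).
  exact: (measurableT_comp (@measurable_sin R) (mmulr v)).
have mc : measurable_fun [set: R] (fun x : R => cos (x * v)).
  exact: (measurableT_comp (@measurable_cos R) (mmulr v)).
rewrite (@Rintegral_standard_normal _ 1).
- have Ds (x : R) : is_derive x (1 : R) (fun x => sin (x * v)) (v * cos (x * v)).
    by apply: is_derive_eq; rewrite /GRing.scale /=; ring.
  have cd : continuous (fun x : R => v * cos (x * v)).
    move=> x; apply: cvgM; first exact: cvg_cst.
    apply: (cvg_comp _ cos); last exact: continuous_cos.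
    by apply: cvgM; [exact: cvg_id|exact: cvg_cst].
  have b1 (x : R) : `|sin (x * v)| <= (1 + `|v|) * (1 + `|x - 0|).
    apply: le_trans (sin_max _) _.
    by rewrite -[leLHS]mulr1 ler_pM// lerDl.
  have b2 (x : R) : `|v * cos (x * v)| <= 1 + `|v|.
    rewrite normrM; apply: (@le_trans _ _ `|v|); last by rewrite lerDr.
    by rewrite ler_piMr// cos_max.
  have := gaussian_integration_by_parts (ltr01 : 0 < 1 :> R) Ds cd b1 b2.
  under eq_Rintegral do rewrite subr0.
  move=> ->; rewrite expr1n mul1r.
  under eq_Rintegral do rewrite -mulrA.
  rewrite RintegralZl//; last first.
    apply: (@itg_mul_normal_pdf _ 0 1 ltr01 _ 1) => // x.
    by rewrite subr0; apply/bound1/cos_max.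
  congr (_ * _); rewrite -standard_normal_cos (@Rintegral_standard_normal _ 1)//.
  by move=> x; apply/bound1/cos_max.
- exact: measurable_funM.
- move=> x; rewrite normrM; apply: le_trans (normr_le_pow4 x).
  by rewrite ler_piMr// sin_max.
Qed.

End standard_normal_integrals.

Section gaussian_laplace.
Context d (T : measurableType d) (R : realType) (P : probability T R).
Context (n : nat) (X : 'I_n -> T -> R) (C : 'I_n -> 'I_n -> R).
Hypothesis gX : gaussian_vector P X C.
Notation V := (linear_form X).
Notation B := (covariance_form C).
Implicit Types a b c y : 'I_n -> R.

Let mV a : measurable_fun [set: T] (V a) := measurable_lin gX a.
Let V4 a : has_moment4 P (V a) := lin_moment4 gX a.

Let mcos c : measurable_fun [set: T] (fun w => cos (V c w)).
Proof. exact: (measurableT_comp (@measurable_cos R) (mV c)). Qed.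

Let msin c : measurable_fun [set: T] (fun w => sin (V c w)).
Proof. exact: (measurableT_comp (@measurable_sin R) (mV c)). Qed.

(** Integration by parts for the functional [G]: [D a] stands for the derivative of
    [G] in the direction which the covariance associates with [V a]. The identity
    equates the mean of [V_a Y] with that of the derivative of [Y] in this
    direction, for [Y = V_b G cos(V_c)]; the factor [cos(V_c)] is what makes the
    property stable under [parts_step]. *)
Record parts (G : T -> R) (D : ('I_n -> R) -> T -> R) : Prop := {
  parts_measurable : measurable_fun [set: T] G ;
  parts_le1 : forall w, `|G w| <= 1 ;
  parts_itg : forall a b, itg P (fun w => V b w * D a w) ;
  parts_ibp : forall a b c,
    \int[P]_w (V a w * V b w * G w * cos (V c w)) =
    B a b * \int[P]_w (G w * cos (V c w)) -
    B a c * \int[P]_w (V b w * G w * sin (V c w)) +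
    \int[P]_w (V b w * D a w * cos (V c w)) }.

Lemma parts1 : parts (fun=> 1) (fun _ => (fun=> 0)).
Proof.
split=> //.
- by move=> w; rewrite normr1.
- by move=> a b; under eq_fun do rewrite mulr0; exact: itg0.
- move=> a b c.
  under eq_Rintegral do rewrite mulr1.
  under [X in _ * X - _]eq_Rintegral do rewrite mul1r.
  under [X in _ - _ * X]eq_Rintegral do rewrite mulr1.
  under [X in _ + X]eq_Rintegral do rewrite mulr0 mul0r.
  rewrite (gaussian_cos_moment2 gX) (gv_cos gX) (gaussian_sin_moment1 gX).
  by rewrite Rintegral_prob_cst (bilC (gv_sym gX) c b); ring.
Qed.

Section step.
Variables (G : T -> R) (D : ('I_n -> R) -> T -> R) (y : 'I_n -> R).
Hypothesis GD : parts G D.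

Let shift c (g : R) := (fun i => c i + g * y i).

Let itgc U (c : 'I_n -> R) : itg P U -> itg P (fun w => U w * cos (V c w)).
Proof. by move=> Ui; apply: itg_mul_bounded => // w; exact: cos_max. Qed.
Let itgs U (c : 'I_n -> R) : itg P U -> itg P (fun w => U w * sin (V c w)).
Proof. by move=> Ui; apply: itg_mul_bounded => // w; exact: sin_max. Qed.

Let mgV (g : R) : measurable_fun [set: T] (fun w => g * V y w).
Proof. exact: measurable_funM. Qed.

Let itgcg U (g : R) : itg P U -> itg P (fun w => U w * cos (g * V y w)).
Proof.
move=> Ui; apply: itg_mul_bounded => //; last by move=> w; exact: cos_max.
exact: (measurableT_comp (@measurable_cos R) (mgV g)).
Qed.
Let itgsg U (g : R) : itg P U -> itg P (fun w => U w * sin (g * V y w)).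
Proof.
move=> Ui; apply: itg_mul_bounded => //; last by move=> w; exact: sin_max.
exact: (measurableT_comp (@measurable_sin R) (mgV g)).
Qed.

Let integral_cos_shift U c g : itg P U ->
  \int[P]_w (U w * cos (V (shift c g) w)) =
  \int[P]_w (U w * cos (V c w) * cos (g * V y w)) -
  \int[P]_w (U w * sin (V c w) * sin (g * V y w)).
Proof.
move=> Ui; rewrite -RintegralB//; [|exact/itgcg/itgc|exact/itgsg/itgs].
by apply: eq_Rintegral => w _; rewrite linDZ cosD; ring.
Qed.

Let integral_sin_shift U c g : itg P U ->
  \int[P]_w (U w * sin (V (shift c g) w)) =
  \int[P]_w (U w * sin (V c w) * cos (g * V y w)) +
  \int[P]_w (U w * cos (V c w) * sin (g * V y w)).
Proof.
move=> Ui; rewrite -RintegralD//; [|exact/itgcg/itgs|exact/itgsg/itgc].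
by apply: eq_Rintegral => w _; rewrite linDZ sinD; ring.
Qed.

Let cosN_shift U g :
  \int[P]_w (U w * cos (- g * V y w)) = \int[P]_w (U w * cos (g * V y w)).
Proof. by apply: eq_Rintegral => w _; rewrite mulNr cosN. Qed.

Let sinN_shift U g : itg P U ->
  \int[P]_w (U w * sin (- g * V y w)) = - \int[P]_w (U w * sin (g * V y w)).
Proof.
move=> Ui; rewrite -[RHS]mulN1r -RintegralZl//; last exact: itgsg.
by apply: eq_Rintegral => w _; rewrite mulNr sinN mulN1r mulrN.
Qed.

Let itgG U : itg P U -> itg P (fun w => U w * G w).
Proof.
by move=> Ui; apply: itg_mul_bounded => //; [exact: parts_measurable GD|exact: parts_le1 GD].
Qed.

Let Gi : itg P G.
Proof. by apply: (@itg_bounded _ _ _ P G 1); [exact: parts_measurable GD|exact: parts_le1 GD]. Qed.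

Let mix_cos (U : T -> R) : itg P U ->
  itg (standard_normal R) (fun g => \int[P]_w (U w * cos (g * V y w))) /\
  \int[standard_normal R]_g \int[P]_w (U w * cos (g * V y w)) =
  \int[P]_w (U w * expR (- (V y w ^+ 2 / 2))).
Proof.
move=> Ui.
have mk : measurable_fun [set: measurableTypeR R * T] (fun z => cos (z.1 * V y z.2)).
  apply: (measurableT_comp (@measurable_cos R)); apply: measurable_funM => //.
  exact: (measurableT_comp (mV y) measurable_snd).
have b (g : measurableTypeR R) (w : T) : `|cos (g * V y w)| <= (cst 1 : measurableTypeR R -> R) g.
  exact: cos_max.
have [h ->] := @Rintegral_mixture _ _ _ P _ _ (standard_normal R) U (fun g w => cos (g * V y w))
  (cst 1) Ui mk (itg_cst (standard_normal R) 1) b.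
by split=> //; apply: eq_Rintegral => w _; rewrite standard_normal_cos.
Qed.

Let mix_sin (U : T -> R) : itg P U ->
  itg (standard_normal R) (fun g => \int[P]_w (U w * (g * sin (g * V y w)))) /\
  \int[standard_normal R]_g \int[P]_w (U w * (g * sin (g * V y w))) =
  \int[P]_w (U w * (V y w * expR (- (V y w ^+ 2 / 2)))).
Proof.
move=> Ui.
have mk : measurable_fun [set: measurableTypeR R * T] (fun z => z.1 * sin (z.1 * V y z.2)).
  apply: measurable_funM => //.
  apply: (measurableT_comp (@measurable_sin R)); apply: measurable_funM => //.
  exact: (measurableT_comp (mV y) measurable_snd).
have b (g : measurableTypeR R) (w : T) : `|g * sin (g * V y w)| <= `|g : R|.
  by rewrite normrM ler_piMr// sin_max.
have [h ->] := @Rintegral_mixture _ _ _ P _ _ (standard_normal R) U (fun g w => g * sin (g * V y w))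
  (fun g => `|g : R|) Ui mk (itg_standard_normal_norm R) b.
by split=> //; apply: eq_Rintegral => w _; rewrite standard_normal_sin.
Qed.

(** The half-sum of the identities for [c + g y] and [c - g y], by the addition
    formulas. *)
Let parts_ibp_shift a b c g :
  \int[P]_w (V a w * V b w * G w * cos (V c w) * cos (g * V y w)) =
  B a b * \int[P]_w (G w * cos (V c w) * cos (g * V y w)) -
  B a c * \int[P]_w (V b w * G w * sin (V c w) * cos (g * V y w)) -
  B a y * \int[P]_w (V b w * G w * cos (V c w) * (g * sin (g * V y w))) +
  \int[P]_w (V b w * D a w * cos (V c w) * cos (g * V y w)).
Proof.
have i1 : itg P (fun w => V a w * V b w * G w) by apply/itgG/itg_mul2.
have i2 : itg P (fun w => V b w * G w) by apply/itgG/itg_moment4.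
have i3 := parts_itg GD a b.
have := parts_ibp GD a b (shift c (- g)).
have := parts_ibp GD a b (shift c g).
rewrite !(integral_cos_shift c _ i1) !(integral_cos_shift c _ Gi)
  !(integral_cos_shift c _ i3) !(integral_sin_shift c _ i2) /shift !bilDZr.
rewrite !cosN_shift !sinN_shift; try by [exact: itgs|exact: itgc].
have -> : \int[P]_w (V b w * G w * cos (V c w) * (g * sin (g * V y w))) =
    g * \int[P]_w (V b w * G w * cos (V c w) * sin (g * V y w)).
  rewrite -RintegralZl//; last exact/itgsg/itgc.
  by apply: eq_Rintegral => w _; rewrite mulrCA.
set I1 := Rintegral _ _ _; set I2 := Rintegral _ _ _; set I3 := Rintegral _ _ _.
set I4 := Rintegral _ _ _; set I5 := Rintegral _ _ _; set I6 := Rintegral _ _ _.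
set I7 := Rintegral _ _ _; set I8 := Rintegral _ _ _.
move=> h1 h2; lra.
Qed.

(** Integrate [parts_ibp_shift] over a standard normal [g]: the factors
    [cos(g V_y)] and [g sin(g V_y)] average to [exp(- V_y^2 / 2)] and
    [V_y exp(- V_y^2 / 2)]. *)
Lemma parts_step :
  parts (fun w => G w * expR (- (V y w ^+ 2 / 2)))
    (fun a w => (D a w - B a y * (V y w * G w)) * expR (- (V y w ^+ 2 / 2))).
Proof.
have mE : measurable_fun [set: T] (fun w => expR (- (V y w ^+ 2 / 2))).
  apply: measurableT_comp => //; apply: measurableT_comp => //.
  by apply: measurable_funM => //; exact: measurable_funX.
have E1 w : `|expR (- (V y w ^+ 2 / 2))| <= 1.
  by rewrite ger0_norm ?expR_ge0// expR_le1 oppr_le0 divr_ge0// sqr_ge0.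
have iE U : itg P U -> itg P (fun w => U w * expR (- (V y w ^+ 2 / 2))).
  by move=> Ui; exact: itg_mul_bounded.
split.
- by apply: measurable_funM => //; exact: parts_measurable GD.
- by move=> w; rewrite normrM mulr_ile1//; exact: parts_le1 GD w.
- move=> a b.
  have := iE _ (itgB (parts_itg GD a b) (itgZ (B a y) (itgG (itg_mul2 (V4 b) (V4 y))))).
  by congr (integrable _ _ _); apply/funext => w /=; congr (_%:E); ring.
- move=> a b c.
  have i1 : itg P (fun w => V a w * V b w * G w * cos (V c w)) by apply/itgc/itgG/itg_mul2.
  have i2 : itg P (fun w => G w * cos (V c w)) by apply/itgc.
  have i3 : itg P (fun w => V b w * G w * sin (V c w)) by apply/itgs/itgG/itg_moment4.
  have i4 : itg P (fun w => V b w * G w * cos (V c w)) by apply/itgc/itgG/itg_moment4.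
  have i5 : itg P (fun w => V b w * D a w * cos (V c w)) by apply/itgc; exact: parts_itg GD a b.
  have [_ e1] := mix_cos i1.
  have [j2 e2] := mix_cos i2.
  have [j3 e3] := mix_cos i3.
  have [j4 e4] := mix_sin i4.
  have [j5 e5] := mix_cos i5.
  have -> : \int[P]_w (V a w * V b w * (G w * expR (- (V y w ^+ 2 / 2))) * cos (V c w)) =
    \int[P]_w (V a w * V b w * G w * cos (V c w) * expR (- (V y w ^+ 2 / 2))).
    by apply: eq_Rintegral => w _; ring.
  have -> : \int[P]_w (G w * expR (- (V y w ^+ 2 / 2)) * cos (V c w)) =
    \int[P]_w (G w * cos (V c w) * expR (- (V y w ^+ 2 / 2))).
    by apply: eq_Rintegral => w _; ring.
  have -> : \int[P]_w (V b w * (G w * expR (- (V y w ^+ 2 / 2))) * sin (V c w)) =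
    \int[P]_w (V b w * G w * sin (V c w) * expR (- (V y w ^+ 2 / 2))).
    by apply: eq_Rintegral => w _; ring.
  have -> : \int[P]_w (V b w * ((D a w - B a y * (V y w * G w)) * expR (- (V y w ^+ 2 / 2))) * cos (V c w)) =
    \int[P]_w (V b w * D a w * cos (V c w) * expR (- (V y w ^+ 2 / 2))) -
    B a y * \int[P]_w (V b w * G w * cos (V c w) * (V y w * expR (- (V y w ^+ 2 / 2)))).
    have i6 : itg P (fun w => V b w * G w * cos (V c w) * (V y w * expR (- (V y w ^+ 2 / 2)))).
      have := iE _ (itgc c (itgG (itg_mul2 (V4 b) (V4 y)))).
      by congr (integrable _ _ _); apply/funext => w /=; congr (_%:E); ring.
    rewrite -RintegralZl// -RintegralB//; [|exact: iE|exact: itgZ].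
    by apply: eq_Rintegral => w _; ring.
  rewrite -e1 -e2 -e3 -e4 -e5.
  under eq_Rintegral do rewrite parts_ibp_shift.
  rewrite RintegralD//; last first.
    by apply: itgB; [apply: itgB; exact: itgZ|exact: itgZ].
  rewrite RintegralB//; [|by apply: itgB; exact: itgZ|exact: itgZ].
  rewrite RintegralB//; [|exact: itgZ|exact: itgZ].
  by rewrite !RintegralZl//; ring.
Qed.

End step.

Lemma parts_seq (ys : seq ('I_n -> R)) :
  parts (fun w => expR (- ((\sum_(y <- ys) V y w ^+ 2) / 2)))
    (fun a w => - (\sum_(y <- ys) B a y * V y w) *
       expR (- ((\sum_(y <- ys) V y w ^+ 2) / 2))).
Proof.
elim: ys => [|y ys IH].
  have := parts1; congr parts.
    by apply/funext => w; rewrite big_nil mul0r oppr0 expR0.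
  by apply/funext => a; apply/funext => w; rewrite big_nil oppr0 mul0r.
have := parts_step y IH; congr parts.
  by apply/funext => w; rewrite big_cons -expRD; congr expR; ring.
apply/funext => a; apply/funext => w; rewrite !big_cons.
have e (u v : R) : expR (- ((u + v) / 2)) = expR (- (v / 2)) * expR (- (u / 2)).
  by rewrite -expRD; congr expR; ring.
by rewrite e; ring.
Qed.

Definition sqnorm w : R := \sum_i X i w ^+ 2.
(** The derivative of [sqnorm / 2] in the direction which the covariance
    associates with the gradient of [sqnorm / 2]. *)
Definition qform w : R := \sum_i \sum_j C i j * X i w * X j w.

Let unit (k : 'I_n) : 'I_n -> R := fun i => (i == k)%:R.

Let lin_unit k (t : R) w : V (fun i => t * unit k i) w = t * X k w.
Proof.
rewrite /linear_form (bigD1 k)//= /unit eqxx mulr1 big1 ?addr0// => i ik.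
by rewrite (negbTE ik) mulr0 mul0r.
Qed.

Let lin_unit1 k w : V (unit k) w = X k w.
Proof.
by rewrite -[RHS]mul1r -lin_unit; congr (linear_form X _ w); apply/funext => i; rewrite mul1r.
Qed.

Let bil_unit j k (t : R) : B (unit j) (fun i => t * unit k i) = t * C j k.
Proof.
rewrite /covariance_form (bigD1 j)//= (bigD1 k)//= /unit !eqxx !big1 ?addr0.
- by rewrite mulr1 mul1r.
- by move=> i ij; rewrite big1// => l _; rewrite (negbTE ij) !mul0r.
- by move=> i ik; rewrite (negbTE ik) mulr0 mulr0 mul0r.
Qed.

Let bil_unit1 j k : B (unit j) (unit k) = C j k.
Proof.
by rewrite -[RHS]mul1r -bil_unit; congr covariance_form; apply/funext => i; rewrite mul1r.
Qed.

Lemma X_moment4 i : has_moment4 P (X i).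
Proof.
have := V4 (unit i); congr (has_moment4 _ _).
by apply/funext => w; rewrite lin_unit1.
Qed.

Lemma X_moments i j k l :
  \int[P]_w (X i w * X j w) = C i j /\
  \int[P]_w (X i w * X j w * X k w * X l w) =
    C i k * C j l + C i l * C j k + C i j * C k l.
Proof.
split.
  rewrite -bil_unit1 -(gaussian_moment2 gX).
  by apply: eq_Rintegral => w _; rewrite !lin_unit1.
rewrite -!bil_unit1 -(gaussian_moment4 gX).
by apply: eq_Rintegral => w _; rewrite !lin_unit1.
Qed.

Lemma itg_sqnorm : itg P sqnorm.
Proof.
apply: itg_sum => i; under eq_fun do rewrite expr2.
exact: (itg_mul2 (X_moment4 i) (X_moment4 i)).
Qed.

Lemma itg_qform : itg P qform.
Proof.
apply: itg_sum => i; apply: itg_sum => j.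
under eq_fun do rewrite -mulrA.
exact: (itgZ _ (itg_mul2 (X_moment4 i) (X_moment4 j))).
Qed.

Lemma sqnorm_ge0 w : 0 <= sqnorm w.
Proof. by apply: sumr_ge0 => i _; exact: sqr_ge0. Qed.

(** The case of [exp(- m |X|^2)], where each [sqrt(2 m) X_k] contributes one
    Gaussian factor. Summing over [a = b] in the basis of the coordinates gives
    the squared norm on the left. *)
Lemma gaussian_laplace_ibp (m : R) : 0 <= m ->
  \int[P]_w (sqnorm w * expR (- (m * sqnorm w))) =
  (\sum_i C i i) * \int[P]_w expR (- (m * sqnorm w)) -
  2 * m * \int[P]_w (qform w * expR (- (m * sqnorm w))).
Proof.
move=> m0; pose t := Num.sqrt (2 * m).
have t2 : t * t = 2 * m by rewrite -expr2 sqr_sqrtr// mulr_ge0.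
pose ys := [seq (fun i => t * unit k i) | k <- enum 'I_n].
have := parts_seq ys.
have -> : (fun w => expR (- ((\sum_(y <- ys) V y w ^+ 2) / 2))) =
    (fun w => expR (- (m * sqnorm w))).
  apply/funext => w; rewrite big_map big_enum /sqnorm mulr_sumr mulr_suml.
  congr expR; congr (- _); apply: eq_bigr => k _.
  by rewrite lin_unit exprMn (expr2 t) t2; field.
set G := fun w => expR _.
have -> : (fun a w => - (\sum_(y <- ys) B a y * V y w) *
      expR (- ((\sum_(y <- ys) V y w ^+ 2) / 2))) =
    (fun a w => - (\sum_(y <- ys) B a y * V y w) * G w).
  apply/funext => a; apply/funext => w; congr (_ * expR (- _)).
  rewrite big_map big_enum /sqnorm mulr_sumr mulr_suml.
  apply: eq_bigr => k _.
  by rewrite lin_unit exprMn (expr2 t) t2; field.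
move=> p.
have iG U : itg P U -> itg P (fun w => U w * G w).
  move=> Ui; apply: itg_mul_bounded => //; first exact: parts_measurable p.
  exact: parts_le1 p.
have h i : \int[P]_w (X i w ^+ 2 * G w) = C i i * \int[P]_w G w -
    2 * m * \int[P]_w ((\sum_j C i j * X i w * X j w) * G w).
  have := parts_ibp p (unit i) (unit i) (fun=> 0).
  rewrite bil0r mul0r subr0 bil_unit1.
  under eq_Rintegral do rewrite lin0 cos0 mulr1 lin_unit1 -expr2.
  under [X in C i i * X]eq_Rintegral do rewrite lin0 cos0 mulr1.
  move=> ->; congr (_ + _).
  rewrite -mulNr -RintegralZl//; last first.
    apply: iG; apply: itg_sum => j; under eq_fun do rewrite -mulrA.
    exact: (itgZ _ (itg_mul2 (X_moment4 i) (X_moment4 j))).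
  apply: eq_Rintegral => w _.
  rewrite lin0 cos0 mulr1 lin_unit1 big_map big_enum !mulrA; congr (_ * _).
  rewrite -sumrN mulr_sumr mulr_sumr; apply: eq_bigr => j _.
  by rewrite bil_unit lin_unit -t2; ring.
have -> : \int[P]_w (sqnorm w * G w) = \sum_i \int[P]_w (X i w ^+ 2 * G w).
  rewrite -Rintegral_sum.
    by apply: eq_Rintegral => w _; rewrite /sqnorm mulr_suml.
  move=> i; apply: iG; under eq_fun do rewrite expr2.
  exact: (itg_mul2 (X_moment4 i) (X_moment4 i)).
have -> : \int[P]_w (qform w * G w) = \sum_i \int[P]_w ((\sum_j C i j * X i w * X j w) * G w).
  rewrite -Rintegral_sum.
    by apply: eq_Rintegral => w _; rewrite /qform mulr_suml.
  move=> i; apply: iG; apply: itg_sum => j; under eq_fun do rewrite -mulrA.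
  exact: (itg_mul2 (X_moment4 i) (X_moment4 j)) || exact: (itgZ _ (itg_mul2 (X_moment4 i) (X_moment4 j))).
by rewrite mulr_suml mulr_sumr -sumrB; apply: eq_bigr => i _; rewrite h.
Qed.

End gaussian_laplace.

(** * Approximation by polynomials in a decreasing exponential *)

Section bernstein.
Context (R : realType).
Implicit Types (f : nat -> R) (y : R).

(** [(bernstein k f).[y]] is the mean of [f] at a binomial variable of parameters
    [k] and [y]. The recursion conditions on the first trial, so that estimates
    are proved by induction on [k]. *)
Fixpoint bernstein (k : nat) (f : nat -> R) : {poly R} :=
  if k is k'.+1 then 'X * bernstein k' (f \o S) + (1 - 'X) * bernstein k' f
  else (f 0%N)%:P.

Lemma bernsteinS k f y : (bernstein k.+1 f).[y] =
  y * (bernstein k (f \o S)).[y] + (1 - y) * (bernstein k f).[y].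
Proof. by rewrite /= !hornerE. Qed.

Lemma bernstein_at0 k f : (bernstein k f).[0] = f 0%N.
Proof.
by elim: k => [|k IH]; [rewrite hornerC | rewrite bernsteinS IH mul0r add0r subr0 mul1r].
Qed.

(** The second moment of the binomial law about [a] is
    [k y (1 - y) + (k y - a)^2], and it follows the recursion of [bernstein]. *)
Lemma bernstein_bound k f y (c a e K : R) : 0 <= y <= 1 ->
  (forall j, `|f j - c| <= e + K * (j%:R - a) ^+ 2) ->
  `|(bernstein k f).[y] - c| <= e + K * (k%:R * (y * (1 - y)) + (k%:R * y - a) ^+ 2).
Proof.
move=> /andP[y0 y1]; elim: k f a => [|k IH] f a fc.
  by rewrite hornerC !mul0r add0r; exact: fc.
rewrite bernsteinS.
have h1 := IH (f \o S) (a - 1).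
have {}h1 : `|(bernstein k (f \o S)).[y] - c| <=
    e + K * (k%:R * (y * (1 - y)) + (k%:R * y - (a - 1)) ^+ 2).
  apply: h1 => j; apply: le_trans (fc j.+1) _.
  by rewrite -natr1 opprB addrA (addrAC _ 1).
have h2 := IH f a fc.
have y1' : 0 <= 1 - y by rewrite subr_ge0.
have := lerD (ler_wpM2l y0 h1) (ler_wpM2l y1' h2).
rewrite -natr1; set b1 := horner _ _; set b2 := horner _ _ => h.
have -> : y * b1 + (1 - y) * b2 - c = y * (b1 - c) + (1 - y) * (b2 - c) by ring.
apply: le_trans (ler_normD _ _) _; rewrite !normrM (ger0_norm y0) (ger0_norm y1').
apply: le_trans h _; rewrite le_eqVlt; apply/orP; left; apply/eqP; ring.
Qed.

Lemma bernstein_norm_le k f y (M : R) : 0 <= y <= 1 -> (forall j, `|f j| <= M) ->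
  `|(bernstein k f).[y]| <= M.
Proof.
move=> y01 fM; have := @bernstein_bound k f y 0 0 M 0 y01.
rewrite subr0 mul0r addr0; apply => j.
by rewrite subr0 mul0r addr0.
Qed.

(** Continuity at the single point [y] is enough: away from [y], the difference
    [g x - g y] is at most a multiple of [(x - y)^2], whose mean tends to [0]. *)
Lemma bernstein_cvg (g : R -> R) (M y : R) : 0 <= y <= 1 -> (forall x, `|g x| <= M) ->
  {for y, continuous g} ->
  (bernstein k (fun j => g (j%:R / k%:R))).[y] @[k --> \oo] --> g y.
Proof.
move=> y01 gM gy; apply/cvgrPdist_le => e e0.
have e2 : 0 < e / 2 by rewrite divr_gt0.
have /cvgrPdist_le/(_ _ e2) := gy.
move=> /nbhs_ballP[r /= r0 hr].
have M0 : 0 <= M by exact: le_trans (gM 0).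
pose K := 2 * M / r ^+ 2.
have K0 : 0 <= K by apply: divr_ge0; [exact: mulr_ge0|exact: sqr_ge0].
have gb x : `|g x - g y| <= e / 2 + K * (x - y) ^+ 2.
  have [xy|xy] := ltP `|y - x| r.
    rewrite distrC; apply: le_trans (hr x _) _; first exact: xy.
    by rewrite lerDl mulr_ge0 ?sqr_ge0.
  apply: (@le_trans _ _ (2 * M)).
    by apply: le_trans (ler_normB _ _) _; have := gM x; have := gM y; lra.
  apply: ler_wpDl; first exact: ltW.
  rewrite /K mulrAC ler_pdivlMr ?exprn_gt0// ler_wpM2l ?mulr_ge0//.
  have -> : (x - y) ^+ 2 = `|y - x| ^+ 2 by rewrite real_normK ?num_real// -sqrrN opprB.
  by rewrite ler_pXn2r// nnegrE ltW.
near=> k.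
have k0 : (0 < k)%N by near: k; exact: nbhs_infty_gt.
have kR : 0 < k%:R :> R by rewrite ltr0n.
have kne : k%:R != 0 :> R by rewrite gt_eqF.
rewrite distrC.
have := @bernstein_bound k (fun j => g (j%:R / k%:R)) y (g y) (k%:R * y) (e / 2) (K / k%:R ^+ 2) y01.
move=> h; apply: le_trans (h _) _.
  move=> j; apply: le_trans (gb _) _.
  rewrite lerD2l le_eqVlt; apply/orP; left; apply/eqP.
  by field.
rewrite subrr expr0n /= addr0.
have yy : y * (1 - y) <= 1 by move: y01 => /andP[? ?]; nra.
have -> : K / k%:R ^+ 2 * (k%:R * (y * (1 - y))) = K * (y * (1 - y)) / k%:R by field.
have : K * (y * (1 - y)) / k%:R <= e / 2.
  rewrite ler_pdivrMr//; apply: (@le_trans _ _ K); first by rewrite ler_piMr.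
  rewrite -ler_pdivrMl//.
  by near: k; exact: nbhs_infty_ger.
lra.
Unshelve. all: by end_near. Qed.

End bernstein.

Section exponential_primitive.
Context (R : realType).
Notation mu := (@lebesgue_measure R).

(** The primitive of [p.[expR (- x)]] that vanishes at [0], for [p] without
    constant term. The summand of index [0] is zero since [1 - expR 0] is. *)
Definition exp_primitive (p : {poly R}) (x : R) : R :=
  \sum_(m < size p) p`_m * (m%:R^-1 * (1 - expR (- (m%:R * x)))).

Lemma continuous_expRN : continuous (fun t : R => expR (- t)).
Proof.
move=> z; apply/differentiable_continuous/derivable1_diffP.
have D : is_derive z (1 : R) (fun t : R => expR (- t)) (- expR (- z)).
  by apply: is_derive_eq; rewrite /GRing.scale /= mulrN1.
by case: D.
Qed.

Lemma horner_expRN (p : {poly R}) (x : R) :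
  p.[expR (- x)] = \sum_(m < size p) p`_m * expR (- (m%:R * x)).
Proof.
rewrite horner_coef; apply: eq_bigr => m _.
by rewrite -expRM_natl mulrN.
Qed.

Lemma exp_primitive0 (p : {poly R}) : exp_primitive p 0 = 0.
Proof.
by rewrite /exp_primitive big1// => m _; rewrite mulr0 oppr0 expR0 subrr !mulr0.
Qed.

Lemma is_derive_exp_primitive (p : {poly R}) (x : R) : p`_0 = 0 ->
  is_derive x (1 : R) (exp_primitive p) p.[expR (- x)].
Proof.
move=> p0; rewrite horner_expRN /exp_primitive.
have h (m : 'I_(size p)) : is_derive x (1 : R)
    (fun x => p`_m * (m%:R^-1 * (1 - expR (- (m%:R * x))))) (p`_m * expR (- (m%:R * x))).
  apply: is_derive_eq; rewrite /GRing.scale /=.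
  have [->|m0] := eqVneq (m : nat) 0%N; first by rewrite p0; ring.
  by field; rewrite pnatr_eq0.
have := is_derive_sum h.
by congr (is_derive _ _ _ _); apply/funext => z; rewrite fct_sumE.
Qed.

Lemma exp_primitive_integral (p : {poly R}) (x : R) : p`_0 = 0 -> 0 <= x ->
  exp_primitive p x = \int[mu]_(t in `[0, x]) p.[expR (- t)].
Proof.
move=> p0; rewrite le_eqVlt => /orP[/eqP <-|x0].
  by rewrite exp_primitive0 set_itv1 Rintegral_set1.
have D z := is_derive_exp_primitive z p0.
rewrite /Rintegral (@continuous_FTC2 _ (fun t => p.[expR (- t)]) (exp_primitive p))//.
- by rewrite /= exp_primitive0 subr0.
- apply: continuous_subspaceT => z; apply: (cvg_comp (fun t => expR (- t)) (horner p)); last exact: continuous_horner.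
  exact: continuous_expRN.
- have c : continuous (exp_primitive p) by move=> z; apply/differentiable_continuous/derivable1_diffP; case: (D z).
  split; [by move=> z _; case: (D z) | exact/cvg_at_right_filter/c | exact/cvg_at_left_filter/c].
- by move=> z _; rewrite derive1E; case: (D z).
Qed.

Lemma exp_primitive_bound (p : {poly R}) (x M : R) : p`_0 = 0 -> 0 <= x ->
  (forall y, 0 <= y <= 1 -> `|p.[y]| <= M) -> `|exp_primitive p x| <= M * x.
Proof.
move=> p0 x0 pM; rewrite exp_primitive_integral//.
have mp : measurable_fun [set: R] (fun t : R => p.[expR (- t)]).
  apply: continuous_measurable_fun => z; apply: (cvg_comp (fun t => expR (- t)) (horner p)); last exact: continuous_horner.
  exact: continuous_expRN.
have mux : mu `[0, x] = x%:E.
  rewrite lebesgue_measure_itv /= lte_fin; case: ltP => //; first by rewrite oppr0 adde0.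
  by move=> h; congr EFin; apply/eqP; rewrite eq_le x0 h.
have ic : mu.-integrable `[0, x] (EFin \o cst M).
  apply: continuous_compact_integrable; first exact: segment_compact.
  by apply: continuous_subspaceT => z; exact: cvg_cst.
have pb t : `[0, x]%classic t -> `|p.[expR (- t)]| <= M.
  rewrite /= in_itv /= => /andP[t0 _]; apply: pM.
  by rewrite expR_ge0 /= expR_le1 oppr_le0.
have ip : mu.-integrable `[0, x] (EFin \o (fun t => p.[expR (- t)])).
  apply: le_integrable ic => //; first by apply/measurable_EFinP; exact: measurable_funTS.
  by move=> t ht /=; rewrite lee_fin; apply: le_trans (pb _ ht) (ler_norm _).
apply: le_trans (le_normr_Rintegral _ ip) _ => //.
apply: (@le_trans _ _ (\int[mu]_(t in `[0, x]) M)).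
  apply: le_Rintegral => //; exact: (integrable_norm ip).
by rewrite Rintegral_cst// [fine _](_ : _ = x)//; rewrite -[RHS]/(fine x%:E) -mux.
Qed.

End exponential_primitive.

Section exponential_approximation.
Context (R : realType).
Notation mu := (@lebesgue_measure R).
Variables (u v : R -> R) (M : R).
Hypothesis uv : forall x, is_derive x (1 : R) u (v x).
Hypothesis cv : continuous v.
Hypothesis vM : forall x, `|v x| <= M.

(** [v] in the variable [y = exp(- x)]. Convergence is needed for positive [y]
    only; the value [0] at the origin removes the constant term of the Bernstein
    polynomials. *)
Let w (y : R) : R := if 0 < y then v (- ln y) else 0.

Let M0 : 0 <= M. Proof. exact: le_trans (vM 0). Qed.

Let wM y : `|w y| <= M.
Proof. by rewrite /w; case: ifP => // _; rewrite normr0. Qed.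

Definition exp_approx k : {poly R} := bernstein k (fun j => w (j%:R / k%:R)).

Lemma exp_approx0 k : (exp_approx k)`_0 = 0.
Proof. by rewrite -horner_coef0 bernstein_at0 mul0r /w ltxx. Qed.

Lemma exp_approx_bound k y : 0 <= y <= 1 -> `|(exp_approx k).[y]| <= M.
Proof. by move=> y01; apply: bernstein_norm_le => // j; exact: wM. Qed.

Lemma exp_approx_cvg x : 0 <= x -> (exp_approx k).[expR (- x)] @[k --> \oo] --> v x.
Proof.
move=> x0.
have -> : v x = w (expR (- x)) by rewrite /w expR_gt0 expRK opprK.
apply: (@bernstein_cvg _ _ M) => //.
  by rewrite expR_ge0 expR_le1 oppr_le0.
have e0 := expR_gt0 (- x).
have c : {for expR (- x), continuous (fun y => v (- ln y))}.
  have cl : {for expR (- x), continuous (@ln R)} by exact: continuous_ln.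
  apply: (cvg_comp (fun y => - ln y) v); last exact: cv.
  exact: (@cvgN _ R^o).
rewrite /prop_for /continuous_at {2}/w e0.
apply: cvg_trans c; apply: near_eq_cvg.
by near=> y; rewrite /w ifT//; near: y; exact: lt_nbhsr.
Unshelve. all: by end_near. Qed.

Lemma exp_primitive_cvg x : 0 <= x ->
  exp_primitive (exp_approx k) x @[k --> \oo] --> u x - u 0.
Proof.
move=> x0.
have ce k : continuous (fun t : R => (exp_approx k).[expR (- t)]).
  move=> z; apply: (cvg_comp (fun t => expR (- t)) (horner (exp_approx k))); last exact: continuous_horner.
  exact: continuous_expRN.
have iM : mu.-integrable `[0, x] (EFin \o (cst M : R -> R)).
  apply: continuous_compact_integrable; first exact: segment_compact.
  by apply: continuous_subspaceT => z; exact: cvg_cst.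
have -> : u x - u 0 = \int[mu]_t (v \_ `[0, x]) t.
  rewrite -Rintegral_mkcond.
  move: x0; rewrite le_eqVlt => /orP[/eqP <-|x0].
    by rewrite subrr set_itv1 Rintegral_set1.
  rewrite /Rintegral (@continuous_FTC2 _ v u)//.
  - exact: continuous_subspaceT.
  - have c : continuous u by move=> z; apply/differentiable_continuous/derivable1_diffP; case: (uv z).
    split; [by move=> z _; case: (uv z) | exact/cvg_at_right_filter/c | exact/cvg_at_left_filter/c].
  - by move=> z _; rewrite derive1E; case: (uv z).
under eq_fun do rewrite (exp_primitive_integral (exp_approx0 _) x0) Rintegral_mkcond.
have := @dominated_convergence_R _ _ _ mu
  (fun k => (fun t => (exp_approx k).[expR (- t)]) \_ `[0, x]) (v \_ `[0, x]) ((cst M) \_ `[0, x]).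
apply.
- move=> k; apply/(measurable_restrict _ _ _) => //; apply: measurable_funTS.
  exact: continuous_measurable_fun.
- apply/(measurable_restrict _ _ _) => //; apply: measurable_funTS.
  exact: continuous_measurable_fun.
- move=> t; rewrite patchE; case: ifPn => h.
    under eq_fun do rewrite patchE h.
    by apply: exp_approx_cvg; move: h; rewrite inE /= in_itv /= => /andP[].
  by under eq_fun do rewrite patchE (negbTE h); exact: cvg_cst.
- by rewrite -restrict_EFin; apply/integrable_restrict => //=; rewrite setTI.
- move=> k t; rewrite !patchE; case: ifPn => h; last by rewrite normr0.
  apply: exp_approx_bound; move: h; rewrite inE /= in_itv /= => /andP[t0 _].
  by rewrite expR_ge0 expR_le1 oppr_le0.
Qed.

End exponential_approximation.

(** * Gaussian integration by parts for functions of the norm *)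

Section gaussian_integration_by_parts_for_the_norm.
Context d (T : measurableType d) (R : realType) (P : probability T R).
Context (n : nat) (X : 'I_n -> T -> R) (C : 'I_n -> 'I_n -> R).
Hypothesis gX : gaussian_vector P X C.
Notation S := (sqnorm X).
Notation Q := (qform X C).
Notation tr := (\sum_i C i i).

Let mS : measurable_fun [set: T] S := itg_measurable (itg_sqnorm gX).
Let iS : itg P S := itg_sqnorm gX.
Let iQ : itg P Q := itg_qform gX.

Lemma itg_sqnorm2 : itg P (fun w => S w * S w).
Proof.
have -> : (fun w => S w * S w) = (fun w => \sum_i \sum_j X i w * X i w * X j w * X j w).
  apply/funext => w; rewrite /sqnorm mulr_suml; apply: eq_bigr => i _.
  by rewrite mulr_sumr; apply: eq_bigr => j _; ring.
apply: itg_sum => i; apply: itg_sum => j.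
by apply: itg_mul4; exact: (X_moment4 gX).
Qed.

Let mE m : measurable_fun [set: T] (fun w => expR (- (m * S w))).
Proof. by apply: measurableT_comp => //; apply: measurableT_comp => //; exact: measurable_funM. Qed.

Let E1 m w : 0 <= m -> `|expR (- (m * S w))| <= 1.
Proof.
move=> m0; rewrite ger0_norm ?expR_ge0// expR_le1 oppr_le0 mulr_ge0//.
exact: sqnorm_ge0.
Qed.

Let iSc : itg P (fun w => S w - tr).
Proof. by apply: itgB => //; exact: itg_cst. Qed.

Lemma integral_sqnorm : \int[P]_w S w = tr.
Proof.
have := gaussian_laplace_ibp gX (lexx 0).
under eq_Rintegral do rewrite mul0r oppr0 expR0 mulr1.
under [X in _ = _ * X - _]eq_Rintegral do rewrite mul0r oppr0 expR0.
by rewrite Rintegral_prob_cst => ->; ring.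
Qed.

Let laplace_centered (m : R) : 0 <= m ->
  \int[P]_w ((S w - tr) * expR (- (m * S w))) =
  - (2 * m * \int[P]_w (Q w * expR (- (m * S w)))).
Proof.
move=> m0.
have i1 : itg P (fun w => S w * expR (- (m * S w))).
  by apply: itg_mul_bounded => // w; exact: E1.
have i2 : itg P (fun w => expR (- (m * S w))).
  by apply: (@itg_bounded _ _ _ P _ 1) => // w; exact: E1.
transitivity (\int[P]_w (S w * expR (- (m * S w)) - tr * expR (- (m * S w)))).
  by apply: eq_Rintegral => w _; ring.
rewrite RintegralB//; last exact: itgZ.
by rewrite RintegralZl// (gaussian_laplace_ibp gX m0); ring.
Qed.

(** By linearity from [gaussian_laplace_ibp]. The derivative of
    [exp_primitive p] is [p.[expR (- x)]]. *)
Lemma polynomial_ibp (p : {poly R}) : p`_0 = 0 ->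
  \int[P]_w ((S w - tr) * exp_primitive p (S w)) =
  2 * \int[P]_w (Q w * p.[expR (- S w)]).
Proof.
move=> p0.
have ib U (m : R) : 0 <= m -> itg P U -> itg P (fun w => U w * expR (- (m * S w))).
  by move=> m0 Ui; apply: itg_mul_bounded => // w; exact: E1.
transitivity (\sum_(m < size p) \int[P]_w (p`_m * (m%:R^-1 *
    ((S w - tr) - (S w - tr) * expR (- (m%:R * S w)))))).
  rewrite -Rintegral_sum.
    apply: eq_Rintegral => w _; rewrite /exp_primitive mulr_sumr.
    by apply: eq_bigr => m _; ring.
  by move=> m; do 2 apply: itgZ; apply: itgB => //; exact: ib.
transitivity (\sum_(m < size p) 2 * \int[P]_w (p`_m * (Q w * expR (- (m%:R * S w))))); last first.
  rewrite -mulr_sumr -Rintegral_sum.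
    congr (_ * _); apply: eq_Rintegral => w _; rewrite horner_expRN mulr_sumr.
    by apply: eq_bigr => m _; ring.
  by move=> m; apply: itgZ; exact: ib.
apply: eq_bigr => m _.
rewrite !RintegralZl//; [|exact: ib|by apply: itgB => //; exact: ib|by apply: itgZ; apply: itgB => //; exact: ib].
rewrite RintegralB//; last exact: ib.
rewrite RintegralB//; last exact: itg_cst.
rewrite Rintegral_prob_cst integral_sqnorm subrr laplace_centered//.
have [->|m0] := eqVneq (m : nat) 0%N; first by rewrite p0; ring.
by field; rewrite pnatr_eq0.
Qed.

(** Both sides are limits along [exp_approx v]: the polynomials stay bounded by
    [M] and their primitives at [S] by [M S], which gives the dominations. *)
Lemma sqnorm_ibp (u v : R -> R) (M : R) :
  (forall x, is_derive x (1 : R) u (v x)) -> continuous v -> (forall x, `|v x| <= M) ->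
  \int[P]_w ((S w - tr) * u (S w)) = 2 * \int[P]_w (Q w * v (S w)).
Proof.
move=> uv cv vM.
have M0 : 0 <= M by exact: le_trans (vM 0).
pose p k := exp_approx v k.
have mp k : measurable_fun [set: T] (fun w => (p k).[expR (- S w)]).
  apply: (measurableT_comp (f := horner (p k))).
    by apply: continuous_measurable_fun; exact: continuous_horner.
  by apply: measurableT_comp => //; exact: measurableT_comp.
have cu : continuous u by move=> z; apply/differentiable_continuous/derivable1_diffP; case: (uv z).
have mu' : measurable_fun [set: T] (fun w => u (S w)).
  by apply: (measurableT_comp (f := u)) => //; exact: continuous_measurable_fun.
have mv : measurable_fun [set: T] (fun w => v (S w)).
  by apply: (measurableT_comp (f := v)) => //; exact: continuous_measurable_fun.
have mprim k : measurable_fun [set: T] (fun w => exp_primitive (p k) (S w)).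
  apply: measurable_sum => m; apply: measurable_funM => //; apply: measurable_funM => //.
  exact: measurable_funB.
have mQ := itg_measurable iQ.
have mSc := itg_measurable iSc.
have iSS : itg P (fun w => M * (S w * S w + `|tr| * S w)).
  by apply: itgZ; apply: itgD; [exact: itg_sqnorm2|exact: itgZ].
have dom (y : T) (z : R) : `|z| <= M * S y -> `|(S y - tr) * z| <= M * (S y * S y + `|tr| * S y).
  move=> h; rewrite normrM.
  have S0 := sqnorm_ge0 X y.
  have h2 : `|S y - tr| <= S y + `|tr| by apply: le_trans (ler_normB _ _) _; rewrite ger0_norm.
  apply: le_trans (ler_pM _ _ h2 h) _ => //.
  by rewrite le_eqVlt; apply/orP; left; apply/eqP; ring.
(* The bound on the primitives passes to the limit. *)
have du y : 0 <= y -> `|u y - u 0| <= M * y.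
  move=> y0; have c := @exp_primitive_cvg _ u v M uv cv vM y y0.
  have /cvg_norm c' := c.
  apply: (ler_cvg_to c' (cvg_cst (M * y))); apply: nearW => k.
  apply: exp_primitive_bound => //; first exact: exp_approx0.
  by move=> z; exact: exp_approx_bound.
have c1 : \int[P]_w ((S w - tr) * exp_primitive (p k) (S w)) @[k --> \oo] -->
    \int[P]_w ((S w - tr) * (u (S w) - u 0)).
  have := @dominated_convergence_R _ _ _ P
    (fun k w => (S w - tr) * exp_primitive (p k) (S w))
    (fun w => (S w - tr) * (u (S w) - u 0)) _ _ _ _ iSS.
  apply.
  - by move=> k; exact: measurable_funM.
  - by apply: measurable_funM => //; exact: measurable_funB.
  - move=> w; apply: cvgM; first exact: cvg_cst.
    by apply: (exp_primitive_cvg uv cv vM); exact: sqnorm_ge0.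
  - move=> k w; apply: dom; apply: exp_primitive_bound; [exact: exp_approx0|exact: sqnorm_ge0|].
    by move=> y; exact: exp_approx_bound.
have c2 : \int[P]_w ((S w - tr) * exp_primitive (p k) (S w)) @[k --> \oo] -->
    2 * \int[P]_w (Q w * v (S w)).
  under eq_fun do rewrite (polynomial_ibp (exp_approx0 v _)).
  apply: cvgM; first exact: cvg_cst.
  have := @dominated_convergence_R _ _ _ P
    (fun k w => Q w * (p k).[expR (- S w)])
    (fun w => Q w * v (S w)) (fun w => M * `|Q w|).
  apply.
  - by move=> k; exact: measurable_funM.
  - exact: measurable_funM.
  - move=> w; apply: cvgM; first exact: cvg_cst.
    by apply: (exp_approx_cvg cv vM); exact: sqnorm_ge0.
  - by apply: itgZ; exact: itg_norm.
  - move=> k w; rewrite normrM mulrC ler_wpM2r//; apply: (exp_approx_bound vM).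
    by rewrite expR_ge0 expR_le1 oppr_le0 sqnorm_ge0.
rewrite -(cvg_unique _ c1 c2)//.
have i1 : itg P (fun w => (S w - tr) * (u (S w) - u 0)).
  apply: itg_dom iSS => [|w].
    by apply: measurable_funM => //; exact: measurable_funB.
  by apply: dom; apply: du; exact: sqnorm_ge0.
transitivity (\int[P]_w ((S w - tr) * (u (S w) - u 0) + u 0 * (S w - tr))).
  by apply: eq_Rintegral => w _; ring.
rewrite RintegralD//; last exact: itgZ.
rewrite RintegralZl// RintegralB//; last exact: itg_cst.
by rewrite Rintegral_prob_cst integral_sqnorm subrr mulr0 addr0.
Qed.

End gaussian_integration_by_parts_for_the_norm.

(** * Stein's equation for the normal law *)

Section stein_equation.
Context (R : realType).
Notation mu := (@lebesgue_measure R).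
Notation phi := (normal_pdf (0 : R) 1).

Let phi_gt0 (x : R) : 0 < phi x.
Proof. by rewrite normal_pdfE ?oner_neq0// mulr_gt0 ?expR_gt0// normal_peak_gt0// oner_neq0. Qed.

Let Dphi (x : R) : is_derive x (1 : R) phi (- x * phi x).
Proof.
have := is_derive_normal_pdf 0 (ltr01 : 0 < 1 :> R) x.
by rewrite subr0 expr1n divr1.
Qed.

Let cphi : continuous phi. Proof. by apply: continuous_normal_pdf; rewrite oner_neq0. Qed.

Let phiN x : phi (- x) = phi x.
Proof. by rewrite normal_pdfE ?oner_neq0// /normal_fun !subr0 sqrrN. Qed.

Let iphi : itg mu phi. Proof. exact: integrable_normal_pdf. Qed.

Let ixphi : itg mu (fun x => x * phi x).
Proof. by apply: (@itg_mul_normal_pdf _ 0 1 ltr01 _ 1) => // x; rewrite subr0 normr_le_pow4. Qed.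

Let phi_y : phi x @[x --> +oo] --> (0 : R).
Proof.
have [C HC] := @normal_pdf_decay R 0 1 ltr01 (fun=> 1) 1
  (fun x => ltac:(by rewrite normr1 mul1r lerDl)).
apply/cvgrPdist_le => e e0; near=> x.
have x1 : 1 <= x by near: x; exact: nbhs_pinfty_ge.
have x0 : 0 < x by rewrite (lt_le_trans ltr01).
rewrite sub0r normrN; have := HC x; rewrite subr0 (gtr0_norm x0) mul1r => /(_ x1) h.
have hx : C / e <= x by near: x; apply: nbhs_pinfty_ge; exact: num_real.
by apply: le_trans h _; rewrite ler_pdivrMr// mulrC -ler_pdivrMr.
Unshelve. all: by end_near. Qed.

(** [t * phi t] is the derivative of [- phi]. *)
Lemma normal_upper_tail (x : R) : 0 <= x -> \int[mu]_(t in `[x, +oo[) (t * phi t) = phi x.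
Proof.
move=> x0.
have D (y : R) : is_derive y (1 : R) (fun t => - phi t) (y * phi y).
  by have D' := Dphi y; apply: is_derive_eq; rewrite mulNr opprK.
rewrite (@Rintegral_ge0_continuous_FTC2y _ _ (fun t => - phi t) x 0).
- by rewrite sub0r opprK.
- by move=> y xy; rewrite mulr_ge0 ?normal_pdf_ge0// (le_trans x0).
- apply: continuous_subspaceT => y; apply: cvgM; [exact: cvg_id|exact: cphi].
- by have hN := cvgN phi_y; rewrite oppr0 in hN; exact: hN.
- by move=> y _; case: (D y).
- by apply: cvg_at_right_filter; apply: cvgN; exact: cphi.
- by move=> y _; rewrite derive1E; case: (D y).
Qed.

Lemma normal_lower_tail (x : R) : x <= 0 -> \int[mu]_(t in `]-oo, x]) (- t * phi t) = phi x.
Proof.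
move=> x0; have x0' : 0 <= - x by rewrite oppr_ge0.
rewrite -[RHS]phiN -(normal_upper_tail x0') /Rintegral; congr fine.
have := @ge0_integration_by_substitutionNy _ (fun t => - t * phi t) (- x).
rewrite opprK => ->.
- by apply: eq_integral => t _ /=; rewrite opprK phiN.
- apply: continuous_subspaceT => y; apply: cvgM; last exact: cphi.
  exact: (@cvgN _ R^o).
- move=> y; rewrite in_itv /= => yx; rewrite mulr_ge0 ?normal_pdf_ge0// oppr_ge0.
  exact: le_trans (ltW yx) x0.
Qed.

Section solution.
Variable h : R -> R.
Hypothesis ch : continuous h.
Hypothesis h01 : forall x, 0 <= h x <= 1.

Let c := \int[mu]_x (h x * phi x).
Let g x := (h x - c) * phi x.

Let mh : measurable_fun [set: R] h. Proof. exact: continuous_measurable_fun. Qed.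

Let ihphi : itg mu (fun x => h x * phi x).
Proof.
apply: (@itg_dom _ _ _ mu _ phi) => // [|x].
  by apply: measurable_funM => //; exact: measurable_normal_pdf.
rewrite normrM (ger0_norm (normal_pdf_ge0 _ _ _)) ler_piMl ?normal_pdf_ge0//.
by have /andP[? ?] := h01 x; rewrite ger0_norm.
Qed.

Let int_phi : \int[mu]_x phi x = 1.
Proof. by rewrite /Rintegral integral_normal_pdf. Qed.

Let c01 : 0 <= c <= 1.
Proof.
apply/andP; split.
  apply: Rintegral_ge0 => x _; rewrite mulr_ge0 ?normal_pdf_ge0//.
  by have /andP[] := h01 x.
rewrite -int_phi; apply: le_Rintegral => // x _.
by rewrite ler_piMl ?normal_pdf_ge0//; have /andP[] := h01 x.
Qed.

Let ig : itg mu g.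
Proof.
have := itgB ihphi (itgZ c iphi).
by congr (integrable _ _ _); apply/funext => x /=; rewrite /g mulrBl.
Qed.

Let int_g : \int[mu]_x g x = 0.
Proof.
transitivity (\int[mu]_x (h x * phi x - c * phi x)).
  by apply: eq_Rintegral => x _; rewrite /g mulrBl.
by rewrite RintegralB//; [rewrite RintegralZl// int_phi mulr1 subrr|exact: itgZ].
Qed.

Let hc1 x : `|h x - c| <= 1.
Proof.
have /andP[? ?] := h01 x; have /andP[? ?] := c01.
by rewrite ler_norml; apply/andP; split; lra.
Qed.

Let g_le x : `|g x| <= phi x.
Proof.
by rewrite /g normrM (ger0_norm (normal_pdf_ge0 _ _ _)) ler_piMl ?normal_pdf_ge0.
Qed.

Let F x := \int[mu]_(t in `]-oo, x]) g t.

Let cg : continuous g.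
Proof.
by move=> x; apply: cvgM; [apply: cvgB; [exact: ch|exact: cvg_cst]|exact: cphi].
Qed.

Let DF (x : R) : is_derive x (1 : R) F (g x).
Proof.
have xu : x < x + 1 by rewrite ltrDl.
have gu : mu.-integrable [set` Interval -oo%O (BRight (x + 1))] (EFin \o g).
  exact: integrableS ig.
have := @continuous_FTC1 _ g -oo%O x _ xu gu; rewrite ltNyr => /(_ isT (@cg x)) [d1 d2].
by apply: DeriveDef => //; rewrite -derive1E.
Qed.

Let iS (A : set (measurableTypeR R)) (k : R -> R) : measurable A -> itg mu k -> mu.-integrable A (EFin \o k).
Proof. by move=> mA; exact: integrableS. Qed.

(** On a half-line beyond [x], replace [x] by the variable of integration. *)
Let tail_bound (A : set (measurableTypeR R)) (b : R -> R) (x : R) : measurable A ->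
  mu.-integrable A (EFin \o b) -> (forall t, A t -> `|x| * phi t <= b t) ->
  `|x * \int[mu]_(t in A) g t| <= \int[mu]_(t in A) b t.
Proof.
move=> mA ib hb; rewrite -RintegralZl//; last exact: iS.
have i1 : mu.-integrable A (EFin \o (fun t => x * g t)) by apply: iS => //; exact: itgZ.
have l1 := le_normr_Rintegral mA i1; apply: (le_trans l1).
apply: le_Rintegral => // [|t At]; first exact: (integrable_norm i1).
by rewrite normrM; apply: le_trans (hb t At); rewrite ler_wpM2l.
Qed.

(** Since [g] has zero integral, [F x] is also minus the integral over the upper
    half-line; use the half-line on the side of [x] away from the origin. *)
Let F_bound x : `|x * F x| <= phi x.
Proof.
have [x0|x0] := leP 0 x.
  have -> : F x = - \int[mu]_(t in `]x, +oo[) g t.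
    have := @Rintegral_itvB _ g -oo%O +oo%O x.
    rewrite set_itvNyy => /(_ ig isT isT); rewrite int_g sub0r => <-.
    by rewrite opprK.
  rewrite mulrN normrN -(normal_upper_tail x0).
  rewrite Rintegral_itv_obnd_cbnd; last by apply: iS.
  apply: tail_bound => //; first exact: iS.
  move=> t; rewrite /= in_itv /= andbT => xt; rewrite ler_wpM2r ?normal_pdf_ge0//.
  by rewrite ger0_norm.
rewrite -(normal_lower_tail (ltW x0)); apply: tail_bound => //.
  apply: iS => //; have := itgN ixphi.
  by congr (integrable _ _ _); apply/funext => t /=; rewrite mulNr.
move=> t; rewrite /= in_itv /= => xt; rewrite ler_wpM2r ?normal_pdf_ge0//.
by rewrite ltr0_norm// lerN2.
Qed.

(** The solution is [F / phi]. The bound on [df] is the sum of [|x f x| <= 1],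
    which is [F_bound], and of [|h x - c| <= 1]. *)
Lemma stein_solution : exists f df : R -> R,
  [/\ forall x, is_derive x (1 : R) f (df x), continuous df,
      forall x, `|df x| <= 2 & forall x, df x = x * f x + h x - c].
Proof.
pose f x := F x * (phi x)^-1.
pose df x := x * f x + h x - c.
have Df (x : R) : is_derive x (1 : R) f (df x).
  have D1 := DF x; have D2 := Dphi x.
  have p0 : phi x != 0 by rewrite gt_eqF.
  have D3 : is_derive x (1 : R) (fun x => (phi x)^-1) (- (phi x) ^- 2 *: (- x * phi x)).
    exact: is_deriveV.
  apply: is_derive_eq; rewrite /df /f /g /GRing.scale /=; by field.
have cf : continuous f.
  by move=> x; apply/differentiable_continuous/derivable1_diffP; case: (Df x).
exists f, df; split => //.
- move=> x; apply: cvgB; last exact: cvg_cst.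
  by apply: cvgD; [apply: cvgM; [exact: cvg_id|exact: cf]|exact: ch].
- move=> x; rewrite /df -addrA; apply: le_trans (ler_normD _ _) _.
  have : `|x * f x| <= 1.
    rewrite /f mulrA normrM normfV (gtr0_norm (phi_gt0 x)) ler_pdivrMr//.
    by rewrite mul1r.
  by have := hc1 x; lra.
Qed.

End solution.

End stein_equation.

(** * Stein's bound for a quadratic form *)

Section stein_bound.
Context d (T : measurableType d) (R : realType) (P : probability T R).

(** Average [|y| <= y^2 / (2 s) + s / 2]. *)
Lemma Rintegral_norm_le_sqrt (Y : T -> R) (s : R) : 0 < s -> measurable_fun [set: T] Y ->
  itg P (fun w => Y w ^+ 2) -> \int[P]_w (Y w ^+ 2) <= s ^+ 2 ->
  itg P Y /\ \int[P]_w `|Y w| <= s.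
Proof.
move=> s0 mY Y2 Ys.
have b w : `|Y w| <= (2 * s)^-1 * Y w ^+ 2 + s / 2.
  have -> : Y w ^+ 2 = `|Y w| ^+ 2 by rewrite real_normK ?num_real.
  have := sqr_ge0 (`|Y w| - s); set y := `|Y w| => h.
  rewrite -(ler_pM2l (_ : 0 < 2 * s)); last by rewrite mulr_gt0.
  rewrite mulrDr mulrA divff ?mul1r; last by rewrite gt_eqF// mulr_gt0.
  have -> : 2 * s * (s / 2) = s ^+ 2 by field.
  by move: h; rewrite sqrrB; lra.
have ib : itg P (fun w => (2 * s)^-1 * Y w ^+ 2 + s / 2).
  by apply: itgD; [exact: itgZ|exact: itg_cst].
have iY : itg P Y by exact: itg_dom ib.
split=> //.
apply: (@le_trans _ _ (\int[P]_w ((2 * s)^-1 * Y w ^+ 2 + s / 2))).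
  by apply: le_Rintegral => //; exact: itg_norm.
rewrite RintegralD//; [|exact: itgZ|exact: itg_cst].
rewrite Rintegral_prob_cst RintegralZl//.
have : (2 * s)^-1 * \int[P]_w (Y w ^+ 2) <= (2 * s)^-1 * s ^+ 2.
  by rewrite ler_wpM2l// invr_ge0 mulr_ge0// ltW.
have -> : (2 * s)^-1 * s ^+ 2 = s / 2 by field; rewrite gt_eqF.
lra.
Qed.

Context (n : nat) (X : 'I_n -> T -> R) (C : 'I_n -> 'I_n -> R).
Hypothesis gX : gaussian_vector P X C.
Notation S := (sqnorm X).
Notation Q := (qform X C).
Notation tr := (\sum_i C i i).

(** By Stein's equation the left-hand side is [E (df(F) - F f(F))], and
    integration by parts turns it into [E ((1 - 2 a^2 Q) df(F))]. *)
Lemma stein_bound (a : R) (h : R -> R) : continuous h -> (forall x, 0 <= h x <= 1) ->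
  `|\int[P]_w h (a * (S w - tr)) - \int[lebesgue_measure]_x (h x * normal_pdf 0 1 x)| <=
  2 * \int[P]_w `|1 - 2 * a ^+ 2 * Q w|.
Proof.
move=> ch h01.
have [f [df [Df cdf df2 dfE]]] := stein_solution ch h01.
set c := \int[lebesgue_measure]_x _ in dfE *.
have mS := itg_measurable (itg_sqnorm gX).
have iQ := itg_qform gX.
pose F w := a * (S w - tr).
have mF : measurable_fun [set: T] F.
  by apply: measurable_funM => //; exact: measurable_funB.
have mdf : measurable_fun [set: T] (fun w => df (F w)).
  by apply: (measurableT_comp (f := df)) => //; exact: continuous_measurable_fun.
have mh : measurable_fun [set: T] (fun w => h (F w)).
  by apply: (measurableT_comp (f := h)) => //; exact: continuous_measurable_fun.
have idf : itg P (fun w => df (F w)) by exact: (itg_bounded P mdf (fun w => df2 (F w))).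
have ih : itg P (fun w => h (F w)).
  apply: (@itg_bounded _ _ _ P _ 1) => // w.
  by have /andP[? ?] := h01 (F w); rewrite ger0_norm.
pose u x := f (a * (x - tr)); pose v x := a * df (a * (x - tr)).
have Du (x : R) : is_derive x (1 : R) u (v x).
  have D1 := Df (a * (x - tr)).
  by apply: is_derive_eq; rewrite /v /GRing.scale /=; ring.
have cv : continuous v.
  move=> x; apply: cvgM; first exact: cvg_cst.
  apply: (cvg_comp (fun x => a * (x - tr)) df); last exact: cdf.
  by apply: cvgM; [exact: cvg_cst|apply: cvgB; [exact: cvg_id|exact: cvg_cst]].
have vM x : `|v x| <= `|a| * 2 by rewrite /v normrM ler_wpM2l.
have ibp := sqnorm_ibp gX Du cv vM.
have iQd : itg P (fun w => Q w * df (F w)).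
  apply: (@itg_dom _ _ _ P _ (fun w => 2 * `|Q w|)).
  - by apply: measurable_funM => //; exact: itg_measurable iQ.
  - by move=> w; rewrite normrM mulrC ler_wpM2r.
  - by apply: itgZ; exact: itg_norm.
(* Stein's equation bounds [x f x], although [f] itself is not estimated. *)
have iFf : itg P (fun w => F w * f (F w)).
  have := itgD (itgB idf ih) (itg_cst P c).
  by congr (integrable _ _ _); apply/funext => w /=; rewrite dfE; congr EFin; ring.
have ibp' : \int[P]_w (F w * f (F w)) = 2 * a ^+ 2 * \int[P]_w (Q w * df (F w)).
  have [a0|a0] := eqVneq a 0.
    transitivity (\int[P]_w (0 : R)); last by rewrite a0 expr0n /= mulr0 mul0r Rintegral_prob_cst.
    by apply: eq_Rintegral => w _; rewrite /F a0 !mul0r.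
  have iSf : itg P (fun w => (S w - tr) * u (S w)).
    have := itgZ a^-1 iFf; congr (integrable _ _ _); apply/funext => w /=; congr EFin.
    by rewrite /F /u !mulrA mulVf// mul1r.
  transitivity (\int[P]_w (a * ((S w - tr) * u (S w)))).
    by apply: eq_Rintegral => w _; rewrite /F /u mulrA.
  rewrite RintegralZl// ibp.
  have -> : \int[P]_w (Q w * v (S w)) = \int[P]_w (a * (Q w * df (F w))).
    by apply: eq_Rintegral => w _; rewrite /v /F; ring.
  by rewrite RintegralZl//; ring.
have -> : \int[P]_w h (a * (S w - tr)) - c = \int[P]_w ((1 - 2 * a ^+ 2 * Q w) * df (F w)).
  transitivity (\int[P]_w (df (F w) - F w * f (F w))).
    rewrite -[c in LHS](Rintegral_prob_cst P) -RintegralB//; last exact: itg_cst.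
    by apply: eq_Rintegral => w _; rewrite dfE /F; ring.
  rewrite RintegralB// ibp' -RintegralZl// -RintegralB//; last exact: itgZ.
  by apply: eq_Rintegral => w _; ring.
have iG : itg P (fun w => 1 - 2 * a ^+ 2 * Q w).
  by apply: itgB; [exact: itg_cst|exact: itgZ].
have iGd : itg P (fun w => (1 - 2 * a ^+ 2 * Q w) * df (F w)).
  have := itgB idf (itgZ (2 * a ^+ 2) iQd).
  by congr (integrable _ _ _); apply/funext => w /=; congr EFin; ring.
have l1 := le_normr_Rintegral measurableT iGd; apply: (le_trans l1).
rewrite -RintegralZl//; last exact: itg_norm.
apply: le_Rintegral => //.
- exact: (itg_norm iGd).
- by apply: itgZ; exact: itg_norm.
- by move=> w _; rewrite normrM mulrC ler_wpM2r.
Qed.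

Lemma integral_qform : \int[P]_w Q w = \sum_i \sum_j C i j ^+ 2.
Proof.
have i2 i j : itg P (fun w => C i j * X i w * X j w).
  by under eq_fun do rewrite -mulrA; apply: itgZ; apply: itg_mul2; exact: (X_moment4 gX).
rewrite /qform Rintegral_sum; last by move=> i; apply: itg_sum => j.
apply: eq_bigr => i _; rewrite Rintegral_sum//; apply: eq_bigr => j _.
under eq_Rintegral do rewrite -mulrA.
rewrite RintegralZl//; last by apply: itg_mul2; exact: (X_moment4 gX).
by rewrite (X_moments gX i j i j).1 expr2.
Qed.

(** Isserlis' formula: the pairing inside each factor gives the square of the mean,
    the two crossed pairings are equal by symmetry of [C]. *)
Lemma integral_qform2 : itg P (fun w => Q w ^+ 2) /\
  \int[P]_w (Q w ^+ 2) = (\sum_i \sum_j C i j ^+ 2) ^+ 2 +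
    2 * \sum_i \sum_l (\sum_j C i j * C j l) ^+ 2.
Proof.
have Q2 w : Q w ^+ 2 = \sum_i \sum_j \sum_k \sum_l
    (C i j * C k l) * (X i w * X j w * X k w * X l w).
  rewrite expr2 /qform mulr_suml; apply: eq_bigr => i _.
  rewrite mulr_suml; apply: eq_bigr => j _.
  rewrite mulr_sumr; apply: eq_bigr => k _.
  by rewrite mulr_sumr; apply: eq_bigr => l _; ring.
have i4 i j k l : itg P (fun w => X i w * X j w * X k w * X l w).
  by apply: itg_mul4; exact: (X_moment4 gX).
have i4' i j k l : itg P (fun w => C i j * C k l * (X i w * X j w * X k w * X l w)).
  exact: itgZ.
split.
  have : itg P (fun w => \sum_i \sum_j \sum_k \sum_l
    (C i j * C k l) * (X i w * X j w * X k w * X l w)).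
    by do 4 (apply: itg_sum => ?); exact: i4'.
  by congr (integrable _ _ _); apply/funext => w /=; rewrite Q2.
under eq_Rintegral do rewrite Q2.
rewrite Rintegral_sum; last by move=> i; do 3 (apply: itg_sum => ?).
have -> : \sum_i \int[P]_w (\sum_j \sum_k \sum_l
      C i j * C k l * (X i w * X j w * X k w * X l w)) =
   \sum_i \sum_j \sum_k \sum_l (C i j * C k l) *
     (C i k * C j l + C i l * C j k + C i j * C k l).
  apply: eq_bigr => i _; rewrite Rintegral_sum; last by move=> j; do 2 (apply: itg_sum => ?).
  apply: eq_bigr => j _; rewrite Rintegral_sum; last by move=> k; apply: itg_sum => ?.
  apply: eq_bigr => k _; rewrite Rintegral_sum//; apply: eq_bigr => l _.
  by rewrite RintegralZl// (X_moments gX i j k l).2.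
have Cs := gv_sym gX.
have sq : \sum_i \sum_l (\sum_j C i j * C j l) ^+ 2 =
    \sum_i \sum_j \sum_k \sum_l C i j * C j l * (C i k * C k l).
  apply: eq_bigr => i _.
  transitivity (\sum_l \sum_j \sum_k C i j * C j l * (C i k * C k l)).
    apply: eq_bigr => l _; rewrite expr2 mulr_suml; apply: eq_bigr => j _.
    by rewrite mulr_sumr.
  rewrite exchange_big; apply: eq_bigr => j _.
  by rewrite exchange_big.
have sq2 : (\sum_i \sum_j C i j ^+ 2) ^+ 2 =
    \sum_i \sum_j \sum_k \sum_l C i j ^+ 2 * C k l ^+ 2.
  rewrite expr2 mulr_suml; apply: eq_bigr => i _.
  rewrite mulr_suml; apply: eq_bigr => j _.
  rewrite mulr_sumr; apply: eq_bigr => k _.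
  by rewrite mulr_sumr.
have swap : \sum_i \sum_j \sum_k \sum_l C i j * C k l * (C i l * C j k) =
    \sum_i \sum_j \sum_k \sum_l C i j * C k l * (C i k * C j l).
  apply: eq_bigr => i _; apply: eq_bigr => j _; rewrite exchange_big.
  by apply: eq_bigr => k _; apply: eq_bigr => l _; rewrite (Cs k l); ring.
have -> : \sum_i \sum_j \sum_k \sum_l (C i j * C k l) *
     (C i k * C j l + C i l * C j k + C i j * C k l) =
   \sum_i \sum_j \sum_k \sum_l C i j * C k l * (C i k * C j l) +
   \sum_i \sum_j \sum_k \sum_l C i j * C k l * (C i l * C j k) +
   \sum_i \sum_j \sum_k \sum_l C i j ^+ 2 * C k l ^+ 2.
  rewrite -!big_split; apply: eq_bigr => i _; rewrite -!big_split.
  apply: eq_bigr => j _; rewrite -!big_split; apply: eq_bigr => k _.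
  by rewrite -!big_split; apply: eq_bigr => l _ /=; ring.
rewrite swap sq sq2.
have -> : \sum_i \sum_j \sum_k \sum_l C i j * C k l * (C i k * C j l) =
    \sum_i \sum_j \sum_k \sum_l C i j * C j l * (C i k * C k l).
  by do 4 (apply: eq_bigr => ? _); ring.
ring.
Qed.

End stein_bound.

Section schur_test.
Context (R : realType) (n : nat).

Lemma weighted_cauchy_schwarz (I : finType) (w x : I -> R) : (forall i, 0 <= w i) ->
  (\sum_i w i * x i) ^+ 2 <= (\sum_i w i) * (\sum_i w i * x i ^+ 2).
Proof.
move=> w0; rewrite -subr_ge0.
have : 0 <= \sum_i \sum_j w i * w j * (x i - x j) ^+ 2.
  by apply: sumr_ge0 => i _; apply: sumr_ge0 => j _; rewrite mulr_ge0 ?sqr_ge0// mulr_ge0.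
have -> : \sum_i \sum_j w i * w j * (x i - x j) ^+ 2 =
    2 * ((\sum_i w i) * (\sum_i w i * x i ^+ 2) - (\sum_i w i * x i) ^+ 2).
  have e (f g : I -> R) : (\sum_i f i) * (\sum_i g i) = \sum_i \sum_j f i * g j.
    by rewrite mulr_suml; apply: eq_bigr => i _; rewrite mulr_sumr.
  have -> : 2 * ((\sum_i w i) * (\sum_i w i * x i ^+ 2) - (\sum_i w i * x i) ^+ 2) =
    (\sum_i w i) * (\sum_i w i * x i ^+ 2) + (\sum_i w i * x i ^+ 2) * (\sum_i w i)
    - 2 * ((\sum_i w i * x i) * (\sum_i w i * x i)) by ring.
  rewrite !e mulr_sumr -sumrN -!big_split; apply: eq_bigr => i _ /=.
  by rewrite mulr_sumr -sumrN -!big_split; apply: eq_bigr => j _ /=; ring.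
lra.
Qed.

(** Cauchy-Schwarz with weights [|C i j|]: the operator norm of [C] is at most its
    largest absolute row sum. *)
Lemma schur_test (C : 'I_n -> 'I_n -> R) (K : R) : (forall i j, C i j = C j i) ->
  (forall i, \sum_j `|C i j| <= K) ->
  \sum_i \sum_l (\sum_j C i j * C j l) ^+ 2 <= K ^+ 2 * \sum_i \sum_j C i j ^+ 2.
Proof.
move=> Cs CK.
have CK' j : \sum_i `|C i j| <= K by under eq_bigr do rewrite Cs.
apply: (@le_trans _ _ (\sum_i \sum_l K * \sum_j `|C i j| * C j l ^+ 2)).
  apply: ler_sum => i _; apply: ler_sum => l _.
  apply: (@le_trans _ _ ((\sum_j `|C i j| * `|C j l|) ^+ 2)).
    rewrite -(real_normK (num_real (\sum_j C i j * C j l))).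
    rewrite ler_pXn2r ?nnegrE//; last by apply: sumr_ge0 => j _; exact: mulr_ge0.
    apply: le_trans (ler_norm_sum _ _ _) _.
    by apply: ler_sum => j _; rewrite normrM.
  apply: le_trans (weighted_cauchy_schwarz _ _) _ => //.
  under [X in _ * X]eq_bigr do rewrite real_normK ?num_real//.
  by rewrite ler_wpM2r// sumr_ge0// => j _; rewrite mulr_ge0 ?sqr_ge0.
have K0 : (0 < n)%N -> 0 <= K.
  by move=> n0; apply: le_trans (CK (Ordinal n0)); exact: sumr_ge0.
have -> : \sum_i \sum_l K * \sum_j `|C i j| * C j l ^+ 2 =
    K * \sum_j \sum_l (\sum_i `|C i j|) * C j l ^+ 2.
  transitivity (\sum_i \sum_j \sum_l K * (`|C i j| * C j l ^+ 2)).
    apply: eq_bigr => i _; rewrite [RHS]exchange_big; apply: eq_bigr => l _.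
    by rewrite mulr_sumr.
  rewrite exchange_big mulr_sumr; apply: eq_bigr => j _.
  rewrite exchange_big mulr_sumr; apply: eq_bigr => l _.
  by rewrite -mulr_sumr mulr_suml.
case: n C Cs CK CK' K0 => [|m] C' Cs' CK1 CK2 K0.
  by rewrite !big_ord0 !mulr0.
have {}K0 := K0 isT.
rewrite expr2 -mulrA ler_wpM2l// mulr_sumr; apply: ler_sum => j _.
rewrite mulr_sumr; apply: ler_sum => l _.
by rewrite ler_wpM2r ?sqr_ge0.
Qed.

End schur_test.

Section stein_bound_explicit.
Context d (T : measurableType d) (R : realType) (P : probability T R).
Context (n : nat) (X : 'I_n -> T -> R) (C : 'I_n -> 'I_n -> R).
Hypothesis gX : gaussian_vector P X C.

Lemma stein_bound_explicit (a K s : R) (h : R -> R) :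
  continuous h -> (forall x, 0 <= h x <= 1) ->
  (forall i, \sum_j `|C i j| <= K) -> 0 < s ->
  8 * a ^+ 4 * K ^+ 2 * (\sum_i \sum_j C i j ^+ 2) <= s ^+ 2 ->
  `|\int[P]_w h (a * (sqnorm X w - \sum_i C i i)) -
    \int[lebesgue_measure]_x (h x * normal_pdf 0 1 x)| <=
  2 * (`|1 - 2 * a ^+ 2 * \sum_i \sum_j C i j ^+ 2| + s).
Proof.
move=> ch h01 CK s0 hs; apply: le_trans (stein_bound gX a ch h01) _.
rewrite ler_pM2l//.
set N2 := \sum_i \sum_j C i j ^+ 2 in hs *.
have [iQ2 EQ2] := integral_qform2 gX.
have iQ := itg_qform gX; have mQ := itg_measurable iQ.
have EQ := integral_qform gX.
pose Y w := 2 * a ^+ 2 * (N2 - qform X C w).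
have mY : measurable_fun [set: T] Y.
  by apply: measurable_funM => //; exact: measurable_funB.
have YE w : Y w ^+ 2 = 4 * a ^+ 4 * (qform X C w ^+ 2 - 2 * N2 * qform X C w + N2 ^+ 2).
  by rewrite /Y; ring.
have i1 : itg P (fun w => qform X C w ^+ 2 - 2 * N2 * qform X C w + N2 ^+ 2).
  by apply: itgD; [apply: itgB => //; exact: itgZ|exact: itg_cst].
have iY2 : itg P (fun w => Y w ^+ 2).
  have := itgZ (4 * a ^+ 4) i1.
  by congr (integrable _ _ _); apply/funext => w /=; rewrite YE.
have EY2 : \int[P]_w (Y w ^+ 2) <= s ^+ 2.
  under eq_Rintegral do rewrite YE.
  rewrite RintegralZl//.
  have -> : \int[P]_w (qform X C w ^+ 2 - 2 * N2 * qform X C w + N2 ^+ 2) =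
      2 * \sum_i \sum_l (\sum_j C i j * C j l) ^+ 2.
    rewrite RintegralD//; [|by apply: itgB => //; exact: itgZ|exact: itg_cst].
    rewrite RintegralB//; last exact: itgZ.
    by rewrite RintegralZl// Rintegral_prob_cst EQ2 EQ -/N2; ring.
  apply: le_trans hs.
  have := schur_test (gv_sym gX) CK; rewrite -/N2 => hst.
  have a4 : 0 <= 8 * a ^+ 4 by rewrite mulr_ge0// exprn_even_ge0.
  have := ler_wpM2l a4 hst; lra.
have [iY EY] := Rintegral_norm_le_sqrt s0 mY iY2 EY2.
apply: (@le_trans _ _ (\int[P]_w (`|1 - 2 * a ^+ 2 * N2| + `|Y w|))).
  apply: le_Rintegral => //.
  - by apply: itg_norm; apply: itgB; [exact: itg_cst|exact: itgZ].
  - by apply: itgD; [exact: itg_cst|exact: itg_norm].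
  - move=> w _; apply: le_trans (ler_normD _ _); rewrite /Y le_eqVlt; apply/orP; left.
    by apply/eqP; congr (`|_|); ring.
rewrite RintegralD//; [|exact: itg_cst|exact: itg_norm].
by rewrite Rintegral_prob_cst lerD2l.
Qed.

End stein_bound_explicit.

(** * From continuous test functions to the two modes of convergence *)

Section from_smooth_to_kolmogorov.
Context d (T : measurableType d) d' (T' : measurableType d') (R : realType).
Context (P : probability T R) (Q : probability T' R).
Notation mu := (@lebesgue_measure R).
Notation phi := (normal_pdf (0 : R) 1).

Definition gauss_mean (h : R -> R) : R := \int[mu]_x (h x * phi x).

Let phi_ge0 x : 0 <= phi x := normal_pdf_ge0 0 1 x.

Let phi_le1 x : phi x <= 1.
Proof.
apply: le_trans (normal_pdf_ub _ _ _) _; first exact: oner_neq0.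
rewrite /normal_peak invf_le1; last first.
  by rewrite sqrtr_gt0 expr1n mul1r mulrn_wgt0// pi_gt0.
rewrite -[leLHS]sqrtr1 ler_sqrt expr1n mul1r.
  by have := pi_ge2 R; rewrite mulr2n; lra.
by rewrite mulrn_wge0// pi_ge0.
Qed.

Let iphi : itg mu phi. Proof. exact: integrable_normal_pdf. Qed.
Let mphi : measurable_fun [set: R] phi. Proof. exact: measurable_normal_pdf. Qed.

(** A continuous approximation of the indicator of [x <= z], equal to it except
    between [z] and [z + e]. *)
Definition ramp (z e x : R) : R := Num.max 0 (Num.min 1 (1 - (x - z) / e)).

Lemma ramp01 z e x : 0 <= ramp z e x <= 1.
Proof. by rewrite /ramp le_max lexx /= ge_max ler01 /= ge_min lexx. Qed.

Lemma ramp1 z e x : 0 < e -> x <= z -> ramp z e x = 1.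
Proof.
move=> e0 xz; rewrite /ramp min_l ?max_r//.
by rewrite lerBrDr gerDl pmulr_lle0 ?invr_gt0// subr_le0.
Qed.

Lemma ramp0 z e x : 0 < e -> z + e <= x -> ramp z e x = 0.
Proof.
move=> e0 xz; rewrite /ramp max_l// ge_min; apply/orP; right.
by rewrite subr_le0 ler_pdivlMr// mul1r lerBrDl.
Qed.

Lemma continuous_ramp z e : continuous (ramp z e).
Proof.
move=> x.
pose k : R -> R^o := fun x => 1 - (x - z) / e.
have ck : {for x, continuous k}.
  apply: cvgB; first exact: cvg_cst.
  apply: cvgM; last exact: cvg_cst.
  by apply: cvgB; [exact: cvg_id|exact: cvg_cst].
have c0 : {for x, continuous ((fun=> 0) : R -> R^o)} by exact: cvg_cst.
have c1 : {for x, continuous ((fun=> 1) : R -> R^o)} by exact: cvg_cst.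
exact: (continuous_max c0 (continuous_min c1 ck)).
Qed.

Let ihphi (h : R -> R) : measurable_fun [set: R] h -> (forall x, 0 <= h x <= 1) ->
  itg mu (fun x => h x * phi x).
Proof.
move=> mh h01; apply: (@itg_dom _ _ _ mu _ phi) => // [|x].
  exact: measurable_funM.
rewrite normrM (ger0_norm (phi_ge0 _)) ler_piMl//.
by have /andP[? ?] := h01 x; rewrite ger0_norm.
Qed.

Let ind (z x : R) : R := \1_`]-oo, z] x.

Let mind z : measurable_fun [set: R] (ind z).
Proof. by apply: measurable_indic. Qed.

Let ind01 z x : 0 <= ind z x <= 1.
Proof. by rewrite /ind indicE; case: (_ \in _); rewrite ?lexx ?ler01. Qed.

Let indE z x : ind z x = (x <= z)%R%:R.
Proof. by rewrite /ind indicE mem_setE in_itv. Qed.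

Let small_interval z e : 0 < e -> \int[mu]_x (\1_`]z, z + e] x : R) = e /\
  itg mu (\1_`]z, z + e] : R -> R).
Proof.
move=> e0; have m : mu `]z, z + e] = e%:E.
  by rewrite lebesgue_measure_itv /= lte_fin ltrDl e0 -EFinD addrAC subrr add0r.
split; first by rewrite /Rintegral integral_indic// setIT [X in fine X]m.
apply/integrableP; split; first exact/measurable_EFinP/measurable_indic.
under eq_integral do rewrite /= ger0_norm//.
by rewrite integral_indic// setIT [X in (X < _)%E]m ltry.
Qed.

Let gauss_mean_le (h k : R -> R) z e : 0 < e ->
  measurable_fun [set: R] h -> (forall x, 0 <= h x <= 1) ->
  measurable_fun [set: R] k -> (forall x, 0 <= k x <= 1) ->
  (forall x, h x <= k x + \1_`]z, z + e] x) -> gauss_mean h <= gauss_mean k + e.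
Proof.
move=> e0 mh h01 mk k01 hk; have [E I] := small_interval z e0.
rewrite /gauss_mean -[X in _ + X]E -RintegralD//; last exact: ihphi.
apply: le_Rintegral => //; first exact: ihphi.
  by apply: itgD => //; exact: ihphi.
move=> x _; apply: (@le_trans _ _ ((k x + \1_`]z, z + e] x) * phi x)).
  by rewrite ler_wpM2r.
rewrite mulrDl lerD2l ler_piMr//.
Qed.

(** The indicator of [x <= z] lies between the ramps starting at [z - e] and at
    [z]. Their Gaussian means differ from its own by at most [e], because the
    density is at most [1]. *)
Lemma dKol_le (U : {RV P >-> R}) (V : {RV Q >-> R}) (D : R) :
  has_law V (normal_prob 0 1) ->
  (forall h : R -> R, continuous h -> (forall x, 0 <= h x <= 1) ->
    `|\int[P]_w h (U w) - gauss_mean h| <= D) ->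
  (dKol U V <= D%:E)%E.
Proof.
move=> Vlaw hD; apply: ge_ereal_sup => _ [z _ <-].
have iU : itg P (fun w => ind z (U w)).
  apply: (@itg_bounded _ _ _ P _ 1).
    exact: (measurableT_comp (mind z) (measurable_funPT U)).
  by move=> w; have /andP[? ?] := ind01 z (U w); rewrite ger0_norm.
have cU : cdf U z = (\int[P]_w ind z (U w))%:E.
  rewrite /Rintegral fineK; last exact: integrable_fin_num.
  rewrite /cdf /distribution /pushforward.
  transitivity (\int[P]_w (\1_(U @^-1` `]-oo, z]%classic) w)%:E)%E; last by [].
  by rewrite integral_indic ?setIT// -[X in measurable X]setTI; exact: (measurable_funPT U).
have cV : cdf V z = (gauss_mean (ind z))%:E.
  rewrite /cdf Vlaw// /normal_prob /gauss_mean /Rintegral fineK; last first.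
    apply: integrable_fin_num => //; exact: ihphi.
  transitivity (\int[mu]_(x in `]-oo, z]) (phi x)%:E)%E; first by [].
  rewrite [LHS]integral_mkcond; apply: eq_integral => x _.
  rewrite patchE indE mem_setE in_itv /=; case: (x <= z); rewrite ?mul1r ?mul0r//.
rewrite cU cV -EFinB abse_EFin lee_fin; apply/ler_addgt0Pr => e e0.
have mh z' : measurable_fun [set: R] (ramp z' e).
  by apply: continuous_measurable_fun; exact: continuous_ramp.
have iR z' : itg P (fun w => ramp z' e (U w)).
  apply: (@itg_bounded _ _ _ P _ 1).
    exact: (measurableT_comp (mh z') (measurable_funPT U)).
  by move=> w; have /andP[? ?] := ramp01 z' e (U w); rewrite ger0_norm.
have D1 := hD _ (@continuous_ramp z e) (ramp01 z e).
have D2 := hD _ (@continuous_ramp (z - e) e) (ramp01 (z - e) e).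
have U1 : \int[P]_w ind z (U w) <= \int[P]_w ramp z e (U w).
  apply: le_Rintegral => // w _; rewrite indE.
  have /andP[r0 r1] := ramp01 z e (U w).
  by case: (leP (U w) z) => h; rewrite ?mulr0n// ramp1.
have U2 : \int[P]_w ramp (z - e) e (U w) <= \int[P]_w ind z (U w).
  apply: le_Rintegral => // w _; rewrite indE.
  have /andP[r0 r1] := ramp01 (z - e) e (U w).
  by case: (leP (U w) z) => h; rewrite ?mulr1n// ramp0// subrK ltW.
have G1 : gauss_mean (ramp z e) <= gauss_mean (ind z) + e.
  apply: (@gauss_mean_le _ _ z) => // [|x]; first exact: ramp01.
  have /andP[r0 r1] := ramp01 z e x.
  rewrite indE indicE mem_setE in_itv /=; case: (leP x z) => /= h.
    by rewrite mulr0n addr0.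
  rewrite mulr0n add0r; case: (leP x (z + e)) => h2; first by rewrite mulr1n.
  by rewrite mulr0n ramp0// ltW.
have G2 : gauss_mean (ind z) <= gauss_mean (ramp (z - e) e) + e.
  apply: (@gauss_mean_le _ _ (z - e)) => // [|x]; first exact: ramp01.
  rewrite indE indicE mem_setE in_itv /= subrK; have /andP[r0 r1] := ramp01 (z - e) e x.
  case: (leP x (z - e)) => /= h.
    by rewrite ramp1// mulr0n addr0; case: (x <= z); rewrite ?mulr1n ?mulr0n.
  by case: (x <= z); rewrite /= ?mulr1n ?mulr0n ?lerDr ?addr0.
move: D1 D2; rewrite !ler_norml => /andP[? ?] /andP[? ?].
by apply/andP; split; lra.
Qed.

(** An affine map gives a bounded function values in [0, 1]. *)
Lemma cvg_in_law_of_bound (U : nat -> {RV P >-> R}) (V : {RV Q >-> R}) (D : nat -> R) :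
  has_law V (normal_prob 0 1) -> D n @[n --> \oo] --> 0 ->
  (forall h : R -> R, continuous h -> (forall x, 0 <= h x <= 1) ->
    \forall n \near \oo, `|\int[P]_w h (U n w) - gauss_mean h| <= D n) ->
  cvg_in_law U V.
Proof.
move=> Vlaw D0 hD f cf [M0 [_ fM0]].
pose M := `|M0| + 1.
have M_gt0 : 0 < M by rewrite ltr_wpDl.
have fM x : `|f x| <= M.
  by apply: fM0 => //; rewrite /M (le_lt_trans (ler_norm _))// ltrDl.
have mf : measurable_fun [set: R] f by exact: continuous_measurable_fun.
pose h x := (f x + M) / (2 * M).
have M2 : 0 < 2 * M by rewrite mulr_gt0.
have h01 x : 0 <= h x <= 1.
  have := fM x; rewrite ler_norml => /andP[f1 f2].
  apply/andP; split; first by apply: divr_ge0; [lra|exact: ltW].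
  by rewrite ler_pdivrMr// mul1r; lra.
have ch : continuous h.
  move=> x; apply: cvgM; last exact: cvg_cst.
  by apply: cvgD; [exact: cf|exact: cvg_cst].
have fE x : f x = 2 * M * h x - M by rewrite /h; field; rewrite gt_eqF.
have mh : measurable_fun [set: R] h by exact: continuous_measurable_fun.
have ih (d0 : measure_display) (T0 : measurableType d0) (P0 : probability T0 R) (W : {RV P0 >-> R}) :
    itg P0 (fun w => h (W w)).
  apply: (@itg_bounded _ _ _ P0 _ 1).
    exact: (measurableT_comp mh (measurable_funPT W)).
  by move=> w; have /andP[? ?] := h01 (W w); rewrite ger0_norm.
have Ef (d0 : measure_display) (T0 : measurableType d0) (P0 : probability T0 R) (W : {RV P0 >-> R}) :
    'E_P0[f \o W]%E = (2 * M * \int[P0]_w h (W w) - M)%:E.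
  have e : 2 * M * \int[P0]_w h (W w) - M = \int[P0]_w f (W w).
    transitivity (\int[P0]_w (2 * M * h (W w) - M)); last first.
      by apply: eq_Rintegral => w _; rewrite fE.
    rewrite RintegralB//; [|exact/itgZ/ih|exact: itg_cst].
    by rewrite (RintegralZl _ measurableT (ih _ _ _ W)) Rintegral_prob_cst.
  rewrite e unlock /Rintegral fineK//; apply: integrable_fin_num => //.
  apply: (@itg_bounded _ _ _ P0 _ M) => [|w]; last exact: fM.
  exact: (measurableT_comp mf (measurable_funPT W)).
have EV : \int[Q]_w h (V w) = gauss_mean h.
  have hb x : `|h x| <= 1 * (1 + x ^+ 4).
    have /andP[? ?] := h01 x; rewrite ger0_norm// mul1r.
    by apply: (@le_trans _ _ 1) => //; rewrite lerDl exprn_even_ge0.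
  rewrite (@Rintegral_has_law _ _ _ Q V (standard_normal R)) /gauss_mean.
  - by rewrite (Rintegral_standard_normal mh hb).
  - exact: Vlaw.
  - exact: (itg_standard_normal mh hb).
rewrite Ef EV; under eq_fun do rewrite Ef.
apply/fine_cvgP; split; first exact: nearW.
rewrite /comp /=.
apply: cvgB; last exact: cvg_cst.
apply: cvgM; first exact: cvg_cst.
apply/cvgrPdist_le => e e0.
have hn := hD h ch h01.
have /cvgrPdist_le/(_ _ e0) hD0 := D0.
near=> n.
have h1 : `|\int[P]_w h (U n w) - gauss_mean h| <= D n by near: n.
have h2 : `|0 - D n| <= e by near: n.
rewrite distrC; apply: le_trans h1 _; move: h2; rewrite sub0r normrN.
exact: le_trans (ler_norm _).
Unshelve. all: by end_near. Qed.

End from_smooth_to_kolmogorov.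

(** * Correlation of the increments *)

Section power_functions.
Context (R : realType).
Implicit Types x y r : R.

Lemma ler_powR2r r x y : 0 <= r -> 0 <= x -> x <= y -> x `^ r <= y `^ r.
Proof.
by move=> r0 x0 xy; apply: (ge0_ler_powR r0) => //; rewrite nnegrE// (le_trans x0).
Qed.

Lemma le0_ler_powR r x y : r <= 0 -> 0 < x -> x <= y -> y `^ r <= x `^ r.
Proof.
move=> r0 x0 xy; have y0 : 0 < y by exact: lt_le_trans xy.
rewrite -[r]opprK (powRN y (- r)) (powRN x (- r)) lef_pV2 ?posrE ?powR_gt0//.
by apply: ler_powR2r => //; [rewrite oppr_ge0|exact: ltW].
Qed.

Lemma powR_mean_value r x y : 0 < x -> x < y ->
  exists2 z, x < z < y & y `^ r - x `^ r = r * z `^ (r - 1) * (y - x).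
Proof.
move=> x0 xy.
have D (z : R) : z \in `]x, y[%R -> is_derive z (1 : R) (fun t : R => t `^ r) (r * z `^ (r - 1)).
  by rewrite in_itv /= => /andP[xz _]; apply: is_derive1_powR; exact: lt_trans xz.
have [|z zxy ->] := @MVT R (fun t => t `^ r) (fun z => r * z `^ (r - 1)) x y xy D.
  apply: derivable_within_continuous => z; rewrite in_itv /= => /andP[xz _].
  by case: (@is_derive1_powR R r z (lt_le_trans x0 xz)).
by exists z; first by move: zxy; rewrite in_itv.
Qed.

(** The mean value theorem for [t |-> (t + 1)^r - t^r], then for its
    derivative. *)
Lemma powR_second_difference r x : 1 < x ->
  exists2 z, x - 1 < z < x + 1 &
    (x + 1) `^ r - 2 * x `^ r + (x - 1) `^ r = r * (r - 1) * z `^ (r - 2).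
Proof.
move=> x1.
pose G t := (t + 1) `^ r - t `^ r.
pose dG t := r * (t + 1) `^ (r - 1) - r * t `^ (r - 1).
have D (z : R) : 0 < z -> is_derive z (1 : R) G (dG z).
  move=> z0; have z1 : 0 < z + 1 by rewrite addr_gt0.
  have D1 := @is_derive1_powR R r z z0.
  have D2 : is_derive (z + 1) (1 : R) (fun t : R => t `^ r) (r * (z + 1) `^ (r - 1)).
    exact: is_derive1_powR.
  have D3 : is_derive z (1 : R) (fun t : R => t + 1) 1.
    by apply: is_derive_eq; rewrite addr0.
  have D4 := @is_derive1_comp _ (fun t : R => t `^ r) (fun t : R => t + 1) z _ _ D2 D3.
  have := is_deriveB D4 D1.
  by rewrite mulr1.
have x01 : 0 < x - 1 by rewrite subr_gt0.
have xx : x - 1 < x by rewrite ltrBlDr ltrDl.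
have [||c cx Gc] := @MVT R G dG (x - 1) x xx.
- move=> z; rewrite in_itv /= => /andP[xz _]; apply: D; exact: lt_trans xz.
- apply: derivable_within_continuous => z; rewrite in_itv /= => /andP[xz _].
  by case: (D z (lt_le_trans x01 xz)).
move: cx; rewrite in_itv /= => /andP[c1 c2].
have c0 : 0 < c by exact: lt_trans c1.
have cc : c < c + 1 by rewrite ltrDl.
have [z /andP[z1 z2] zE] := powR_mean_value (r - 1) c0 cc.
exists z; first by apply/andP; split; lra.
have e : x - (x - 1) = 1 by ring.
move: Gc; rewrite e mulr1 /G subrK => Gc.
have -> : (x + 1) `^ r - 2 * x `^ r + (x - 1) `^ r =
    (x + 1) `^ r - x `^ r - (x `^ r - (x - 1) `^ r) by ring.
rewrite Gc /dG -mulrBr zE.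
have -> : r - 1 - 1 = r - 2 by ring.
by ring.
Qed.

End power_functions.

Section increment_covariance.
Context (R : realType) (H : R).
Hypothesis H_gt0 : 0 < H.
Hypothesis H_lt : H < 3 / 4.

Notation p := (2 * H).

(** The correlation of two unit increments at distance [r], that is, the
    covariance of fractional Gaussian noise. *)
Definition rho (r : nat) : R :=
  (r.+1%:R `^ (2 * H) + `|r%:R - 1| `^ (2 * H) - 2 * r%:R `^ (2 * H)) / 2.

Let p_gt0 : 0 < p. Proof. by rewrite mulr_gt0. Qed.
Let p_lt : p < 3 / 2. Proof. by move: H_lt; lra. Qed.
Let p_neq0 : p != 0. Proof. by rewrite gt_eqF. Qed.

Lemma rho0 : rho 0 = 1.
Proof. by rewrite /rho powR1 sub0r normrN1 powR1 powR0// mulr0 subr0 -mulr2n divff. Qed.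

Let g (r : nat) : R := r%:R `^ p.

Lemma rhoS r : rho r.+1 = ((g r.+2 - g r.+1) - (g r.+1 - g r)) / 2.
Proof.
have e : (r.+1%:R - 1 : R) = r%:R by rewrite -[r.+1%:R]natr1 addrK.
rewrite /rho /g e ger0_norm//.
congr (_ / _); ring.
Qed.

Lemma rho_mean_value r : (2 <= r)%N ->
  exists2 z, r%:R / 2 <= z & rho r = p * (p - 1) / 2 * z `^ (p - 2).
Proof.
case: r => [//|[//|r]] _.
have x1 : (1 : R) < r.+2%:R by rewrite ltr1n.
have [z /andP[z1 z2] zE] := powR_second_difference p x1.
exists z.
  have : (2 : R) <= r.+2%:R by rewrite ler_nat.
  by move: z1; lra.
rewrite rhoS /g.
have e1 : (r.+3%:R : R) = r.+2%:R + 1 by rewrite natr1.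
have e2 : (r.+1%:R : R) = r.+2%:R - 1 by rewrite -[r.+2%:R]natr1 addrK.
rewrite e1 e2.
have -> : ((r.+2%:R + 1) `^ p - r.+2%:R `^ p - (r.+2%:R `^ p - (r.+2%:R - 1) `^ p)) / 2 =
  ((r.+2%:R + 1) `^ p - 2 * r.+2%:R `^ p + (r.+2%:R - 1) `^ p) / 2 by ring.
by rewrite zE; ring.
Qed.

Lemma rho_le r : (2 <= r)%N ->
  `|rho r| <= `|p * (p - 1) / 2| * 2^-1 `^ (p - 2) * r%:R `^ (p - 2).
Proof.
move=> r2; have [z rz ->] := rho_mean_value r2.
have r0 : 0 < r%:R / 2 :> R by rewrite divr_gt0// ltr0n (leq_trans _ r2).
rewrite normrM -[leRHS]mulrA ler_wpM2l// -powRM// ?invr_ge0//.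
have p2 : p - 2 <= 0 by move: p_lt; lra.
rewrite (ger0_norm (powR_ge0 _ _)) [2^-1 * _]mulrC.
exact: (le0_ler_powR p2 r0 rz).
Qed.

Lemma rho_sign : (forall r, (2 <= r)%N -> 0 <= rho r) /\ 1 <= p \/
  (forall r, (2 <= r)%N -> rho r <= 0) /\ p <= 1.
Proof.
have [p1|p1] := leP 1 p; [left|right]; split => //; last exact: ltW.
  move=> r /rho_mean_value[z _ ->].
  apply: mulr_ge0; last exact: powR_ge0.
  by apply: divr_ge0 => //; apply: mulr_ge0; [exact: ltW|rewrite subr_ge0].
move=> r /rho_mean_value[z _ ->].
apply: mulr_le0_ge0; last exact: powR_ge0.
by rewrite pmulr_lle0 ?invr_gt0// pmulr_rle0// subr_le0 ltW.
Qed.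

Lemma rho1_le : `|rho 1| <= 1.
Proof.
rewrite rhoS /g powR1 powR0//.
have one2 : (1 : R) <= 2 by rewrite ler1n.
have h1 : (1 : R) <= 2 `^ p by have := ler_powR one2 (ltW p_gt0); rewrite powRr0.
have h2 : (2 : R) `^ p <= 4.
  have -> : (4 : R) = 2 `^ 2 by rewrite powR_mulrn//; ring.
  by apply: (ler_powR one2); move: p_lt; lra.
by rewrite ler_norml; apply/andP; split; lra.
Qed.

Let m := Num.max 0 (p - 1).

Let sum_rho n : \sum_(2 <= r < n.+2) rho r = ((g n.+2 - g n.+1) - (g 2 - g 1)) / 2.
Proof.
elim: n => [|n IH]; first by rewrite big_geq// subrr mul0r.
by rewrite big_nat_recr//= IH rhoS; ring.
Qed.

(** The constant sign lets the sum telescope to first differences of [r^(2H)].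
    This treats alike the cases [H < 1/2], [H = 1/2] and [H > 1/2], in which the
    sums of [r^(2H - 2)] grow differently. *)
Lemma sum_abs_rho_le n : (0 < n)%N -> \sum_(2 <= r < n) `|rho r| <= n%:R `^ m.
Proof.
case: n => [//|[|n]] _; first by rewrite big_geq// powR_ge0.
have g12 : g 1 <= g 2 by apply: ler_powR2r; rewrite ?ler_nat// ltW.
have gn : g n.+1 <= g n.+2 by apply: ler_powR2r; rewrite ?ler_nat// ltW.
have nx : (n.+1%:R : R) < n.+2%:R by rewrite ltr_nat.
have n1 : (0 : R) < n.+1%:R by rewrite ltr0n.
case: rho_sign => -[rs p1].
  rewrite (eq_big_nat _ _ (F2 := rho)); last by move=> r /andP[r2 _]; rewrite ger0_norm// rs.
  rewrite sum_rho /m max_r ?subr_ge0//.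
  have [z /andP[z1 z2] zE] := powR_mean_value p n1 nx.
  have zn : z `^ (p - 1) <= n.+2%:R `^ (p - 1).
    by apply: ler_powR2r; rewrite ?subr_ge0// ltW// (lt_trans n1).
  have e : (n.+2%:R - n.+1%:R : R) = 1 by rewrite -[n.+2%:R]natr1 addrAC subrr add0r.
  move: zE; rewrite e mulr1 -/(g _) -/(g _) => zE.
  have z0 : 0 <= z `^ (p - 1) by rewrite powR_ge0.
  have : p * z `^ (p - 1) <= 2 * n.+2%:R `^ (p - 1).
    by apply: ler_pM => //; [exact: ltW|move: p_lt; lra].
  by lra.
rewrite (eq_big_nat _ _ (F2 := fun r => - rho r)); last by move=> r /andP[r2 _]; rewrite ler0_norm// rs.
rewrite sumrN sum_rho /m max_l ?subr_le0// powRr0.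
have : g 2 <= 2.
  have one2 : (1 : R) <= 2 by rewrite ler1n.
  by have := ler_powR one2 p1; rewrite powRr1.
have : 0 <= g 1 by rewrite powR_ge0.
by lra.
Qed.

Definition row_bound (n : nat) : R := 5 * n%:R `^ m.

Lemma row_bound_le n : (0 < n)%N -> 1 + 2 * \sum_(1 <= r < n) `|rho r| <= row_bound n.
Proof.
move=> n0; have n1 : (1 : R) <= n%:R `^ m.
  have n1 : (1 : R) <= n%:R by rewrite ler1n.
  by have := @ler_powR _ _ n1 0 m; rewrite powRr0; apply; rewrite /m le_max lexx.
case: n n0 n1 => [//|[|n]] _ n1; rewrite /row_bound; first by rewrite big_geq// mulr0 addr0; lra.
rewrite big_ltn//; have := @sum_abs_rho_le n.+2 isT; have := rho1_le; lra.
Qed.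

(** The exponent of [n] in the theorem. *)
Definition rate : R := Num.min (1 / 2) (3 / 2 - 2 * H).

Lemma rate_gt0 : 0 < rate.
Proof. by rewrite /rate lt_min; apply/andP; split; move: p_lt; lra. Qed.

Lemma rate_le : rate <= 1 / 2. Proof. by rewrite /rate ge_min lexx. Qed.

Lemma row_bound_rate n : (0 < n)%N -> row_bound n / Num.sqrt n%:R = 5 / n%:R `^ rate.
Proof.
move=> n0; have nn : (n%:R != 0 :> R) by rewrite pnatr_eq0 -lt0n.
rewrite /row_bound -powR12_sqrt// -!powRN -!mulrA -powRD; last by rewrite nn implybT.
congr (_ * (_ `^ _)); rewrite /m /rate.
have [h|h] := leP 0 (p - 1); have [h'|h'] := leP (1 / 2) (3 / 2 - p); by lra.
Qed.

(** The summand is of order [r^(- 1 - dl)] with [dl = 3 - 4H - rate], and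
    [dl > 0] since [rate <= 3/2 - 2H] and [H < 3/4]. *)
Lemma weighted_rho2_summable : exists A : R, forall N,
  \sum_(r < N) r.+1%:R `^ rate * rho r.+1 ^+ 2 <= A.
Proof.
pose A := `|p * (p - 1) / 2| * 2^-1 `^ (p - 2).
pose dl := 3 - 2 * p - rate.
have rate2 : rate <= 3 / 2 - p by rewrite /rate ge_min lexx orbT.
have dl0 : 0 < dl by rewrite /dl; move: p_lt; lra.
have A0 : 0 <= A by rewrite mulr_ge0 ?powR_ge0.
exists (1 + A ^+ 2 / dl).
have term r : r.+2%:R `^ rate * rho r.+2 ^+ 2 <=
    A ^+ 2 / dl * (r.+1%:R `^ (- dl) - r.+2%:R `^ (- dl)).
  have r0 : (0 : R) < r.+1%:R by rewrite ltr0n.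
  have rr : (r.+1%:R : R) < r.+2%:R by rewrite ltr_nat.
  have r20 : (0 : R) < r.+2%:R by rewrite ltr0n.
  apply: (@le_trans _ _ (A ^+ 2 * r.+2%:R `^ (- dl - 1))).
    have := @rho_le r.+2 isT; rewrite -/A => h.
    have h2 : rho r.+2 ^+ 2 <= A ^+ 2 * r.+2%:R `^ (2 * (p - 2)).
      rewrite -(real_normK (num_real (rho r.+2))) [2 * _]mulrC powRrM powR_mulrn ?powR_ge0//.
      rewrite -exprMn; apply: lerXn2r; rewrite ?nnegrE//.
      by apply: mulr_ge0 => //; exact: powR_ge0.
    apply: le_trans (ler_wpM2l (powR_ge0 _ _) h2) _.
    rewrite mulrCA -powRD; last by rewrite pnatr_eq0 implybT.
    by rewrite le_eqVlt; apply/orP; left; apply/eqP; congr (_ * _ `^ _); rewrite /dl; ring.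
  have [z /andP[z1 z2] zE] := powR_mean_value (- dl) r0 rr.
  have e : (r.+2%:R - r.+1%:R : R) = 1 by rewrite -[r.+2%:R]natr1 addrAC subrr add0r.
  rewrite e mulr1 in zE.
  rewrite -[_ `^ _ - _ `^ _]opprB zE -mulrA ler_wpM2l ?sqr_ge0//.
  have -> : dl^-1 * - (- dl * z `^ (- dl - 1)) = z `^ (- dl - 1) by field; rewrite gt_eqF.
  apply: le0_ler_powR; [by move: dl0; lra|exact: lt_trans z1|exact: ltW].
have tel N : \sum_(r < N) r.+2%:R `^ rate * rho r.+2 ^+ 2 <=
    A ^+ 2 / dl * (1 - N.+1%:R `^ (- dl)).
  elim: N => [|N IH]; first by rewrite big_ord0 powR1 subrr mulr0.
  rewrite big_ord_recr /=; apply: le_trans (lerD IH (term N)) _.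
  by rewrite le_eqVlt; apply/orP; left; apply/eqP; ring.
have B0 : 0 <= A ^+ 2 / dl by rewrite divr_ge0 ?sqr_ge0// ltW.
case=> [|N]; first by rewrite big_ord0 addr_ge0.
rewrite big_ord_recl /= powR1 mul1r; apply: lerD.
  by rewrite -(real_normK (num_real (rho 1))) exprn_ile1// rho1_le.
apply: le_trans (tel N) _; rewrite ler_piMr// gerBl powR_ge0//.
Qed.

Definition rho2_sum (N : nat) : R := \sum_(r < N) rho r.+1 ^+ 2.

(** In the tail beyond [N] the weight [r^rate] is at least [(N + 1)^rate]. *)
Lemma rho2_sum_tail : exists2 L : R, rho2_sum N @[N --> \oo] --> L &
  exists2 A : R, 0 <= A & forall N, 0 <= L - rho2_sum N <= A / N.+1%:R `^ rate.
Proof.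
have [A hA] := weighted_rho2_summable.
have A0 : 0 <= A by have := hA 0%N; rewrite big_ord0.
have Qnd : nondecreasing_seq rho2_sum.
  apply/nondecreasing_seqP => N; rewrite /rho2_sum big_ord_recr /= lerDl; exact: sqr_ge0.
have QD N k : rho2_sum (N + k) - rho2_sum N <= A / N.+1%:R `^ rate.
  have n0 : 0 < N.+1%:R `^ rate :> R by rewrite powR_gt0.
  rewrite ler_pdivlMr// mulrC.
  apply: le_trans (hA (N + k)%N); rewrite /rho2_sum big_split_ord /= addrAC subrr add0r.
  rewrite [leRHS]big_split_ord /= ler_wpDl//.
    by apply: sumr_ge0 => i _; rewrite mulr_ge0 ?powR_ge0 ?sqr_ge0.
  rewrite mulr_sumr; apply: ler_sum => i _; rewrite ler_wpM2r ?sqr_ge0//.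
  apply: ler_powR2r => //; first exact: ltW rate_gt0.
  by rewrite ler_nat ltnS leq_addr.
have Qub : has_ubound (range rho2_sum).
  exists (A / 1%:R `^ rate) => _ [N _ <-].
  by have := QD 0%N N; rewrite add0n /rho2_sum [X in _ - X]big_ord0 subr0.
have cQ := nondecreasing_is_cvgn Qnd Qub.
exists (limn rho2_sum); first exact: cQ.
exists A => // N; apply/andP; split.
  by rewrite subr_ge0; exact: nondecreasing_cvgn_le.
rewrite lerBlDr; apply: limr_le => //; near=> M.
have NM : (N <= M)%N by near: M; exact: nbhs_infty_ge.
by have := QD N (M - N)%N; rewrite subnKC// lerBlDr.
Unshelve. all: by end_near. Qed.

Lemma sum_powR_rate n : \sum_(i < n) (i.+1%:R `^ rate)^-1 <= 2 * n%:R `^ (1 - rate).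
Proof.
have r1 := rate_le; have r0 := rate_gt0.
elim: n => [|n IH]; first by rewrite big_ord0 mulr_ge0 ?powR_ge0.
rewrite big_ord_recr /=; apply: le_trans (lerD IH (lexx _)) _.
case: n {IH} => [|n].
  rewrite powR1 powR0; last by rewrite gt_eqF//; lra.
  by rewrite mulr0 add0r invr1; lra.
have x0 : (0 : R) < n.+1%:R by rewrite ltr0n.
have xy : (n.+1%:R : R) < n.+2%:R by rewrite ltr_nat.
have [z /andP[z1 z2] zE] := powR_mean_value (1 - rate) x0 xy.
have e : (n.+2%:R - n.+1%:R : R) = 1 by rewrite -[n.+2%:R]natr1 addrAC subrr add0r.
rewrite e mulr1 in zE.
have h : n.+2%:R `^ (1 - rate - 1) <= z `^ (1 - rate - 1).
  by apply: le0_ler_powR; [lra|exact: lt_trans z1|exact: ltW].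
have e2 : 1 - rate - 1 = - rate by ring.
rewrite e2 in h zE; rewrite -powRN.
have z0 : 0 <= z `^ (- rate) by rewrite powR_ge0.
have : z `^ (- rate) <= 2 * ((1 - rate) * z `^ (- rate)).
  by rewrite mulrA ler_peMl//; lra.
rewrite -zE; lra.
Qed.

End increment_covariance.

(** * The limiting variance and the error terms *)

Section toeplitz_sums.
Context (R : realType).

Definition ndist (i j : nat) : nat := (i - j + (j - i))%N.

Lemma ndistC i j : ndist i j = ndist j i.
Proof. by rewrite /ndist addnC. Qed.

(** The distances from [i] to the indices below it are [1, ..., i], and to those
    above it [1, ..., n - i - 1]. *)
Lemma sum_ndist (f : nat -> R) n i : (i < n)%N ->
  \sum_(j < n) f (ndist i j) =
  f 0%N + \sum_(r < i) f r.+1 + \sum_(r < n - i.+1) f r.+1.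
Proof.
move=> ilen; rewrite -(big_mkord xpredT (fun j => f (ndist i j))).
rewrite (big_cat_nat (n := i)) ?(ltnW ilen)//= [X in _ + X]big_ltn//.
have -> : \sum_(0 <= j < i) f (ndist i j) = \sum_(r < i) f r.+1.
  rewrite big_nat_rev big_mkord; apply: eq_bigr => r _; congr f.
  by rewrite /ndist; have := ltn_ord r; lia.
have -> : \sum_(i.+1 <= j < n) f (ndist i j) = \sum_(r < n - i.+1) f r.+1.
  rewrite -{1}[i.+1]add0n big_addn big_mkord; apply: eq_bigr => r _; congr f.
  by rewrite /ndist; lia.
by rewrite {1}/ndist subnn addn0; ring.
Qed.

End toeplitz_sums.

Section covariance_matrix.
Context (R : realType) (H : R).
Hypothesis H_gt0 : 0 < H.
Hypothesis H_lt : H < 3 / 4.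

Definition cov (n : nat) (i j : 'I_n) : R := rho H (ndist i j).

Lemma cov_sym n (i j : 'I_n) : cov i j = cov j i.
Proof. by rewrite /cov ndistC. Qed.

Lemma cov_trace n : \sum_(i < n) cov i i = n%:R.
Proof.
rewrite (eq_bigr (fun=> 1)); first by rewrite sumr_const card_ord.
by move=> i _; rewrite /cov /ndist subnn addn0 rho0.
Qed.

Lemma cov_row_sum n (i : 'I_n) : \sum_j `|cov i j| <= row_bound H n.
Proof.
have n0 : (0 < n)%N by apply: leq_ltn_trans (ltn_ord i).
apply: le_trans (row_bound_le H_gt0 H_lt n0).
rewrite /cov (@sum_ndist _ (fun r => `|rho H r|))// rho0// normr1.
have le k : (k < n)%N -> \sum_(r < k) `|rho H r.+1| <= \sum_(1 <= r < n) `|rho H r|.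
  move=> kn; rewrite big_add1 big_mkord.
  rewrite -(big_mkord xpredT (fun r => `|rho H r.+1|)) -(big_mkord xpredT (fun r => `|rho H r.+1|)).
  have kn' : (k <= n.-1)%N by rewrite -ltnS prednK.
  by rewrite [leRHS](big_cat_nat (leq0n k) kn')//= lerDl sumr_ge0.
have h1 := le i (ltn_ord i).
have h2 : \sum_(r < n - i.+1) `|rho H r.+1| <= \sum_(1 <= r < n) `|rho H r|.
  by apply: le; rewrite ltn_subrL n0.
lra.
Qed.

Lemma cov_square_sum n : \sum_(i < n) \sum_(j < n) cov i j ^+ 2 =
  n%:R + 2 * \sum_(i < n) rho2_sum H i.
Proof.
have row (i : 'I_n) : \sum_(j < n) cov i j ^+ 2 = 1 + rho2_sum H i + rho2_sum H (n - i.+1).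
  by rewrite /cov (@sum_ndist _ (fun r => rho H r ^+ 2))// rho0// expr1n.
rewrite (eq_bigr _ (fun i _ => row i)) !big_split /= sumr_const card_ord.
have -> : \sum_(i < n) rho2_sum H (n - i.+1) = \sum_(i < n) rho2_sum H i.
  by rewrite [RHS](reindex_inj rev_ord_inj).
by ring.
Qed.

Variable L : R.
Hypothesis QL : rho2_sum H N @[N --> \oo] --> L.

Let cvg_series (u : nat -> R) (l : R) : (forall n, 0 <= u n) ->
  (\sum_(i < n) u i) @[n --> \oo] --> l ->
  \esum_(i in [set: nat]) (u i)%:E = l%:E.
Proof.
move=> u0 ul; rewrite -nneseries_esumT; last by move=> n; rewrite lee_fin.
apply/cvg_lim => //.
have -> : (fun n => (\sum_(0 <= i < n) (u i)%:E)%E) = (fun n => (\sum_(i < n) u i)%R%:E).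
  by apply/funext => n; rewrite sumEFin big_mkord.
by apply/fine_cvgP; split; [exact: nearW|exact: ul].
Qed.

(** The summand at [t] is [4 rho(|t|)^2]; split the integers by sign. *)
Lemma sigma2_value : sigma2 H = (2 * (1 + 2 * L))%:E.
Proof.
rewrite /sigma2.
set F := fun t : int => _.
have F0 t : (0 <= F t)%E by rewrite lee_fin sqr_ge0.
have FP (n : nat) : F (Posz n) = (4 * rho H n ^+ 2)%:E.
  rewrite /F /rho; congr EFin.
  rewrite -[(Posz n)%:~R]/(n%:R) natr1 (ger0_norm (ler0n R n.+1)) (ger0_norm (ler0n R n)); by field.
have FN (n : nat) : F (Negz n) = (4 * rho H n.+1 ^+ 2)%:E.
  rewrite /F; congr EFin; rewrite NegzE mulrNz -[(Posz n.+1)%:~R]/(n.+1%:R).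
  have e1 : - n.+1%:R + 1 = - n%:R :> R by rewrite -[n.+1%:R]natr1; ring.
  have e2 : - n.+1%:R - 1 = - n.+2%:R :> R by rewrite -[n.+2%:R]natr1; ring.
  have e3 : n.+1%:R - 1 = n%:R :> R by rewrite -[n.+1%:R]natr1; ring.
  rewrite e1 e2 !normrN /rho e3 !(ger0_norm (ler0n R _)); by field.
have -> : (\esum_(t in [set: int]) F t = \esum_(n in [set: nat]) F (Posz n) +
    \esum_(n in [set: nat]) F (Negz n))%E.
  rewrite (esumID (range Posz))// setTI setTI; congr (_ + _)%E.
    apply: reindex_esum; split; [by move=> n _; exists n|by move=> i j _ _ []|by []].
  apply: reindex_esum; split.
  - by move=> n _ [m _].
  - by move=> i j _ _ [].
  - by move=> [n|n] /= h; [exfalso; apply: h; exists n|exists n].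
have e1 : \esum_(n in [set: nat]) F (Posz n) = (4 * (1 + L))%:E.
  rewrite (eq_esum (b := fun n => (4 * rho H n ^+ 2)%:E)); last by move=> n _; exact: FP.
  apply: cvg_series => [n|]; first by rewrite mulr_ge0// sqr_ge0.
  rewrite -(cvg_shiftS (fun n => \sum_(i < n) 4 * rho H i ^+ 2)).
  under eq_fun do rewrite big_ord_recl rho0// expr1n -mulr_sumr -mulrDr.
  apply: cvgM; first exact: cvg_cst.
  by apply: cvgD; [exact: cvg_cst|exact: QL].
have e2 : \esum_(n in [set: nat]) F (Negz n) = (4 * L)%:E.
  rewrite (eq_esum (b := fun n => (4 * rho H n.+1 ^+ 2)%:E)); last by move=> n _; exact: FN.
  apply: cvg_series => [n|]; first by rewrite mulr_ge0// sqr_ge0.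
  under eq_fun do rewrite -mulr_sumr.
  by apply: cvgM; [exact: cvg_cst|exact: QL].
by rewrite e1 e2 -EFinD -EFinM; congr EFin; field.
Qed.

Lemma sigma2_gt0 : 0 <= L -> 0 < sigma H /\ sigma H ^+ 2 = 2 * (1 + 2 * L).
Proof.
move=> L0; rewrite /sigma sigma2_value /=.
have h : 0 < 2 * (1 + 2 * L) by lra.
by rewrite sqrtr_gt0 sqr_sqrtr// ltW.
Qed.

End covariance_matrix.

Section error_terms.
Context (R : realType) (H : R).
Hypothesis H_gt0 : 0 < H.
Hypothesis H_lt : H < 3 / 4.

Definition qvar_scale (n : nat) : R := (sigma H * Num.sqrt n%:R)^-1.

Definition fluctuation_bound (n : nat) : R :=
  2 * row_bound H n / (sigma H * Num.sqrt n%:R).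

(** The error on the mean is [2 / (1 + 2 L)] times the average of the tails
    [L - rho2_sum i] over [i < n], and each tail is [O(i^- rate)]. The fluctuation
    is of the order of [row_bound n / sqrt n]. *)
Lemma error_terms : (sigma2 H < +oo)%E /\ exists c : R, forall n, (0 < n)%N ->
  [/\ 0 < fluctuation_bound n,
     8 * qvar_scale n ^+ 4 * row_bound H n ^+ 2 * (\sum_(i < n) \sum_(j < n) cov H i j ^+ 2)
       <= fluctuation_bound n ^+ 2 &
     2 * (`|1 - 2 * qvar_scale n ^+ 2 * \sum_(i < n) \sum_(j < n) cov H i j ^+ 2| +
        fluctuation_bound n) <= c / n%:R `^ rate H].
Proof.
have [L QL [A A0 hA]] := rho2_sum_tail H_gt0 H_lt.
have L0 : 0 <= L by have /andP[] := hA 0%N; rewrite /rho2_sum big_ord0 subr0.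
have [s0 s2] := sigma2_gt0 H_gt0 QL L0.
split; first by rewrite (sigma2_value H_gt0 QL) ltry.
exists (8 * A + 20 / sigma H) => n n0.
have nR : 0 < n%:R :> R by rewrite ltr0n.
have sn0 : 0 < Num.sqrt n%:R :> R by rewrite sqrtr_gt0.
have sn2 : Num.sqrt n%:R ^+ 2 = n%:R :> R by rewrite sqr_sqrtr// ltW.
have nb : 0 < n%:R `^ rate H by rewrite powR_gt0.
have K0 : 0 < row_bound H n by rewrite /row_bound mulr_gt0// powR_gt0.
have f0 : 0 < fluctuation_bound n.
  by rewrite /fluctuation_bound; apply: divr_gt0; exact: mulr_gt0.
have QiL i : rho2_sum H i <= L by have /andP[] := hA i; rewrite subr_ge0.
have sumQ : \sum_(i < n) rho2_sum H i <= n%:R * L.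
  have -> : n%:R * L = \sum_(i < n) L by rewrite sumr_const card_ord mulr_natl.
  by apply: ler_sum.
have a2 : qvar_scale n ^+ 2 = (2 * (1 + 2 * L) * n%:R)^-1.
  by rewrite /qvar_scale exprVn exprMn s2 sn2.
have L1 : 0 < 1 + 2 * L by lra.
have fE : fluctuation_bound n ^+ 2 = 4 * row_bound H n ^+ 2 * qvar_scale n ^+ 2.
  by rewrite /fluctuation_bound /qvar_scale exprMn exprMn; ring.
split => //.
- have -> : 8 * qvar_scale n ^+ 4 * row_bound H n ^+ 2 *
     (\sum_(i < n) \sum_(j < n) cov H i j ^+ 2) =
     4 * row_bound H n ^+ 2 * qvar_scale n ^+ 2 *
     (2 * qvar_scale n ^+ 2 * (\sum_(i < n) \sum_(j < n) cov H i j ^+ 2)) by ring.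
  rewrite fE ler_piMr//; first by rewrite mulr_ge0 ?sqr_ge0// mulr_ge0// sqr_ge0.
  rewrite cov_square_sum// a2.
  have -> : 2 * (2 * (1 + 2 * L) * n%:R)^-1 * (n%:R + 2 * \sum_(i < n) rho2_sum H i) =
    (n%:R + 2 * \sum_(i < n) rho2_sum H i) / ((1 + 2 * L) * n%:R).
    by field; rewrite !gt_eqF.
  rewrite ler_pdivrMr ?mulr_gt0// mul1r; lra.
- have e1 : 1 - 2 * qvar_scale n ^+ 2 * \sum_(i < n) \sum_(j < n) cov H i j ^+ 2 =
      2 / ((1 + 2 * L) * n%:R) * \sum_(i < n) (L - rho2_sum H i).
    rewrite cov_square_sum// a2 sumrB sumr_const card_ord -[L *+ n]mulr_natl.
    by field; rewrite !gt_eqF.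
  have sumL : 0 <= \sum_(i < n) (L - rho2_sum H i) by apply: sumr_ge0 => i _; rewrite subr_ge0.
  rewrite e1 ger0_norm; last by rewrite mulr_ge0// divr_ge0// mulr_ge0// ltW.
  have sumL2 : \sum_(i < n) (L - rho2_sum H i) <= A * (2 * n%:R `^ (1 - rate H)).
    apply: (@le_trans _ _ (\sum_(i < n) A / i.+1%:R `^ rate H)).
      by apply: ler_sum => i _; have /andP[] := hA i.
    by rewrite -mulr_sumr ler_wpM2l//; exact: sum_powR_rate.
  have nE : n%:R `^ (1 - rate H) = n%:R / n%:R `^ rate H.
    rewrite powRB; last by rewrite (gt_eqF nR) implybT.
    by rewrite powRr1// ltW.
  have b1 : 2 / ((1 + 2 * L) * n%:R) * \sum_(i < n) (L - rho2_sum H i) <= 4 * A / n%:R `^ rate H.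
    apply: (@le_trans _ _ (2 / n%:R * \sum_(i < n) (L - rho2_sum H i))).
      rewrite ler_wpM2r// ler_wpM2l// lef_pV2 ?posrE ?mulr_gt0//.
      by apply: ler_peMl; [exact: ltW|lra].
    apply: le_trans (ler_wpM2l _ sumL2) _; first by rewrite divr_ge0// ltW.
    rewrite nE le_eqVlt; apply/orP; left; apply/eqP; field.
    by rewrite !gt_eqF.
  have b2 : fluctuation_bound n = 10 / sigma H / n%:R `^ rate H.
    have h := row_bound_rate H n0.
    have -> : fluctuation_bound n = 2 / sigma H * (row_bound H n / Num.sqrt n%:R).
      by rewrite /fluctuation_bound; field; rewrite !gt_eqF.
    by rewrite h; ring.
  rewrite b2 [leRHS]mulrDl.
  have -> : 20 / sigma H / n%:R `^ rate H = 2 * (10 / sigma H / n%:R `^ rate H) by ring.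
  have -> : 8 * A / n%:R `^ rate H = 2 * (4 * A / n%:R `^ rate H) by ring.
  lra.
Qed.

End error_terms.

(** * Increments of fractional Brownian motion *)

Section fractional_increments.
Context d (T : measurableType d) (R : realType) (P : probability T R).
Context (H : R) (B : R -> {RV P >-> R}).
Hypothesis fB : fractional_brownian_motion H B.

Let H01 : 0 < H < 1 := fbm_index fB.
Notation p := (2 * H).

Let mfun_sumE m (f : 'I_m -> {mfun T >-> R}) w :
  (\sum_(i < m) f i : {mfun T >-> R}) w = \sum_(i < m) f i w.
Proof. by apply: (big_morph (fun g : {mfun T >-> R} => g w)). Qed.

Let combination m (a : 'I_m -> R) (t : 'I_m -> R) : {RV P >-> R} :=
  \sum_(i < m) (a i \o* B (t i) : {mfun T >-> R}).

Let combinationE m (a : 'I_m -> R) (t : 'I_m -> R) w :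
  combination a t w = \sum_(i < m) a i * B (t i) w.
Proof. by rewrite /combination mfun_sumE; apply: eq_bigr => i _ /=; rewrite mulrC. Qed.

Lemma fbm_moment4 t : t \in `[0, 1] -> has_moment4 P (B t).
Proof.
move=> t01; split; first exact: measurable_funPT.
have := @fbm_gaussian _ _ _ _ _ _ fB 1 (fun=> 1) (fun=> t) (fun=> t01).
move=> /centered_gaussian[].
  have -> : (\sum_(i < 1) (1 \o* B t : {mfun T >-> R}) : T -> R) = B t.
    by apply/funext => w; rewrite mfun_sumE big_ord1 /= mulr1.
  exact: fbm_centered fB t t01.
move=> h _; move: h; congr (integrable _ _ _); apply/funext => w /=.
by rewrite mfun_sumE big_ord1 /= mulr1.
Qed.

(** Every linear combination of values of the motion is a centered Gaussian
    variable. *)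
Lemma fbm_combination m (a : 'I_m -> R) (t : 'I_m -> R) :
  (forall i, t i \in `[0, 1]) ->
  itg P (fun w => (\sum_(i < m) a i * B (t i) w) ^+ 4) /\
  \int[P]_w cos (\sum_(i < m) a i * B (t i) w) =
    expR (- (\int[P]_w ((\sum_(i < m) a i * B (t i) w) ^+ 2) / 2)).
Proof.
move=> t01.
have iB i : itg P (fun w => a i * B (t i) w).
  by apply: itgZ; exact: itg_moment4 (fbm_moment4 (t01 i)).
have E0 : 'E_P[combination a t]%E = 0%E.
  rewrite unlock.
  have -> : (\int[P]_w (combination a t w)%:E = (\int[P]_w (\sum_(i < m) a i * B (t i) w))%R%:E)%E.
    rewrite /Rintegral fineK; last by apply: integrable_fin_num => //; exact: itg_sum.
    by apply: eq_integral => w _; rewrite combinationE.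
  rewrite Rintegral_sum// big1// => i _.
  rewrite RintegralZl//; last exact: itg_moment4 (fbm_moment4 (t01 i)).
  by have := fbm_centered fB (t01 i); rewrite unlock /Rintegral => ->; rewrite mulr0.
have [h1 h2] := centered_gaussian (@fbm_gaussian _ _ _ _ _ _ fB m a t t01) E0.
have e' w : combination a t w = \sum_(i < m) a i * B (t i) w by rewrite combinationE.
split.
  by move: h1; congr (integrable _ _ _); apply/funext => w /=; rewrite -e'.
under eq_Rintegral do rewrite -e'.
under [X in X / 2]eq_Rintegral do rewrite -e'.
exact: h2.
Qed.

Lemma fbm_product s t : s \in `[0, 1] -> t \in `[0, 1] ->
  \int[P]_w (B s w * B t w) = 2^-1 * (t `^ p + s `^ p - `|t - s| `^ p).
Proof.
by move=> s01 t01; rewrite /Rintegral; have := fbm_covariance fB s01 t01; rewrite unlock => ->.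
Qed.

Variable n : nat.
Hypothesis n0 : (0 < n)%N.

Let grid (k : nat) : R := k%:R / n%:R.

Let nR : 0 < n%:R :> R. Proof. by rewrite ltr0n. Qed.

Let grid01 k : (k <= n)%N -> grid k \in `[0, 1].
Proof.
move=> kn; rewrite in_itv /= divr_ge0 ?ler0n//= ler_pdivrMr// mul1r ler_nat//.
Qed.

Definition fbm_increment (i : 'I_n) (w : T) : R :=
  n%:R `^ H * (B (i.+1%:R / n%:R) w - B (i%:R / n%:R) w).

Notation X := fbm_increment.

Let XE i w : X i w = n%:R `^ H * (B (grid i.+1) w - B (grid i) w).
Proof. by []. Qed.

Let iBB k l : (k <= n)%N -> (l <= n)%N -> itg P (fun w => B (grid k) w * B (grid l) w).
Proof. by move=> kn ln; apply: itg_mul2; exact/fbm_moment4/grid01. Qed.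

Let EBB k l : (k <= n)%N -> (l <= n)%N ->
  n%:R `^ p * \int[P]_w (B (grid k) w * B (grid l) w) =
  2^-1 * (l%:R `^ p + k%:R `^ p - `|l%:R - k%:R| `^ p).
Proof.
move=> kn ln; rewrite fbm_product ?grid01// /grid.
have -> : l%:R / n%:R - k%:R / n%:R = (l%:R - k%:R) / n%:R :> R by rewrite mulrBl.
rewrite normrM normfV (gtr0_norm nR) !powRM// ?invr_ge0 ?ler0n//.
have e : n%:R `^ p * n%:R^-1 `^ p = 1 :> R.
  by rewrite -powRM ?invr_ge0 ?ler0n// divff ?gt_eqF// powR1.
transitivity (2^-1 * (l%:R `^ p + k%:R `^ p - `|l%:R - k%:R| `^ p) * (n%:R `^ p * n%:R^-1 `^ p)).
  by ring.
by rewrite e mulr1.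
Qed.

Let nH2 : n%:R `^ H * n%:R `^ H = n%:R `^ p :> R.
Proof.
rewrite -powRD; last by rewrite (gt_eqF nR) implybT.
by congr (powR _ _); ring.
Qed.

Lemma increment_covariance i j :
  itg P (fun w => X i w * X j w) /\ \int[P]_w (X i w * X j w) = cov H i j.
Proof.
have XX w : X i w * X j w = n%:R `^ p *
   (B (grid i.+1) w * B (grid j.+1) w - B (grid i.+1) w * B (grid j) w
    - B (grid i) w * B (grid j.+1) w + B (grid i) w * B (grid j) w).
  by rewrite !XE -nH2; ring.
have [i1 i2 j1 j2] : [/\ (i.+1 <= n)%N, (i <= n)%N, (j.+1 <= n)%N & (j <= n)%N].
  by split=> //; exact: ltnW.
have h1 := iBB i1 j1; have h2 := iBB i1 j2; have h3 := iBB i2 j1; have h4 := iBB i2 j2.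
have h : itg P (fun w => B (grid i.+1) w * B (grid j.+1) w - B (grid i.+1) w * B (grid j) w
    - B (grid i) w * B (grid j.+1) w + B (grid i) w * B (grid j) w).
  by apply: itgD => //; apply: itgB => //; exact: itgB.
split.
  by move: (itgZ (n%:R `^ p) h); congr (integrable _ _ _); apply/funext => w /=; rewrite XX.
under eq_Rintegral do rewrite XX.
rewrite RintegralZl// RintegralD//; last by apply: itgB => //; exact: itgB.
rewrite RintegralB//; last exact: itgB.
rewrite RintegralB// mulrDr !mulrBr !EBB//.
rewrite /cov /rho /ndist.
have e (k : nat) : (k.+1%:R : R) = k%:R + 1 by rewrite natr1.
wlog ji : i j {XX i1 i2 j1 j2 h1 h2 h3 h4 h} / (j <= i)%N.
  move=> hw; case: (leqP j i) => [/hw//|/ltnW/hw hji].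
  rewrite [(i - j + _)%N]addnC -hji.
  by rewrite !(distrC _ i%:R) (distrC j%:R) !(distrC _ i.+1%:R); ring.
have -> : (i - j + (j - i) = i - j)%N by lia.
have e1 : (i - j)%:R = i%:R - j%:R :> R by rewrite natrB.
have ij0 : 0 <= i%:R - j%:R :> R by rewrite -e1 ler0n.
have -> : `|j.+1%:R - i.+1%:R| = i%:R - j%:R :> R.
  by rewrite !e distrC -(ger0_norm ij0); congr (`|_|); ring.
have -> : `|j%:R - i.+1%:R| = (i - j).+1%:R :> R.
  rewrite !e e1 distrC -(ger0_norm (_ : 0 <= i%:R - j%:R + 1)); last by rewrite addr_ge0.
  by congr (`|_|); ring.
have -> : `|j.+1%:R - i%:R| = `|(i - j)%:R - 1| :> R.
  by rewrite e e1 distrC; congr (`|_|); ring.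
have -> : `|j%:R - i%:R| = i%:R - j%:R :> R by rewrite distrC ger0_norm.
by rewrite e1; field.
Qed.

(** A combination of [n] increments is a combination of [2 n] values of the
    motion. *)
Lemma gaussian_fbm_increments : gaussian_vector P X (cov H (n := n)).
Proof.
have mX i : measurable_fun [set: T] (X i).
  by apply: measurable_funM => //; apply: measurable_funB; exact: measurable_funPT.
pose u (k : 'I_(n + n)) : R :=
  match fintype.split k with inl i => grid i.+1 | inr i => grid i end.
pose b (a : 'I_n -> R) (k : 'I_(n + n)) : R :=
  match fintype.split k with inl i => a i * n%:R `^ H | inr i => - (a i * n%:R `^ H) end.
have u01 k : u k \in `[0, 1].
  by rewrite /u; case: fintype.split => i; apply: grid01 => //; exact: ltnW.
have linE a w : \sum_k b a k * B (u k) w = linear_form X a w.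
  rewrite big_split_ord /= /linear_form -big_split /=; apply: eq_bigr => i _.
  have e1 : fintype.split (lshift n i) = inl i := unsplitK (inl i).
  have e2 : fintype.split (rshift n i) = inr i := unsplitK (inr i).
  by rewrite /b /u e1 e2 XE; ring.
split => //; last 2 first.
- by move=> i j; exact: cov_sym.
- move=> a; have [_] := fbm_combination (b a) u01.
  under eq_Rintegral do rewrite linE.
  move=> ->; congr (expR (- (_ / 2))).
  under eq_Rintegral do rewrite linE.
  have e w : linear_form X a w ^+ 2 = \sum_i \sum_j a i * a j * (X i w * X j w).
    rewrite expr2 /linear_form mulr_suml; apply: eq_bigr => i _.
    by rewrite mulr_sumr; apply: eq_bigr => j _; ring.
  have iXX i j : itg P (fun w => a i * a j * (X i w * X j w)).
    by apply: itgZ; exact: (increment_covariance i j).1.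
  under eq_Rintegral do rewrite e.
  rewrite Rintegral_sum; last by move=> i; apply: itg_sum.
  apply: eq_bigr => i _; rewrite Rintegral_sum//; apply: eq_bigr => j _.
  have [h1 h2] := increment_covariance i j.
  by rewrite RintegralZl// h2.
- move=> a; have [h _] := fbm_combination (b a) u01.
  by move: h; congr (integrable _ _ _); apply/funext => w /=; rewrite linE.
Qed.

Lemma normalized_qvarE w : normalized_qvar H B n w =
  qvar_scale H n * (sqnorm X w - \sum_(i < n) cov H i i).
Proof.
rewrite /normalized_qvar cov_trace; last by have /andP[] := H01.
congr (_ * _); rewrite sumrB sumr_const card_ord; congr (_ - _).
by apply: eq_bigr => i _; rewrite /fbm_increment exprMn -nH2 expr2.
Qed.

End fractional_increments.

Theorem theorem1p6 (R : realType) (H : R) (hH : 0 < H < 3 / 4) :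
  [/\ (sigma2 H < +oo)%E,
      (forall (d : measure_display) (T : measurableType d)
          (P : probability T R) (B : R -> {RV P >-> R})
          (d' : measure_display) (T' : measurableType d')
          (Q : probability T' R) (Z : {RV Q >-> R}),
        fractional_brownian_motion H B -> has_law Z (normal_prob 0 1) ->
        cvg_in_law (P := P) (Q := Q) (fun n => normalized_qvar H B n) Z)
    & (exists c : R,
        forall (d : measure_display) (T : measurableType d)
          (P : probability T R) (B : R -> {RV P >-> R})
          (d' : measure_display) (T' : measurableType d')
          (Q : probability T' R) (Z : {RV Q >-> R}),
        fractional_brownian_motion H B -> has_law Z (normal_prob 0 1) ->
        forall n : nat, (1 <= n)%N ->
        (dKol (P := P) (Q := Q) (normalized_qvar H B n) Z
          <= (c / n%:R `^ Num.min (1 / 2) (3 / 2 - 2 * H))%:E)%E)].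
Proof.
have /andP[H_gt0 H_lt] := hH.
have [sfin [c hc]] := error_terms H_gt0 H_lt.
have bound (d : measure_display) (T : measurableType d) (P : probability T R)
    (B : R -> {RV P >-> R}) (n : nat) (h : R -> R) :
    fractional_brownian_motion H B -> (0 < n)%N ->
    continuous h -> (forall x, 0 <= h x <= 1) ->
    `|\int[P]_w h (normalized_qvar H B n w) - gauss_mean h| <= c / n%:R `^ rate H.
  move=> fB n0 ch h01; have [f0 f1 f2] := hc n n0.
  apply: le_trans f2.
  have := stein_bound_explicit (gaussian_fbm_increments fB n0) ch h01
    (fun i => cov_row_sum H_gt0 H_lt i) f0 f1.
  by under eq_Rintegral do rewrite -normalized_qvarE//.
split => //.
- move=> d T P B d' T' Q Z fB Zlaw.
  apply: (@cvg_in_law_of_bound _ _ _ _ _ _ _ _ _ (fun n => c / n%:R `^ rate H) Zlaw).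
    apply/cvgrPdist_le => e e0; have r0 := rate_gt0 H_lt.
    near=> n; rewrite sub0r normrN normrM normfV (ger0_norm (powR_ge0 _ _)).
    have n0 : (0 < n)%N by near: n; exact: nbhs_infty_gt.
    rewrite ler_pdivrMr; last by rewrite powR_gt0// ltr0n.
    rewrite mulrC -ler_pdivrMr//.
    have hn : (`|c| / e) `^ (rate H)^-1 <= n%:R by near: n; exact: nbhs_infty_ger.
    have ce0 : 0 <= `|c| / e by rewrite divr_ge0// ltW.
    have := ler_powR2r (ltW r0) (powR_ge0 _ _) hn.
    by rewrite -powRrM mulVf ?gt_eqF// powRr1.
  move=> h ch h01; near=> n; apply: bound => //.
  by near: n; exact: nbhs_infty_gt.
- exists c => d T P B d' T' Q Z fB Zlaw n n1.
  apply: dKol_le => // h ch h01.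
  exact: bound.
Unshelve. all: by end_near. Qed.
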